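(* Assume the setup described in the context. Then the response-moment estimators defined there satisfy $$(\hat\theta_0,\hat\gamma^2,\hat\varphi)\ \xrightarrow{\ \mathrm p\ }\ (\theta_0^*,\gamma^2,\varphi).$$
   Context: **Setup.** Let $\rho(x)=\log(1+e^x)$, so $\rho'(x)=1/(1+e^{-x})$. Asymptotics are as $n\to\infty$ with $p=p_n$ and $p/n\to\kappa\in(0,1)$. For each $n$: $x_1,\dots,x_n\in\mathbb{R}^p$ are i.i.d. $N(0_p,p^{-1}I_p)$; $\varepsilon_1,\dots,\varepsilon_n$ are i.i.d. uniform on $[0,1]$, independent of all other randomness; $\beta_0,\beta_P\in\mathbb{R}^p$ and $\theta_0,\theta_P\in\mathbb{R}$ are (possibly random) sequences such that (a) with $\Gamma_p=\frac1p\begin{pmatrix}\|\beta_0\|_2^2&\langle\beta_0,\beta_P\rangle\\ \langle\beta_0,\beta_P\rangle&\|\beta_P\|_2^2\end{pmatrix}$ and a deterministic positive semidefinite $\Gamma=\begin{pmatrix}\gamma^2&\varphi\\ \varphi&\delta^2\end{pmatrix}$ ($\gamma,\delta\ge0$), there are constants $c_\Gamma,C_\Gamma>0$ and $n_0$ such that for all $n>n_0$, $t>0$: $\Pr(\|\Gamma_p-\Gamma\|_2>t)\le C_\Gamma\exp\{-c_\Gamma n\min(t^2,t)\}$; (b) almost surely $\frac1p\sum_{j=1}^p\delta_{(\beta_{0,j},\beta_{P,j})}$ converges in Wasserstein-2 distance to a deterministic distribution on $\mathbb{R}^2$; (c) there are deterministic $\theta_0^*,\theta_P^*$ and constants $c_\Theta,C_\Theta>0$,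 $n_0$ with $\Pr(\max\{|\theta_0-\theta_0^*|,|\theta_P-\theta_P^*|\}>t)\le C_\Theta\exp\{-c_\Theta nt^2\}$ for all $n>n_0$, $t>0$; (d) $(\theta_0,\theta_P,\beta_0,\beta_P)$ is jointly independent of $(x_i)_{i=1}^n$. Responses: $Y_i=\mathbf 1\{\varepsilon_i<\rho'(\theta_0+x_i^\top\beta_0)\}$. **Estimators.** For $Z\sim N(0,1)$ and $(\theta,g)\in\mathbb{R}\times[0,\infty)$ let $\pi(\theta,g)=\mathbb{E}[\rho'(\theta+gZ)]$, $c(\theta,g)=\mathbb{E}[\rho''(\theta+gZ)]$, $\zeta(\theta,g)=\mathbb{E}[Z\rho'(\theta+gZ)]=g\,c(\theta,g)$; the map $(\theta,g)\mapsto(\pi(\theta,g),\zeta(\theta,g))$ is injective on $\mathbb{R}\times[0,\infty)$. Let $\bar Y=\frac1n\sum_iY_i$, $\bar x=\frac1n\sum_ix_i$, $\hat\pi=\bar Y$, $\widehat{\zeta^2}=\frac{p}{n(n-1)}\sum_{i\ne j}Y_iY_jx_i^\top x_j$, $\hat\zeta=\{\max(\widehat{\zeta^2},0)\}^{1/2}$. Let $(\hat\theta_0,\hat\gamma)\in\mathbb{R}\times[0,\infty)$ be the unique solution of $\pi(\hat\theta_0,\hat\gamma)=\hat\pi$, $\zeta(\hat\theta_0,\hat\gamma)=\hat\zeta$ when it exists, and $(0,0)$ otherwise. Let $\delta_p=\|\beta_P\|_2/\sqrt p$, $\hat b=\frac1{n-1}\sum_{i=1}^n(Y_i-\bar Y)\,\beta_P^\top(x_i-\bar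 x)$, $\tilde\varphi=\hat b/c(\hat\theta_0,\hat\gamma)$ and $\hat\varphi=\mathrm{sign}(\tilde\varphi)\min\{|\tilde\varphi|,\hat\gamma\delta_p\}$. *)

(* Defs.v *)
From HB Require Import structures.
From mathcomp Require Import all_boot all_order all_algebra.
From mathcomp Require Import all_classical all_reals all_analysis.

Set Implicit Arguments.
Unset Strict Implicit.
Unset Printing Implicit Defensive.

Import Order.TTheory GRing.Theory Num.Theory.
Import numFieldNormedType.Exports.

Local Open Scope classical_set_scope.
Local Open Scope ring_scope.

Section LinearAlgebra.
Context {R : realType}.

(* The carrier for random vectors is [k.-tuple R], which has the product
   sigma-algebra; [vec] moves to row vectors for the algebra. *)
Definition vec k (t : k.-tuple R) : 'rV[R]_k := \row_j tnth t j.

Definition dot k (u v : 'rV[R]_k) : R := (u *m v^T) 0 0.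

(* Euclidean norm; the canonical norm on 'rV is the sup norm. *)
Definition l2norm k (u : 'rV[R]_k) : R := Num.sqrt (dot u u).

(* Spectral norm; [v *m M^T] is the transpose of M applied to v^T. *)
Definition opnorm2 k (M : 'M[R]_k) : R :=
  sup [set l2norm (v *m M^T) | v in [set v : 'rV[R]_k | l2norm v <= 1]].

Definition symmx2 (a b c : R) : 'M[R]_2 :=
  \matrix_(i, j) if i == j then (if i == 0 then a else c) else b.

Definition psdmx k (M : 'M[R]_k) : Prop :=
  M^T = M /\ forall v : 'rV[R]_k, 0 <= dot (v *m M) v.

Definition Gram2 k (b0 bP : 'rV[R]_k) : 'M[R]_2 :=
  k%:R^-1 *: symmx2 (l2norm b0 ^+ 2) (dot b0 bP) (l2norm bP ^+ 2).

End LinearAlgebra.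

Section Probability.
Context d (T : measurableType d) (R : realType) (P : probability T R).
Local Open Scope ereal_scope.

(* For a finite family, taking some of the A i equal to setT gives the product
   rule over all subfamilies. *)
Definition mutually_independent (I : finType) d' (U : measurableType d')
    (X : I -> T -> U) : Prop :=
  forall A : I -> set U, (forall i, measurable (A i)) ->
    P (\bigcap_i (X i @^-1` A i)) = \prod_(i : I) P (X i @^-1` A i).

Definition independent2 d1 (U : measurableType d1) d2 (V : measurableType d2)
    (X : T -> U) (Y : T -> V) : Prop :=
  forall (A : set U) (B : set V), measurable A -> measurable B ->
    P ((X @^-1` A) `&` (Y @^-1` B)) = P (X @^-1` A) * P (Y @^-1` B).

Definition has_law d' (U : measurableType d') (X : T -> U)
    (mu : set U -> \bar R) : Prop :=
  forall A : set U, measurable A -> P (X @^-1` A) = mu A.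

(* X ~ N(0, s^2 I_k): the law of X is the k-fold product of N(0, s^2), which is
   determined by its values on boxes. *)
Definition isotropic_gaussian k (s : R) (X : T -> k.-tuple R) : Prop :=
  forall A : 'I_k -> set R, (forall j, measurable (A j)) ->
    P [set w | forall j, A j (tnth (X w) j)] =
    \prod_(j < k) normal_prob 0%R s (A j).

Definition cvg_in_prob (V : normedModType R) (X : nat -> T -> V) (l : V) : Prop :=
  forall e : R, (0 < e)%R -> P [set w | (e < `|X n w - l|)%R] @[n --> \oo] --> 0.

End Probability.

Section Wasserstein.
Context {R : realType}.
Local Open Scope ereal_scope.

Definition couplings (mu nu : set (R * R) -> \bar R) :
    set (probability ((R * R) * (R * R))%type R) :=
  [set q | has_law q fst mu /\ has_law q snd nu].

Definition wasserstein2 (mu nu : set (R * R) -> \bar R) : \bar R :=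
  (ereal_inf [set \int[q]_z ((z.1.1 - z.2.1) ^+ 2 + (z.1.2 - z.2.2) ^+ 2)%:E
             | q in couplings mu nu]) `^ (2^-1).

(* For k = 0 this is the zero measure, which has no coupling with a probability,
   so the Wasserstein distance is then +oo. *)
Definition empirical2 k (a b : k.-tuple R) (A : set (R * R)) : \bar R :=
  (k%:R^-1)%:E * \sum_(j < k) \d_(tnth a j, tnth b j) A.

End Wasserstein.

Section Logistic.
Context {R : realType}.

Definition rho (x : R) : R := ln (1 + expR x).

Definition drho : R -> R := (rho^`())%classic.
Definition ddrho : R -> R := (rho^`(2))%classic.

(* The three moment maps of (theta, g): expectations over Z ~ N(0, 1). *)
Definition mom_pi (theta g : R) : R :=
  \int[normal_prob 0 1]_z (drho (theta + g * z)).

Definition mom_c (theta g : R) : R :=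
  \int[normal_prob 0 1]_z (ddrho (theta + g * z)).

Definition mom_zeta (theta g : R) : R :=
  \int[normal_prob 0 1]_z (z * drho (theta + g * z)).

Definition response k (eps theta0 : R) (x beta0 : 'rV[R]_k) : R :=
  if eps < drho (theta0 + dot x beta0) then 1 else 0.

End Logistic.

Section Estimators.
Context {R : realType} (n k : nat).
Variables (y : 'I_n -> R) (x : 'I_n -> 'rV[R]_k) (bP : 'rV[R]_k).

Definition ybar : R := n%:R^-1 * \sum_i y i.
Definition xbar : 'rV[R]_k := n%:R^-1 *: \sum_i x i.

Definition pi_hat : R := ybar.

Definition zeta2_hat : R :=
  k%:R / (n%:R * (n%:R - 1)) *
  \sum_(i < n) \sum_(j < n | i != j) y i * y j * dot (x i) (x j).

Definition zeta_hat : R := Num.sqrt (Num.max zeta2_hat 0).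

Definition moment_solution (s : R * R) : Prop :=
  [/\ 0 <= s.2, mom_pi s.1 s.2 = pi_hat & mom_zeta s.1 s.2 = zeta_hat].

Definition theta_gamma_hat : R * R := xget (0, 0) [set s | unique moment_solution s].

Definition theta0_hat : R := theta_gamma_hat.1.
Definition gamma_hat : R := theta_gamma_hat.2.

Definition delta_p : R := l2norm bP / Num.sqrt k%:R.

Definition b_hat : R :=
  (n%:R - 1)^-1 * \sum_i (y i - ybar) * dot bP (x i - xbar).

Definition phi_tilde : R := b_hat / mom_c theta0_hat gamma_hat.

Definition phi_hat : R :=
  Num.sg phi_tilde * Num.min `|phi_tilde| (gamma_hat * delta_p).

Definition response_moment_estimators : (R * R * R)%type :=
  (theta0_hat, gamma_hat ^+ 2, phi_hat).

End Estimators.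

(* Main.v *)
(* Write gp = |beta0| / sqrt p, and freeze the parameters, so that the pairs
   (eps_i, x_i) are i.i.d.  Since <b, x> has law N(0, |b|^2 / p), and by Stein's
   identity, E[Y_i] = pi (theta0, gp) and E[Y_i x_i] = c (theta0, gp) beta0 / p.
   Second moments, for zeta2_hat those of a U-statistic, then show that pi_hat,
   zeta2_hat and b_hat are within O(n^(-1/2)) of pi (theta0, gp), zeta (theta0, gp)^2
   and <beta0, betaP> / p * c (theta0, gp), uniformly over bounded parameters, and
   Fubini carries this over to random parameters.  By the concentration hypotheses
   and the Lipschitz continuity of the moment maps the targets are close to their
   values at (theta0s, gamma) and phi.

   It remains to invert (pi, zeta) continuously.  For fixed g, pi is increasing in
   theta; along a level curve of pi, zeta is increasing in g, because two response
   curves with the same mean cross exactly once.  This gives the inverse, its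
   continuity and its measurability.  Measurability cannot be skipped: P is
   unconstrained outside the sigma-algebra, so that even the deviation events of the
   spectral norm (measurable because the norm of a symmetric 2 x 2 matrix is at
   most t iff t^2 - M^2 is positive semidefinite) have to be shown measurable. *)

Require Import Defs.
From HB Require Import structures.
From mathcomp Require Import all_boot all_order all_algebra.
From mathcomp Require Import all_classical all_reals all_analysis.
From mathcomp Require Import measurable_realfun ring lra.

Set Implicit Arguments.
Unset Strict Implicit.
Unset Printing Implicit Defensive.

Import Order.TTheory GRing.Theory Num.Theory.
Import numFieldNormedType.Exports.

Local Open Scope classical_set_scope.
Local Open Scope ring_scope.

(** * The logistic function *)

(** Since p grows like n, errors must not accumulate over the coordinates. What prevents this is
    that the second-moment matrix of Y_i x_i is at most I / p: the linear part of the U-statistic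
    then costs 8 / n, and its degenerate part, which does pay a trace, costs 8 p / (n - 1)^2, still
    of order 1 / n. Freezing takes the place of conditioning: by independence the law of (sample,
    parameters) is a product, so a bound valid at every bounded parameter value can be integrated.
    Continuity at the limit is delicate in three places. Near gamma = 0 only gamma^2 is controlled,
    so errors of size s^2 in the square are traded for errors of size s. Truncating [zeta2_hat] at 0
    only brings it closer to its target, which is a square. Finally, positive semidefiniteness gives
    phi^2 <= gamma^2 delta^2, so phi lies in the limiting clipping interval and clipping does not
    bias it. The division by c is harmless because c is positive at the limit. *)

Section Logistic.
Context {R : realType}.
Implicit Types x y : R.

Lemma onePexpR_gt0 x : 0 < 1 + expR x.
Proof. by rewrite addr_gt0// expR_gt0. Qed.

Lemma onePexpR_neq0 x : 1 + expR x != 0.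
Proof. by rewrite gt_eqF// onePexpR_gt0. Qed.

Lemma is_derive_onePexpR x : is_derive x 1 (cst 1 + @expR R) (expR x).
Proof. by apply: is_derive_eq; rewrite add0r. Qed.

Lemma drhoE x : drho x = expR x / (1 + expR x).
Proof.
have h : is_derive ((cst 1 + @expR R) x) 1 (@ln R) (1 + expR x)^-1.
  exact: is_derive1_ln (onePexpR_gt0 x).
rewrite /drho derive1E /rho.
have -> : (fun x : R => ln (1 + expR x)) = @ln R \o (cst 1 + @expR R) by [].
have h2 := is_derive_onePexpR x.
by have h3 := is_derive1_comp h h2; rewrite derive_val mulrC.
Qed.

Lemma is_derive_drho x : is_derive x 1 (@drho R) (drho x * (1 - drho x)).
Proof.
have E : @drho R = cst 1 - (fun y => (1 + expR y)^-1).
  apply/funext => z; rewrite drhoE !fctE.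
  by have := onePexpR_neq0 z => ?; field.
have h0 := onePexpR_neq0 x; have h2 := is_derive_onePexpR x.
have h3 : is_derive x 1 (fun y => (1 + expR y)^-1) (- (1 + expR x) ^- 2 * expR x).
  exact: (is_deriveV (f := cst 1 + @expR R)).
by rewrite drhoE {1}E; apply: is_derive_eq; field.
Qed.

Lemma ddrhoE x : ddrho x = drho x * (1 - drho x).
Proof.
by rewrite /ddrho derive1nS /= derive1E; have := is_derive_drho x => ?; rewrite derive_val.
Qed.

End Logistic.

(* Conversion checks that unfold these derivatives practically diverge. *)
Opaque drho ddrho.

Section LogisticBounds.
Context {R : realType}.
Implicit Types x y : R.

Lemma drho_gt0 x : 0 < drho x.
Proof. by rewrite drhoE divr_gt0 ?expR_gt0 ?onePexpR_gt0. Qed.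

Lemma drho_lt1 x : drho x < 1.
Proof. by rewrite drhoE ltr_pdivrMr ?onePexpR_gt0// mul1r ltrDr. Qed.

Lemma continuous_drho : continuous (@drho R).
Proof.
move=> x; apply: differentiable_continuous; apply/derivable1_diffP.
by have [] := is_derive_drho x.
Qed.

Lemma drhoB x y : drho y - drho x =
  (expR y - expR x) / ((1 + expR x) * (1 + expR y)).
Proof.
by rewrite !drhoE; have := onePexpR_neq0 x; have := onePexpR_neq0 y => ? ?; field; apply/andP.
Qed.

Lemma drho_lt x y : x < y -> drho x < drho y.
Proof.
move=> xy; rewrite -subr_gt0 drhoB divr_gt0 ?mulr_gt0 ?onePexpR_gt0//.
by rewrite subr_gt0 ltr_expR.
Qed.

Lemma drho_lip x y : `|drho x - drho y| <= `|x - y|.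
Proof.
wlog xy : x y / x <= y.
  move=> h; case: (leP x y) => [|/ltW] xy; first exact: h.
  by rewrite distrC [leRHS]distrC; exact: h.
move: xy; rewrite le_eqVlt => /predU1P[->|xy]; first by rewrite !subrr.
rewrite distrC [leRHS]distrC !ger0_norm ?subr_ge0 ?(ltW xy) ?(ltW (drho_lt xy))//.
have [c _ ->] := MVT xy (fun z _ => is_derive_drho z)
  (continuous_subspaceT continuous_drho).
rewrite ler_piMl ?subr_ge0 ?(ltW xy)//.
have := drho_gt0 c; have := drho_lt1 c; nra.
Qed.

Lemma ddrho_gt0 x : 0 < ddrho x.
Proof. by rewrite ddrhoE mulr_gt0 ?drho_gt0// subr_gt0 drho_lt1. Qed.

Lemma ddrho_lt1 x : ddrho x < 1.
Proof. by rewrite ddrhoE; have := drho_gt0 x; have := drho_lt1 x; nra. Qed.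

(** On the unit interval a |-> a (1 - a) is 1-Lipschitz, its difference quotient being 1 - a - b, so
    the bound passes from [drho] to [ddrho]. *)
Lemma ddrho_lip x y : `|ddrho x - ddrho y| <= `|x - y|.
Proof.
apply: le_trans (drho_lip x y); rewrite !ddrhoE.
have := drho_gt0 x; have := drho_lt1 x; have := drho_gt0 y; have := drho_lt1 y.
move: (drho x) (drho y) => a b b1 b0 a1 a0.
have -> : a * (1 - a) - b * (1 - b) = (a - b) * (1 - a - b) by ring.
by rewrite normrM ler_piMr// ler_norml; apply/andP; split; lra.
Qed.

Lemma continuous_ddrho : continuous (@ddrho R).
Proof.
have -> : @ddrho R = (fun x => drho x * (1 - drho x)) by apply/funext => x; rewrite ddrhoE.
move=> x; apply: cvgM; first exact: continuous_drho.
by apply: cvgB; [exact: cvg_cst|exact: continuous_drho].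
Qed.

End LogisticBounds.

(** * Gaussian integrals on the line *)

Section DensityIntegral.
Local Open Scope ereal_scope.
Context d (T : measurableType d) (R : realType).
Variables (mu nu : {measure set T -> \bar R}) (p : T -> R).
Import HBNNSimple.

(** For indicators this is the hypothesis on [nu]; linearity gives simple functions, and monotone
    convergence, applied to both sides along the same approximation, gives the rest. *)
Lemma ge0_integral_density (f : T -> \bar R) :
  measurable_fun setT p -> (forall x, 0 <= p x)%R ->
  (forall A, measurable A -> nu A = \int[mu]_(x in A) (p x)%:E) ->
  measurable_fun setT f -> (forall x, 0 <= f x) ->
  \int[nu]_x f x = \int[mu]_x (f x * (p x)%:E).
Proof.
move=> /measurable_EFinP mp p0 nuE mf f0.
have {}p0 x : 0 <= (p x)%:E by rewrite lee_fin.
pose f_ := nnsfun_approx measurableT mf.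
have Hn n : \int[nu]_x (f_ n x)%:E = \int[mu]_x ((f_ n x)%:E * (p x)%:E).
  under [LHS]eq_integral do rewrite fimfunE -fsumEFin//.
  rewrite [LHS]ge0_integral_fsum//; last 2 first.
    - by move=> r; exact/measurable_EFinP/measurableT_comp.
    - by move=> k x _; rewrite EFinM nnfun_muleindic_ge0.
  under [RHS]eq_integral.
    move=> x _; rewrite fimfunE -fsumEFin// ge0_mule_fsuml; last first.
      by move=> r; rewrite EFinM nnfun_muleindic_ge0.
    over.
  rewrite [RHS]ge0_integral_fsum//; last 2 first.
    - by move=> r; apply: emeasurable_funM => //; exact/measurable_EFinP/measurableT_comp.
    - by move=> k x _; rewrite mule_ge0// EFinM nnfun_muleindic_ge0.
  apply: eq_fsbigr => r _.
  under [RHS]eq_integral do rewrite EFinM -muleA.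
  (* Scalars are pulled out only when nonnegative; a negative level has an empty preimage. *)
  have [r0|r0] := ltP r 0%R.
    have -> : (f_ n @^-1` [set r]) = set0.
      by apply/seteqP; split => x //= fr; have : (0 <= f_ n x)%R by []; rewrite fr leNgt r0.
    by rewrite !integral0_eq// => x _; rewrite indic0 ?mulr0 ?mul0e ?mule0.
  under [LHS]eq_integral do rewrite EFinM.
  have mA : measurable (f_ n @^-1` [set r]) by [].
  rewrite !ge0_integralZl//=; last 3 first.
    by apply: emeasurable_funM => //; exact/measurable_EFinP/measurable_indic.
    by move=> x _; rewrite mule_ge0.
    by apply/measurable_EFinP; exact: measurable_indic.
  congr (_ * _); rewrite integral_indic// setIT nuE// integral_mkcond.
  apply: eq_integral => x _; rewrite patchE indicE; case: ifPn => _.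
    by rewrite mul1e.
  by rewrite mul0e.
transitivity (limn (fun n => \int[nu]_x (f_ n x)%:E)).
  rewrite -monotone_convergence//=.
  - by apply: eq_integral => x _; apply/esym/cvg_lim => //=; exact: cvg_nnsfun_approx.
  - by move=> n; exact/measurable_EFinP/measurable_funTS.
  - by move=> n x _; rewrite lee_fin.
  - by move=> x _ i j ij; rewrite lee_fin; exact/lefP/nd_nnsfun_approx.
transitivity (limn (fun n => \int[mu]_x ((f_ n x)%:E * (p x)%:E))).
  by congr (limn _); apply/funext => n; exact: Hn.
rewrite -monotone_convergence//=.
- apply: eq_integral => x _; apply/cvg_lim => //=.
  by apply: cvgeZr => //; exact: cvg_nnsfun_approx.
- by move=> n; apply: emeasurable_funM => //; exact/measurable_EFinP/measurable_funTS.
- by move=> n x _; rewrite mule_ge0// lee_fin.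
- move=> x _ i j ij; rewrite lee_wpmul2r// lee_fin.
  exact/lefP/nd_nnsfun_approx.
Qed.

End DensityIntegral.

Section NormalIntegral.
Context {R : realType}.
Notation mu := (@lebesgue_measure R).
Implicit Types (m s a b : R).
Local Open Scope ereal_scope.

Lemma ge0_integral_normal_prob m s (f : R -> \bar R) :
  measurable_fun [set: R] f -> (forall x, 0 <= f x) ->
  \int[normal_prob m s]_x f x = \int[mu]_x (f x * (normal_pdf m s x)%:E).
Proof.
move=> mf f0; apply: (@ge0_integral_density _ (measurableTypeR R)) => //.
- exact: measurable_normal_pdf.
- by move=> x; exact: normal_pdf_ge0.
Qed.

End NormalIntegral.

Section NormalScale.
Context {R : realType}.
Notation mu := (@lebesgue_measure R).
Implicit Types (m s a b x : R).

Lemma normal_pdf_scale m s x : 0 < s ->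
  normal_pdf m s (m + s * x) * s = normal_pdf 0 1 x.
Proof.
move=> s0; rewrite !normal_pdfE ?oner_eq0 ?gt_eqF//.
have -> : normal_fun m s (m + s * x) = normal_fun 0 1 x.
  rewrite /normal_fun; congr expR.
  by rewrite subr0 addrC addKr expr1n -mulr_natr; have := s0; rewrite lt0r => /andP[? _]; field.
rewrite mulrAC; congr (_ * _); rewrite /normal_peak expr1n mul1r.
rewrite -mulrnAr sqrtrM ?sqr_ge0// sqrtr_sqr ger0_norm ?(ltW s0)//.
rewrite invfM mulrAC mulVf ?mul1r// gt_eqF//.
Qed.

Lemma continuous_affine m s : continuous (fun x => m + s * x).
Proof. by move=> x; apply: cvgD; [exact: cvg_cst|apply: cvgM; [exact: cvg_cst|exact: cvg_id]]. Qed.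

Lemma measurable_affine m s : measurable_fun [set: R] (fun x => m + s * x).
Proof. apply: continuous_measurable_fun; exact: continuous_affine. Qed.

Local Open Scope ereal_scope.

Lemma integral_normal_prob_scale m s (f : R -> R) : (0 < s)%R ->
  continuous f -> (forall x, 0 <= f x)%R ->
  \int[normal_prob m s]_x (f x)%:E =
  \int[normal_prob 0 1]_x (f (m + s * x)%R)%:E.
Proof.
move=> s0 cf f0.
rewrite ge0_integral_normal_prob; [|apply/measurable_EFinP; exact: continuous_measurable_fun|by move=> x; rewrite lee_fin].
rewrite ge0_integral_normal_prob; [|apply/measurable_EFinP; apply: measurableT_comp; [exact: continuous_measurable_fun|exact: measurable_affine]|by move=> x; rewrite lee_fin].
pose F := (fun x : R => m + s * x)%R.
have dF (x : R) : is_derive x 1%R F s.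
  rewrite /F (_ : (fun _ => _) = cst m + s \*: id)%R//.
  by apply: is_derive_eq; rewrite add0r /GRing.scale/= mulr1.
have F'E : (F^`())%classic = cst s.
  by apply/funext => x; rewrite derive1E derive_val.
have := @increasing_ge0_integration_by_substitutionT R F (fun x => f x * normal_pdf m s x)%R.
rewrite F'E => ->//.
- apply: eq_integral => x _ /=; rewrite -EFinM; congr EFin.
  by rewrite fctE /= -mulrA normal_pdf_scale.
- by move=> x y xy; rewrite /F ltrD2l ltr_pM2l.
- by move=> x; exact: cvg_cst.
- exact: is_cvg_cst.
- exact: is_cvg_cst.
- have h : (s * x)%R @[x --> -oo%R] --> -oo%R.
    by under eq_fun do rewrite mulrC; apply: gt0_cvgMlNy => //; exact: cvg_id.
  have := cvg_comp _ _ h (cvg_addrl_Ny m); exact.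
- have h : (s * x)%R @[x --> +oo%R] --> +oo%R.
    by under eq_fun do rewrite mulrC; apply: gt0_cvgMly => //; exact: cvg_id.
  have := cvg_comp _ _ h (cvg_addrl m); exact.
- by move=> x; apply: cvgM; [exact: cf|apply: continuous_normal_pdf; rewrite gt_eqF].
- by move=> x; rewrite mulr_ge0// normal_pdf_ge0.
Qed.

(** The density is even and Lebesgue measure is invariant under reflection. *)
Lemma integral_normal_probN (f : R -> R) :
  continuous f -> (forall x, 0 <= f x)%R ->
  \int[normal_prob 0 1]_x (f (- x)%R)%:E = \int[normal_prob 0 1]_x (f x)%:E.
Proof.
move=> cf f0.
have mf : measurable_fun setT f by exact: continuous_measurable_fun.
have mN : measurable_fun setT (-%R : R -> measurableTypeR R) by exact: oppr_measurable.
rewrite ge0_integral_normal_prob; [|by apply/measurable_EFinP; apply: measurableT_comp => //; exact: oppr_measurable|by move=> x; rewrite lee_fin].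
rewrite ge0_integral_normal_prob; [|exact/measurable_EFinP|by move=> x; rewrite lee_fin].
transitivity (\int[mu]_(x in (-%R : R -> measurableTypeR R) @^-1` setT) ((fun x => (f x)%:E * (normal_pdf 0 1 x)%:E) (- x)%R)).
  rewrite preimage_setT; apply: eq_integral => x _; congr (_ * _%:E).
  by rewrite !normal_pdfE ?oner_eq0// /normal_fun !subr0 sqrrN.
rewrite -(@ge0_integral_pushforward _ _ (measurableTypeR R) (measurableTypeR R) R (-%R : R -> measurableTypeR R) mN mu setT (fun x => (f x)%:E * (normal_pdf 0 1 x)%:E))//.
- by apply: eq_measure_integral => A mA _; exact: lebesgue_measureN.
- by apply: emeasurable_funM; apply/measurable_EFinP => //; exact: measurable_normal_pdf.
- by move=> x _; rewrite mule_ge0// lee_fin// normal_pdf_ge0.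
Qed.

End NormalScale.

Section NormalRotation.
Context {R : realType}.
Notation mu := (@lebesgue_measure R).
Notation N := (@normal_prob R 0 1).
Implicit Types (m s a b x z u : R).

(* Completing the square. *)
Lemma normal_pdf_conv a b z u : 0 < b ->
  normal_pdf (a * z) b u * normal_pdf 0 1 z =
  normal_pdf 0 (Num.sqrt (a ^+ 2 + b ^+ 2)) u *
  normal_pdf (a * u / (a ^+ 2 + b ^+ 2)) (b / Num.sqrt (a ^+ 2 + b ^+ 2)) z.
Proof.
move=> b0; set c := Num.sqrt _.
have ab0 : 0 < a ^+ 2 + b ^+ 2 by rewrite ltr_wpDl ?sqr_ge0// exprn_gt0.
have c0 : 0 < c by rewrite sqrtr_gt0.
have c2 : c ^+ 2 = a ^+ 2 + b ^+ 2 by rewrite sqr_sqrtr// ltW.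
have bc0 : 0 < b / c by rewrite divr_gt0.
rewrite !normal_pdfE ?oner_eq0 ?gt_eqF//.
rewrite mulrACA [RHS]mulrACA; congr (_ * _).
  rewrite /normal_peak expr1n mul1r -!mulrnAr (sqrtrM _ (sqr_ge0 b)) (sqrtrM _ (sqr_ge0 c)) (sqrtrM _ (sqr_ge0 (b / c))).
  rewrite !sqrtr_sqr !ger0_norm ?(ltW b0) ?(ltW c0) ?(ltW bc0)//.
  have p0 : Num.sqrt (pi *+ 2 : R) != 0.
    by rewrite gt_eqF// sqrtr_gt0 pmulrn_lgt0// pi_gt0.
  by have := lt0r_neq0 b0; have := lt0r_neq0 c0 => ? ?; field; rewrite p0; apply/and3P.
rewrite /normal_fun -!expRD; congr expR.
rewrite -!(mulr_natr (_ ^+ 2)) expr_div_n c2 expr1n.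
have := lt0r_neq0 b0; have := lt0r_neq0 ab0 => ? ?; field.
by apply/andP.
Qed.

Local Open Scope ereal_scope.

(** With u = a z + b y the inner integral is taken against the density of N(a z, b^2). After
    exchanging the integrals, [normal_pdf_conv] splits the joint density into the marginal of u and
    the conditional density of z given u, which integrates to 1. *)
Lemma normal_convolution a b (f : R -> R) : (0 < b)%R ->
  continuous f -> (forall x, 0 <= f x)%R ->
  \int[N]_z \int[N]_y (f (a * z + b * y)%R)%:E =
  \int[N]_z (f (Num.sqrt (a ^+ 2 + b ^+ 2) * z)%R)%:E.
Proof.
move=> b0 cf f0; set c := Num.sqrt _.
have ab0 : (0 < a ^+ 2 + b ^+ 2)%R by rewrite ltr_wpDl ?sqr_ge0// exprn_gt0.
have c0 : (0 < c)%R by rewrite sqrtr_gt0.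
have mf : measurable_fun setT f by exact: continuous_measurable_fun.
pose g (z u : measurableTypeR R) := (f u * normal_pdf (a * z) b u)%R.
have g0 z u : (0 <= g z u)%R by rewrite mulr_ge0// normal_pdf_ge0.
have mg : measurable_fun setT (fun zu : measurableTypeR R * measurableTypeR R => g zu.1 zu.2).
  apply: measurable_funM; first exact: measurableT_comp mf measurable_snd.
  (* The mean varies with z, so joint measurability is read off the explicit formula. *)
  rewrite (_ : (fun _ => _) = fun zu : measurableTypeR R * measurableTypeR R => normal_peak b * expR (- (zu.2 - a * zu.1) ^+ 2 / (b ^+ 2 *+ 2)))%R; last first.
    by apply/funext => zu; rewrite normal_pdfE ?gt_eqF.
  apply: measurable_funM; first exact: measurable_cst.
  apply: measurableT_comp; first exact: measurable_expR.
  apply: measurable_funM; last exact: measurable_cst.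
  apply: measurable_funN; apply: measurable_funX; apply: measurable_funB.
    exact: measurable_snd.
  by apply: measurable_funM; [exact: measurable_cst|exact: measurable_fst].
have inner z : \int[N]_y (f (a * z + b * y)%R)%:E = \int[mu]_u (g z u)%:E.
  rewrite -(integral_normal_prob_scale (a * z) b0 cf f0).
  by rewrite ge0_integral_normal_prob; [|exact/measurable_EFinP|move=> x; rewrite lee_fin].
under eq_integral do rewrite inner.
have mF : measurable_fun setT (fun z => \int[mu]_u (g z u)%:E).
  apply: (@measurable_fun_fubini_tonelli_F _ _ (measurableTypeR R) (measurableTypeR R) R mu (fun zu => (g zu.1 zu.2)%:E)).
    exact/measurable_EFinP.
  by move=> zu; rewrite lee_fin.
rewrite (ge0_integral_normal_prob _ _ mF); last first.
  by move=> z; apply: integral_ge0 => u _; rewrite lee_fin.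
transitivity (\int[mu]_z \int[mu]_u (g z u * normal_pdf 0 1 z)%:E).
  apply: eq_integral => z _; rewrite -ge0_integralZr//.
  - by apply/measurable_EFinP; exact: (measurableT_comp mg (measurable_pair1 z)).
  - by move=> u _; rewrite lee_fin.
  - by rewrite lee_fin normal_pdf_ge0.
rewrite (@fubini_tonelli _ _ (measurableTypeR R) (measurableTypeR R) R mu mu (fun zu => (g zu.1 zu.2 * normal_pdf 0 1 zu.1)%:E)); last 2 first.
- apply/measurable_EFinP; apply: measurable_funM; first exact: mg.
  by apply: measurableT_comp; [exact: measurable_normal_pdf|exact: measurable_fst].
- by move=> zu; rewrite lee_fin mulr_ge0// normal_pdf_ge0.
transitivity (\int[mu]_u (f u * normal_pdf 0 c u)%:E).
  apply: eq_integral => u _ /=.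
  under eq_integral do rewrite /g -mulrA normal_pdf_conv// mulrA EFinM.
  rewrite ge0_integralZl//; last 3 first.
  - by apply/measurable_EFinP; exact: measurable_normal_pdf.
  - by move=> z _; rewrite lee_fin normal_pdf_ge0.
  - by rewrite lee_fin mulr_ge0// normal_pdf_ge0.
  by rewrite integral_normal_pdf mule1.
have := integral_normal_prob_scale 0 c0 cf f0.
rewrite ge0_integral_normal_prob; [|exact/measurable_EFinP|by move=> x; rewrite lee_fin].
by under [in X in _ = X -> _]eq_integral do rewrite add0r.
Qed.

(** A negative b is reduced to a positive one by reflecting y. For b = 0 the right-hand scale is
    |a|, reached by reflecting z. *)
Lemma normal_rotation a b (f : R -> R) :
  continuous f -> (forall x, 0 <= f x)%R ->
  \int[N]_z \int[N]_y (f (a * z + b * y)%R)%:E =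
  \int[N]_z (f (Num.sqrt (a ^+ 2 + b ^+ 2) * z)%R)%:E.
Proof.
move=> cf f0.
have [b0|b0|b0] := ltgtP 0%R b; first exact: normal_convolution.
  rewrite -(sqrrN b) -normal_convolution ?oppr_gt0//.
  apply: eq_integral => z _.
  rewrite -(@integral_normal_probN _ (fun y => f (a * z + b * y)%R))//.
    by apply: eq_integral => y _; rewrite mulNr mulrN.
  by move=> y; apply: continuous_comp; [exact: continuous_affine|exact: cf].
rewrite -b0 expr0n addr0 sqrtr_sqr.
under eq_integral.
  move=> z _; under eq_integral do rewrite mul0r addr0.
  rewrite integral_cst//= probability_setT mule1.
  over.
have [a0|a0] := ger0P a; first by [].
rewrite -(@integral_normal_probN _ (fun z => f (a * z)%R))//.
  by apply: eq_integral => y _; rewrite mulNr mulrN.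
move=> y; apply: continuous_comp; last exact: cf.
by apply: cvgM; [exact: cvg_cst|exact: cvg_id].
Qed.

End NormalRotation.

(** * Square-integrable random variables *)

Section SquareIntegrable.
Context d (T : measurableType d) (R : realType) (P : probability T R).
Implicit Types (f g : T -> R).

Definition square_integrable f :=
  measurable_fun setT f /\ P.-integrable setT (fun w => (f w ^+ 2)%:E).

Lemma integrable_le_norm f g : measurable_fun setT f ->
  P.-integrable setT (EFin \o g) -> (forall w, `|f w| <= g w) ->
  P.-integrable setT (EFin \o f).
Proof.
move=> mf ig fg; apply: le_integrable ig => //; first exact/measurable_EFinP.
by move=> w _ /=; rewrite lee_fin (le_trans (fg w))// ler_norm.
Qed.

Lemma integrable_bounded f K : measurable_fun setT f ->
  (forall w, `|f w| <= K) -> P.-integrable setT (EFin \o f).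
Proof.
move=> mf fK; apply: (integrable_le_norm (g := cst K)) => //.
exact: (finite_measure_integrable_cst P K).
Qed.

Lemma integrableDR f g : P.-integrable setT (EFin \o f) ->
  P.-integrable setT (EFin \o g) ->
  P.-integrable setT (EFin \o (fun w => f w + g w)).
Proof. by move=> mf mg; have := integrableD measurableT mf mg; apply: eq_integrable. Qed.

Lemma square_integrable_cst c : square_integrable (cst c).
Proof. by split => //; exact: (finite_measure_integrable_cst P (c ^+ 2)). Qed.

Lemma square_integrable_bounded f K : measurable_fun setT f ->
  (forall w, `|f w| <= K) -> square_integrable f.
Proof.
move=> mf fK; split=> //; apply: (@integrable_bounded (fun w => f w ^+ 2) (K ^+ 2)).
  exact: measurable_funX.
by move=> w; rewrite normrX lerXn2r ?nnegrE ?(le_trans _ (fK w)).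
Qed.

Lemma square_integrable_mul f g : square_integrable f -> square_integrable g ->
  P.-integrable setT (fun w => (f w * g w)%:E).
Proof.
move=> [mf f2] [mg g2].
apply: (@integrable_le_norm (fun w => f w * g w) (fun w => f w ^+ 2 + g w ^+ 2)).
- exact: measurable_funM.
- exact: integrableDR f2 g2.
- by move=> w; rewrite ler_norml; apply/andP; split; nra.
Qed.

Lemma square_integrable_integrable f : square_integrable f ->
  P.-integrable setT (EFin \o f).
Proof.
move=> f2; have := square_integrable_mul f2 (square_integrable_cst 1).
by apply: eq_integrable => // w _ /=; rewrite mulr1.
Qed.

Lemma square_integrableD f g : square_integrable f -> square_integrable g ->
  square_integrable (fun w => f w + g w).
Proof.
move=> [mf f2] [mg g2]; split; first exact: measurable_funD.
apply: (@integrable_le_norm _ (fun w => (f w ^+ 2 + g w ^+ 2) + (f w ^+ 2 + g w ^+ 2))).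
- by apply: measurable_funX; exact: measurable_funD.
- by apply: integrableDR; exact: integrableDR f2 g2.
- by move=> w; rewrite ger0_norm ?sqr_ge0//; have := sqr_ge0 (f w - g w); nra.
Qed.

Lemma square_integrableZ f c : square_integrable f ->
  square_integrable (fun w => c * f w).
Proof.
move=> [mf f2]; split; first exact: measurable_funM.
have := integrableZl measurableT (c ^+ 2) f2.
by apply: eq_integrable => // w _ /=; rewrite -EFinM exprMn.
Qed.

Lemma square_integrableB f g : square_integrable f -> square_integrable g ->
  square_integrable (fun w => f w - g w).
Proof.
move=> f2 /(square_integrableZ (-1)) g2.
by have := square_integrableD f2 g2; under eq_fun do rewrite mulN1r.
Qed.

Lemma square_integrable_sum I (s : seq I) (A : pred I) (F : I -> T -> R) :
  (forall i, square_integrable (F i)) ->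
  square_integrable (fun w => \sum_(i <- s | A i) F i w).
Proof.
move=> hF; elim: s => [|i s ih].
  by under eq_fun do rewrite big_nil; exact: square_integrable_cst.
under eq_fun do rewrite big_cons; case: (A i) => //.
exact: square_integrableD.
Qed.

Lemma square_integrable_bddM f g K : measurable_fun setT f ->
  (forall w, `|f w| <= K) -> square_integrable g ->
  square_integrable (fun w => f w * g w).
Proof.
move=> mf fK [mg g2]; split; first exact: measurable_funM.
apply: (@integrable_le_norm _ (fun w => K ^+ 2 * g w ^+ 2)).
- by apply: measurable_funX; exact: measurable_funM.
- have := integrableZl measurableT (K ^+ 2) g2.
  by apply: eq_integrable => // w _ /=; rewrite -EFinM.
- move=> w; rewrite normrX normrM exprMn -normrX -(real_normK (num_real (g w))).
  rewrite normrX ler_wpM2r ?exprn_ge0// lerXn2r ?nnegrE ?(le_trans _ (fK w))//.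
Qed.

Lemma Rintegral_sum I (s : seq I) (F : I -> T -> R) :
  (forall i, P.-integrable setT (EFin \o F i)) ->
  P.-integrable setT (EFin \o (fun w => \sum_(i <- s) F i w)) /\
  \int[P]_w (\sum_(i <- s) F i w) = \sum_(i <- s) \int[P]_w F i w.
Proof.
move=> hF; elim: s => [|i s [ih1 ih2]].
  rewrite big_nil; split.
    under [X in EFin \o X]eq_fun do rewrite big_nil.
    exact: (finite_measure_integrable_cst P 0).
  by under eq_Rintegral do rewrite big_nil; rewrite Rintegral_cst// mul0r.
rewrite big_cons -ih2 -RintegralD//; split.
  by under [X in EFin \o X]eq_fun do rewrite big_cons; exact: integrableDR.
by apply: eq_Rintegral => w _; rewrite big_cons.
Qed.

Lemma Rintegral_prob_cst c : \int[P]_w c = c.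
Proof. by rewrite Rintegral_cst//; rewrite /= probability_setT mulr1. Qed.

(** Expanding the square leaves the second moment minus c^2. *)
Lemma le_Rintegral_sqr_sub f c : square_integrable f -> c = \int[P]_w f w ->
  \int[P]_w (f w - c) ^+ 2 <= \int[P]_w (f w ^+ 2).
Proof.
move=> f2 cE.
have i1 : P.-integrable setT (EFin \o f) by exact: square_integrable_integrable.
have i2 : P.-integrable setT (EFin \o (fun w => c ^+ 2)) by exact: (finite_measure_integrable_cst P (c ^+ 2)).
have i3 : P.-integrable setT (EFin \o (fun w => - (2 * c) * f w)).
  have := integrableZl measurableT (- (2 * c)) i1.
  by apply: eq_integrable => // w _ /=; rewrite -EFinM.
have i4 : P.-integrable setT (EFin \o (fun w => f w ^+ 2)) by exact: f2.2.
rewrite (_ : (fun w => (f w - c) ^+ 2) = fun w => f w ^+ 2 + (- (2 * c) * f w + c ^+ 2)); last first.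
  by apply/funext => w; ring.
rewrite RintegralD//; last exact: integrableDR.
rewrite RintegralD// RintegralZl// Rintegral_prob_cst -cE.
by rewrite gerDl; nra.
Qed.

Lemma chebyshev_sqr f (t : R) : square_integrable f -> 0 < t ->
  (P [set w | (t < `|f w|)%R] <= (\int[P]_w (f w ^+ 2) / t ^+ 2)%:E)%E.
Proof.
move=> [mf f2] t0.
have t20 : 0 < t ^+ 2 by rewrite exprn_gt0.
have mA : measurable [set w | t < `|f w|].
  rewrite -[X in measurable X]setTI.
  by apply: measurable_fun_ltr => //; exact: measurableT_comp.
rewrite EFinM muleC lee_pdivlMl//.
have -> : (\int[P]_w (f w ^+ 2))%:E = (\int[P]_w (f w ^+ 2)%:E)%E.
  by rewrite /Rintegral fineK// integrable_fin_num.
rewrite -[X in P X]setIT -integral_indic// -ge0_integralZl//; last 2 first.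
- exact/measurable_EFinP/measurable_indic.
- by rewrite lee_fin ltW.
apply: ge0_le_integral => //.
- by move=> w _; rewrite mule_ge0// lee_fin// ltW.
- by apply: emeasurable_funM => //; exact/measurable_EFinP/measurable_indic.
- exact/measurable_EFinP/measurable_funX.
- move=> w _; rewrite -EFinM lee_fin indicE; case: (boolP (w \in _)) => [|_].
    rewrite inE/= mulr1 => tf.
    by rewrite -(real_normK (num_real (f w))) lerXn2r ?nnegrE// ltW.
  by rewrite mulr0 sqr_ge0.
Qed.

End SquareIntegrable.

(** * Stein's identity *)

Section Stein.
Context {R : realType}.
Notation mu := (@lebesgue_measure R).
Notation N := (@normal_prob R 0 1).
Implicit Types (x z : R).

(** Multiplying by a nonnegative density commutes with taking positive and negative parts, so the
    nonnegative case applies to each part, integrable or not. *)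
Lemma integral_normal_prob m s (h : R -> R) : measurable_fun setT h ->
  (\int[normal_prob m s]_x (h x)%:E = \int[mu]_x (h x * normal_pdf m s x)%:E)%E.
Proof.
move=> mh; rewrite integralE [RHS]integralE.
have mE : measurable_fun setT (EFin \o h) by exact/measurable_EFinP.
rewrite !ge0_integral_normal_prob//; last 2 first.
- exact: measurable_funeneg.
- exact: measurable_funepos.
congr (_ - _)%E; apply: eq_integral => x _.
- rewrite !funeposE -!EFin_max -EFinM; congr EFin.
  by rewrite maxr_pMl ?normal_pdf_ge0// mul0r.
- rewrite !funenegE -!EFinN -!EFin_max -EFinM; congr EFin.
  by rewrite maxr_pMl ?normal_pdf_ge0// mul0r mulNr.
Qed.

Let k : R := normal_peak 1.

Lemma std_normal_pdfE x : normal_pdf 0 1 x = k * expR (- 2^-1 * x ^+ 2).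
Proof.
rewrite normal_pdfE ?oner_eq0// /normal_fun subr0 expr1n mulNr; congr (_ * expR _).
by rewrite mulNr mulrC.
Qed.

Lemma is_derive_normal_pdf x :
  is_derive x 1 (normal_pdf 0 1 : R -> R) (- x * normal_pdf 0 1 x).
Proof.
rewrite [X in is_derive _ _ X _](_ : _ = k \*: (@expR R \o ((- 2^-1) \*: (@id R) ^+ 2))); last first.
  by apply/funext => y; rewrite std_normal_pdfE.
apply: is_derive_eq; rewrite std_normal_pdfE !fctE /GRing.scale/=.
by field.
Qed.

(** A crude decay is enough: against the linear growth allowed in [normal_stein], order x^-2 makes
    the boundary terms vanish. It follows from exp t >= 1 + t at t = x^2 / 2. *)
Lemma normal_pdf_decay x : 0 < x -> normal_pdf 0 1 x <= 2 * k / x ^+ 2.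
Proof.
move=> x0; have x20 : 0 < x ^+ 2 by rewrite exprn_gt0.
have k0 : 0 <= k by exact: normal_peak_ge0.
rewrite std_normal_pdfE mulNr expRN ler_pdivlMr//.
have e0 := expR_gt0 (2^-1 * x ^+ 2).
rewrite mulrAC ler_pdivrMr//.
have := expR_ge1Dx (2^-1 * x ^+ 2); nra.
Qed.

(** Half of the Gaussian exponent absorbs x^2, and the other half is, up to a constant, the density
    of N(0, 2). *)
Lemma square_integrable_normal_id : square_integrable N (id : R -> R).
Proof.
split=> //; apply/integrableP; split.
  by apply/measurable_EFinP; exact: exprn_measurable.
rewrite /=.
have mx2 : measurable_fun setT (fun x : R => x ^+ 2) by exact: exprn_measurable.
have -> : (\int[N]_x `|x ^+ 2|%:E = \int[N]_x (x ^+ 2)%:E)%E.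
  by apply: eq_integral => x _; rewrite ger0_norm// sqr_ge0.
rewrite integral_normal_prob//.
pose s : R := Num.sqrt 2.
have s0 : 0 < s by rewrite sqrtr_gt0.
have s2 : s ^+ 2 = 2 by rewrite sqr_sqrtr.
(* The 4 comes from x^2 <= 4 exp (x^2 / 4); the quotient exchanges the two normalizing constants. *)
pose C : R := 4 * k / normal_peak s.
have C0 : 0 <= C by rewrite mulr_ge0// ?mulr_ge0// ?normal_peak_ge0// invr_ge0 normal_peak_ge0.
apply: (@le_lt_trans _ _ (\int[mu]_x (C%:E * (normal_pdf 0 s x)%:E))%E).
  apply: ge0_le_integral => //.
  - by move=> x _; rewrite lee_fin mulr_ge0// ?sqr_ge0// normal_pdf_ge0.
  - apply/measurable_EFinP; apply: measurable_funM => //; exact: measurable_normal_pdf.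
  - apply: emeasurable_funM => //; apply/measurable_EFinP; exact: measurable_normal_pdf.
  - move=> x _; rewrite -EFinM lee_fin std_normal_pdfE normal_pdfE ?gt_eqF//.
    rewrite /normal_fun subr0 s2.
    have p0 := normal_peak_gt0 (lt0r_neq0 s0).
    rewrite [leRHS]mulrA /C mulfVK ?gt_eqF//.
    have -> : expR (- 2^-1 * x ^+ 2) = expR (- x ^+ 2 / (2 *+ 2)) * expR (- x ^+ 2 / (2 *+ 2)).
      by rewrite -expRD; congr expR; field.
    rewrite !mulrA ler_wpM2r ?expR_ge0//.
    have k0 : 0 <= k by exact: normal_peak_ge0.
    rewrite mulNr expRN ler_pdivrMr ?expR_gt0//.
    have := expR_ge1Dx (x ^+ 2 / (2 *+ 2)).
    set e := expR _.
    have -> : x ^+ 2 / (2 *+ 2) = 4^-1 * x ^+ 2 by field.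
    move=> h; have h2 : 0 <= k * (e - (1 + 4^-1 * x ^+ 2)) by rewrite mulr_ge0// subr_ge0.
    by nra.
rewrite integralZl//; last exact: integrable_normal_pdf.
by rewrite integral_normal_pdf mule1 ltry.
Qed.

(** With h = f' - z f, the product of h and the density is the derivative of the density times f.
    The fundamental theorem on growing symmetric intervals leaves only boundary terms, which vanish
    in the limit, while dominated convergence handles the integral of h. *)
Lemma normal_stein (f f' : R -> R) (A : R) :
  (forall x, is_derive x 1 f (f' x)) -> continuous f' ->
  (forall x, `|f x| <= A * (1 + `|x|)) -> (forall x, `|f' x| <= A) ->
  \int[N]_z (z * f z) = \int[N]_z f' z.
Proof.
move=> df cf' fA f'A.
have A0 : 0 <= A by exact: le_trans (f'A 0).
have cf : continuous f.
  by move=> x; apply: differentiable_continuous; apply/derivable1_diffP; have [] := df x.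
have mf : measurable_fun setT f by exact: continuous_measurable_fun.
have mf' : measurable_fun setT f' by exact: continuous_measurable_fun.
have if' : N.-integrable setT (EFin \o f') by exact: (@integrable_bounded _ (measurableTypeR R) R N f' A).
have sid := square_integrable_normal_id.
have sabs : square_integrable N (fun x : R => A * (1 + `|x|)).
  apply: square_integrableZ; apply: square_integrableD; first exact: square_integrable_cst.
  split; first exact: normr_measurable.
  by move: sid.2; apply: eq_integrable => // x _; rewrite real_normK// num_real.
have sf : square_integrable N f.
  split=> //; apply: (integrable_le_norm _ sabs.2); first exact: measurable_funX.
  by move=> x; rewrite normrX lerXn2r ?nnegrE ?mulr_ge0// addr_ge0.
have izf : N.-integrable setT (EFin \o (fun z : R => z * f z)) by exact: square_integrable_mul.
pose h z := f' z - z * f z.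
have ch : continuous h.
  by move=> z; apply: cvgB; [exact: cf'|apply: cvgM; [exact: cvg_id|exact: cf]].
have mh : measurable_fun setT h by exact: continuous_measurable_fun.
have ih : N.-integrable setT (EFin \o h).
  by have := integrableB measurableT if' izf; apply: eq_integrable.
pose G z := normal_pdf 0 1 z * f z.
have dG z : is_derive z 1 G (h z * normal_pdf 0 1 z).
  have := is_derive_normal_pdf z; have := df z => ? ?.
  by apply: is_derive_eq; rewrite /h /GRing.scale/=; ring.
(* Endpoints n + 1 avoid the degenerate interval at n = 0 and give y >= 1 in the boundary
   estimate. *)
pose I (n : nat) : set R := `[- n.+1%:R, n.+1%:R]%classic.
have mI n : measurable (I n) by exact: measurable_itv.
have FTC n : (\int[N]_z (h z * \1_(I n) z)%:E = (G n.+1%:R - G (- n.+1%:R))%:E)%E.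
  rewrite integral_normal_prob; last by apply: measurable_funM => //; exact: measurable_indic.
  rewrite EFinB.
  rewrite -(@continuous_FTC2 R (fun z => h z * normal_pdf 0 1 z)).
  - rewrite [RHS]integral_mkcond; apply: eq_integral => z _.
    by rewrite patchE indicE; case: ifPn => _; rewrite ?mulr1 ?mulr0 ?mul0r.
  - by rewrite -subr_gt0 opprK addr_gt0.
  - apply: continuous_subspaceT => z; apply: cvgM; first exact: ch.
    by apply: continuous_normal_pdf; rewrite oner_eq0.
  - have cG : continuous G.
      by move=> z; apply: differentiable_continuous; apply/derivable1_diffP; have [] := dG z.
    split.
    + by move=> z _; have [] := dG z.
    + by apply: cvg_at_right_filter; exact: cG.
    + by apply: cvg_at_left_filter; exact: cG.
  - by move=> z _; rewrite derive1E; have ? := dG z; rewrite derive_val.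
have lim1 : (\int[N]_z (h z * \1_(I n) z)%:E)%E @[n --> \oo] --> (\int[N]_z (h z)%:E)%E.
  apply: (@dominated_cvg _ (measurableTypeR R) R N setT measurableT _ _ (fun z => `|h z|%:E)).
  - by move=> n; apply/measurable_EFinP; apply: measurable_funM => //; apply: measurable_indic; exact: mI.
  - move=> z _; apply: cvg_near_cst; near=> n.
    rewrite indicE mem_set ?mulr1//= /I /= in_itv/= -ler_norml.
    rewrite (le_trans _ (_ : n%:R <= _)) ?ler_nat//.
    by near: n; exact: nbhs_infty_ger.
  - by [].
  - by have := integrable_norm ih; apply: eq_integrable.
  - move=> n z _; rewrite /= lee_fin normrM ler_piMr//.
    by rewrite indicE; case: (_ \in _); rewrite ?normr1 ?normr0.
have lim2 : (G n.+1%:R - G (- n.+1%:R)) @[n --> \oo] --> (0 : R).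
  apply/cvgr0Pnorm_le => /= e e0; near=> n.
  have n0 : (0 : R) < n.+1%:R by rewrite ltr0n.
  (* With y = n + 1 this is (2 k / y^2) A (1 + y), where 1 + y <= 2 y. *)
  have Gle z : `|z| = n.+1%:R -> `|G z| <= 4 * k * A / n.+1%:R.
    move=> zn; rewrite /G normrM (ger0_norm (normal_pdf_ge0 _ _ _)).
    have -> : normal_pdf 0 1 z = normal_pdf 0 1 (n.+1%:R : R).
      by rewrite !std_normal_pdfE -zn real_normK// num_real.
    apply: le_trans (ler_pM (normal_pdf_ge0 _ _ _) (normr_ge0 _) (normal_pdf_decay n0) (fA z)) _.
    have n1 : (1 : R) <= n.+1%:R by rewrite ler1n.
    have k0 : 0 <= k by exact: normal_peak_ge0.
    rewrite zn; set y : R := n.+1%:R in n0 n1 *.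
    have -> : 2 * k / y ^+ 2 * (A * (1 + y)) = k * A * (2 * ((1 + y) / y)) / y.
      by field; rewrite gt_eqF.
    rewrite ler_pM2r ?invr_gt0//.
    have h2 : (1 + y) / y <= 2 by rewrite ler_pdivrMr//; lra.
    have h3 : 0 <= k * A * (2 - (1 + y) / y) by rewrite mulr_ge0 ?subr_ge0// mulr_ge0.
    by move: (_ / _) h2 h3 => r h2 h3; nra.
  rewrite (le_trans (ler_normB _ _))//.
  apply: le_trans (lerD (Gle _ _) (Gle _ _)) _; first by rewrite ger0_norm.
    by rewrite normrN ger0_norm.
  rewrite -mulrDl ler_pdivrMr//.
  rewrite -ler_pdivrMl// (le_trans _ (_ : n%:R <= _)) ?ler_nat//.
  by near: n; exact: nbhs_infty_ger.
have h0 : (\int[N]_z (h z)%:E = 0)%E.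
  move/cvg_lim : lim1 => <-//; under eq_fun do rewrite FTC.
  by apply/cvg_lim => //; apply: cvg_EFin; [exact: nearW|exact: lim2].
have : \int[N]_z h z = 0 by rewrite /Rintegral h0.
by rewrite RintegralB// => /eqP; rewrite subr_eq0 => /eqP.
Unshelve. all: by end_near. Qed.

End Stein.

(** * The moment maps and their inverse *)

Section Moments.
Context {R : realType}.
Notation N := (@normal_prob R 0 1).
Implicit Types (x z th g q s : R).

Lemma measurable_drho : measurable_fun setT (@drho R).
Proof. by apply: continuous_measurable_fun; exact: continuous_drho. Qed.

Lemma measurable_ddrho : measurable_fun setT (@ddrho R).
Proof. by apply: continuous_measurable_fun; exact: continuous_ddrho. Qed.

Lemma normr_drho_le1 x : `|drho x| <= 1.
Proof. by rewrite ger0_norm ?ltW ?drho_gt0 ?drho_lt1. Qed.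

Lemma normr_ddrho_le1 x : `|ddrho x| <= 1.
Proof. by rewrite ger0_norm ?ltW ?ddrho_gt0 ?ddrho_lt1. Qed.

Lemma square_integrable_normal_bounded (f : R -> R) K : measurable_fun setT f ->
  (forall z, `|f z| <= K) -> square_integrable N f.
Proof. exact: (@square_integrable_bounded _ (measurableTypeR R)). Qed.

Lemma square_integrable_drho th g : square_integrable N (fun z => drho (th + g * z)).
Proof.
apply: (@square_integrable_normal_bounded _ 1); last by move=> z; exact: normr_drho_le1.
by apply: measurableT_comp; [exact: measurable_drho|exact: measurable_affine].
Qed.

Lemma square_integrable_ddrho th g : square_integrable N (fun z => ddrho (th + g * z)).
Proof.
apply: (@square_integrable_normal_bounded _ 1); last by move=> z; exact: normr_ddrho_le1.
by apply: measurableT_comp; [exact: measurable_ddrho|exact: measurable_affine].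
Qed.

Lemma integrable_zdrho th g : N.-integrable setT (EFin \o (fun z => z * drho (th + g * z))).
Proof.
apply: square_integrable_mul; first exact: square_integrable_normal_id.
exact: square_integrable_drho.
Qed.

Definition normal_m1 : R := \int[N]_z `|z|.
Definition normal_m2 : R := \int[N]_z (z ^+ 2).

Lemma normal_m1_ge0 : 0 <= normal_m1.
Proof. by apply: Rintegral_ge0. Qed.

Lemma normal_m2_ge0 : 0 <= normal_m2.
Proof. by apply: Rintegral_ge0 => z _; exact: sqr_ge0. Qed.

Lemma integrable_normal_abs : N.-integrable setT (EFin \o (fun z : R => `|z|)).
Proof.
have sid := @square_integrable_normal_id R.
have sabs : square_integrable N (fun z : R => `|z|).
  split; first exact: normr_measurable.
  by move: sid.2; apply: eq_integrable => // x _; rewrite real_normK// num_real.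
exact: square_integrable_integrable sabs.
Qed.

(** The weight is 1 for pi and c, and z for zeta; this is why the first absolute moment enters the
    former bounds and the second moment the latter. *)
Lemma normal_average_lip (w f : R -> R) th g th' g' :
  measurable_fun setT w ->
  N.-integrable setT (EFin \o (fun z => w z * f (th + g * z))) ->
  N.-integrable setT (EFin \o (fun z => w z * f (th' + g' * z))) ->
  N.-integrable setT (EFin \o (fun z => `|w z|)) ->
  N.-integrable setT (EFin \o (fun z => `|w z| * `|z|)) ->
  (forall x y, `|f x - f y| <= `|x - y|) ->
  `|\int[N]_z (w z * f (th + g * z)) - \int[N]_z (w z * f (th' + g' * z))| <=
  `|th - th'| * \int[N]_z `|w z| + `|g - g'| * \int[N]_z (`|w z| * `|z|).
Proof.
move=> mw i1 i2 iw iwz flip.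
rewrite -RintegralB//.
apply: le_trans (le_normr_Rintegral _ _) _ => //.
  by have := integrableB measurableT i1 i2; apply: eq_integrable.
rewrite -RintegralZl// -RintegralZl// -RintegralD//; last 2 first.
- by have := integrableZl measurableT `|th - th'| iw; apply: eq_integrable.
- by have := integrableZl measurableT `|g - g'| iwz; apply: eq_integrable.
apply: le_Rintegral => //.
- have := integrable_norm (integrableB measurableT i1 i2).
  by apply: eq_integrable.
- apply: integrableDR.
  + by have := integrableZl measurableT `|th - th'| iw; apply: eq_integrable.
  + by have := integrableZl measurableT `|g - g'| iwz; apply: eq_integrable.
- move=> z _; rewrite -mulrBr normrM.
  have -> : `|th - th'| * `|w z| + `|g - g'| * (`|w z| * `|z|) =
      `|w z| * (`|th - th'| + `|g - g'| * `|z|) by ring.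
  rewrite ler_wpM2l//; apply: le_trans (flip _ _) _.
  rewrite -normrM (_ : _ - _ = (th - th') + (g - g') * z); last by ring.
  exact: ler_normD.
Qed.

Lemma integrable_normal_one : N.-integrable setT (EFin \o (fun z : R => `|1 : R|)).
Proof. by rewrite normr1; exact: (finite_measure_integrable_cst N 1). Qed.

Lemma integrable_normal_oneabs : N.-integrable setT (EFin \o (fun z : R => `|1 : R| * `|z|)).
Proof.
by have := integrable_normal_abs; apply: eq_integrable => // z _; rewrite /= normr1 mul1r.
Qed.

Lemma normal_average_lip1 (f : R -> R) th g th' g' :
  measurable_fun setT f -> (forall x, `|f x| <= 1) ->
  (forall x y, `|f x - f y| <= `|x - y|) ->
  `|\int[N]_z f (th + g * z) - \int[N]_z f (th' + g' * z)| <=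
  `|th - th'| + `|g - g'| * normal_m1.
Proof.
move=> mf f1 flip.
have e th0 g0 : \int[N]_z (1 * f (th0 + g0 * z)) = \int[N]_z f (th0 + g0 * z).
  by apply: eq_Rintegral => z _; rewrite mul1r.
have h th0 g0 : N.-integrable setT (EFin \o (fun z => 1 * f (th0 + g0 * z))).
  apply: (@integrable_bounded _ (measurableTypeR R) R N _ 1).
    apply: measurable_funM => //.
    by apply: measurableT_comp; [exact: mf|exact: measurable_affine].
  by move=> z; rewrite mul1r.
have e1 : \int[N]_z `|1 : R| = 1 by rewrite Rintegral_prob_cst normr1.
have e2 : \int[N]_z (`|1 : R| * `|z|) = normal_m1.
  by apply: eq_Rintegral => z _; rewrite normr1 mul1r.
have := @normal_average_lip (fun=> 1) f th g th' g' (measurable_cst _)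
  (h _ _) (h _ _) integrable_normal_one integrable_normal_oneabs flip.
by rewrite !e e1 e2 mulr1.
Qed.

Lemma mom_pi_lip th g th' g' :
  `|mom_pi th g - mom_pi th' g'| <= `|th - th'| + `|g - g'| * normal_m1.
Proof.
exact: (normal_average_lip1 _ _ _ _ measurable_drho normr_drho_le1 drho_lip).
Qed.

Lemma mom_c_lip th g th' g' :
  `|mom_c th g - mom_c th' g'| <= `|th - th'| + `|g - g'| * normal_m1.
Proof.
exact: (normal_average_lip1 _ _ _ _ measurable_ddrho normr_ddrho_le1 ddrho_lip).
Qed.

Lemma mom_zeta_lip th g th' g' :
  `|mom_zeta th g - mom_zeta th' g'| <= `|th - th'| * normal_m1 + `|g - g'| * normal_m2.
Proof.
have h2 : N.-integrable setT (EFin \o (fun z : R => `|z| * `|z|)).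
  have := (@square_integrable_normal_id R).2; apply: eq_integrable => // z _ /=.
  by rewrite -expr2 real_normK// num_real.
have := @normal_average_lip id (@drho R) th g th' g' (@measurable_id _ _ _)
  (integrable_zdrho _ _) (integrable_zdrho _ _) integrable_normal_abs h2 drho_lip.
have -> : \int[N]_z (`|z| * `|z|) = normal_m2.
  by apply: eq_Rintegral => z _; rewrite -expr2 (real_normK (num_real _)).
by [].
Qed.

(** Stein's identity for z |-> drho (th + g z), whose derivative carries the factor g; 1 + |g|
    dominates both the function and the derivative. *)
Lemma mom_zetaE th g : mom_zeta th g = g * mom_c th g.
Proof.
transitivity (\int[N]_z (g * ddrho (th + g * z))); last first.
  rewrite RintegralZl//.
  exact: (square_integrable_integrable (square_integrable_ddrho th g)).
apply: (@normal_stein R (fun z => drho (th + g * z)) _ (1 + `|g|)).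
- move=> z.
  have h : is_derive z 1 (cst th + g \*: @id R) g.
    by apply: is_derive_eq; rewrite add0r /GRing.scale/= mulr1.
  have h2 : is_derive ((cst th + g \*: @id R) z) 1 (@drho R) (ddrho (th + g * z)).
    by rewrite ddrhoE; exact: is_derive_drho.
  by rewrite mulrC; exact: (is_derive1_comp h2 h).
- move=> z; apply: cvgM; first exact: cvg_cst.
  by apply: continuous_comp; [exact: continuous_affine|exact: continuous_ddrho].
- move=> z; apply: le_trans (normr_drho_le1 _) _.
  by rewrite -[leLHS]mulr1 ler_pM// lerDl.
- move=> z; rewrite normrM; have := normr_ddrho_le1 (th + g * z).
  have := normr_ge0 g; have := normr_ge0 (ddrho (th + g * z)); nra.
Qed.

Lemma normal_prob_set1 x : N [set x] = 0%E.
Proof. by rewrite /normal_prob integral_set1. Qed.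

(** A zero integral would make f vanish almost everywhere, but f can vanish only at [x0], a null
    set. The exceptional point accommodates the crossing point in [mom_zeta_lt]. *)
Lemma Rintegral_normal_gt0 (f : R -> R) x0 : measurable_fun setT f ->
  N.-integrable setT (EFin \o f) -> 0 <= f x0 -> (forall z, z != x0 -> 0 < f z) ->
  0 < \int[N]_z f z.
Proof.
move=> mf intf f0 fpos.
have fge0 z : 0 <= f z.
  by have [->//|/fpos/ltW] := eqVneq z x0.
rewrite lt_neqAle Rintegral_ge0// andbT; apply/eqP => int0.
have i0 : (\int[N]_z `|(f z)%:E| = 0)%E.
  under eq_integral do rewrite gee0_abs ?lee_fin//.
  by rewrite -[LHS]fineK ?integrable_fin_num// -/(Rintegral _ _ _) -int0.
have mE : measurable_fun setT (EFin \o f) by exact/measurable_EFinP.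
have /(ae_eq_integral_abs N measurableT mE).1 : (\int[N]_z `|(EFin \o f) z| = 0)%E by exact: i0.
move=> [A [mA A0 sub]].
have mx0 : measurable ([set x0] : set (measurableTypeR R)) by exact: measurable_set1.
have h1 : (N setT <= N (A `|` [set x0]))%E.
  apply: le_measure; rewrite ?inE//; first by apply: measurableU.
  move=> z _; have [->|zx] := eqVneq z x0; first by right.
  left; apply: sub => /= /(_ I) [] fz0.
  by have := fpos z zx; rewrite fz0 ltxx.
have h2 : (N (A `|` [set x0]) <= 0)%E.
  by have /= := measureU2 N mA mx0; rewrite normal_prob_set1 adde0; move: A0 => /= ->.
have := le_trans h1 h2.
by rewrite probability_setT lee_fin ler10.
Qed.

End Moments.

Section MomentFacts.
Context {R : realType}.
Notation N := (@normal_prob R 0 1).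
Implicit Types (x z th g q s u : R).

Lemma integrable_drho_affine th g : N.-integrable setT (EFin \o (fun z => drho (th + g * z))).
Proof. exact: square_integrable_integrable (square_integrable_drho th g). Qed.

Lemma measurable_drho_affine th g : measurable_fun setT (fun z => drho (th + g * z)).
Proof. by apply: measurableT_comp; [exact: measurable_drho|exact: measurable_affine]. Qed.

Lemma mom_c_gt0 th g : 0 < mom_c th g.
Proof.
apply: (Rintegral_normal_gt0 (x0 := 0)).
- by apply: measurableT_comp; [exact: measurable_ddrho|exact: measurable_affine].
- exact: square_integrable_integrable (square_integrable_ddrho th g).
- exact/ltW/ddrho_gt0.
- by move=> z _; exact: ddrho_gt0.
Qed.

Lemma mom_pi_gt0 th g : 0 < mom_pi th g.
Proof.
apply: (Rintegral_normal_gt0 (x0 := 0)).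
- exact: measurable_drho_affine.
- exact: integrable_drho_affine.
- exact/ltW/drho_gt0.
- by move=> z _; exact: drho_gt0.
Qed.

Lemma drhoN x : drho (- x) = 1 - drho x.
Proof.
rewrite !drhoE expRN; have := onePexpR_neq0 x; have := expR_gt0 x => e0 ne.
have := lt0r_neq0 e0 => e1; field.
by rewrite ne.
Qed.

(** Negating both arguments negates th + g z itself, so [drhoN] applies pointwise. Bounds on one
    tail of pi thereby serve for the other. *)
Lemma mom_piN th g : mom_pi (- th) (- g) = 1 - mom_pi th g.
Proof.
rewrite /mom_pi -[X in X - _](Rintegral_prob_cst N) -RintegralB//.
- by apply: eq_Rintegral => z _; rewrite -drhoN; congr drho; ring.
- exact: (finite_measure_integrable_cst N 1).
- exact: integrable_drho_affine.
Qed.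

Lemma mom_pi_lt1 th g : mom_pi th g < 1.
Proof. by rewrite -subr_gt0 -mom_piN mom_pi_gt0. Qed.

Lemma mom_pi_lt th th' g : th < th' -> mom_pi th g < mom_pi th' g.
Proof.
move=> h; rewrite -subr_gt0 /mom_pi -RintegralB//; last 2 first.
- exact: integrable_drho_affine.
- exact: integrable_drho_affine.
have d z : 0 < drho (th' + g * z) - drho (th + g * z).
  by rewrite subr_gt0 drho_lt// ltrD2r.
apply: (Rintegral_normal_gt0 (x0 := 0)).
- by apply: measurable_funB; exact: measurable_drho_affine.
- have := integrableB measurableT (integrable_drho_affine th' g) (integrable_drho_affine th g).
  exact: eq_integrable.
- exact: ltW.
- by move=> z _.
Qed.

Lemma drho_tail x : 0 < x -> 1 - drho x <= x^-1.
Proof.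
move=> x0; have e := expR_ge1Dx x.
rewrite drhoE (_ : 1 - _ = (1 + expR x)^-1); last by have := onePexpR_neq0 x => ?; field.
by rewrite lef_pV2 ?posrE ?onePexpR_gt0//; lra.
Qed.

(** A pointwise Chebyshev argument: either th + g z >= th / 2 and [drho_tail] gives 2 / th, or |g z|
    > th / 2 and the quadratic term already exceeds 1. *)
Lemma mom_pi_tail th g : 1 <= th -> 1 - mom_pi th g <= (2 + 4 * g ^+ 2 * normal_m2) / th.
Proof.
move=> th1; have th0 : 0 < th by lra.
have i2 : N.-integrable setT (EFin \o (fun z => (4 * g ^+ 2 / th) * z ^+ 2)).
  have := integrableZl measurableT (4 * g ^+ 2 / th) (@square_integrable_normal_id R).2.
  by apply: eq_integrable.
have i1 : N.-integrable setT (EFin \o (fun z : R => 2 / th)).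
  exact: (finite_measure_integrable_cst N (2 / th)).
have -> : (2 + 4 * g ^+ 2 * normal_m2) / th =
    \int[N]_z (2 / th + (4 * g ^+ 2 / th) * z ^+ 2).
  rewrite RintegralD// RintegralZl ?Rintegral_prob_cst//; last exact: (@square_integrable_normal_id R).2.
  by rewrite -/normal_m2; ring.
rewrite -mom_piN; apply: le_Rintegral => //.
- exact: integrable_drho_affine.
- exact: integrableDR.
- move=> z _; rewrite mulNr -opprD drhoN.
  have X0 : 0 <= 4 * g ^+ 2 / th * z ^+ 2.
    by rewrite mulr_ge0 ?sqr_ge0// mulr_ge0 ?invr_ge0 ?(ltW th0)// mulr_ge0// sqr_ge0.
  have [gz|gz] := leP (- (th / 2)) (g * z).
    have h1 : 1 - drho (th + g * z) <= 1 - drho (th / 2).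
      rewrite lerD2l lerN2.
      have : th / 2 <= th + g * z by lra.
      by rewrite le_eqVlt => /predU1P[->|/drho_lt/ltW].
    have th20 : 0 < th / 2 by rewrite divr_gt0.
    apply: le_trans h1 (le_trans (drho_tail th20) _).
    by rewrite invf_div lerDl.
  (* Here th <= th^2 <= 4 g^2 z^2, the first inequality because th >= 1. *)
  have h1 : 1 <= 4 * g ^+ 2 / th * z ^+ 2.
    rewrite mulrAC ler_pdivlMr// mul1r.
    have h2 : (th / 2) ^+ 2 <= (g * z) ^+ 2 by nra.
    by nra.
  apply: (@le_trans _ _ 1); first by rewrite gerBl ltW// drho_gt0.
  apply: le_trans h1 _; by rewrite lerDr divr_ge0// ltW.
Qed.

(* At equal means the two response curves cross exactly once, and weighting
   their difference by the signed distance to the crossing point makes it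
   positive. *)
Lemma mom_zeta_lt th g th' g' : g < g' -> mom_pi th g = mom_pi th' g' ->
  mom_zeta th g < mom_zeta th' g'.
Proof.
move=> gg' e; pose z0 := (th - th') / (g' - g).
have d0 : 0 < g' - g by rewrite subr_gt0.
pose D z := drho (th' + g' * z) - drho (th + g * z).
have iD : N.-integrable setT (EFin \o D).
  have := integrableB measurableT (integrable_drho_affine th' g') (integrable_drho_affine th g).
  exact: eq_integrable.
have mD : measurable_fun setT D by apply: measurable_funB; exact: measurable_drho_affine.
have D0 : \int[N]_z D z = 0.
  transitivity (mom_pi th' g' - mom_pi th g); last by rewrite e (subrr (mom_pi th' g')).
  exact: (RintegralB measurableT (integrable_drho_affine th' g') (integrable_drho_affine th g)).
have izD : N.-integrable setT (EFin \o (fun z => z * D z)).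
  have := integrableB measurableT (integrable_zdrho th' g') (integrable_zdrho th g).
  by apply: eq_integrable => [//|z _]; exact: (congr1 EFin (esym (mulrBr z _ _))).
have i0D : N.-integrable setT (EFin \o (fun z => z0 * D z)).
  by have := integrableZl measurableT z0 iD; apply: eq_integrable.
have zD : \int[N]_z (z * D z) = mom_zeta th' g' - mom_zeta th g.
  rewrite /mom_zeta -(RintegralB measurableT (integrable_zdrho th' g') (integrable_zdrho th g)).
  by apply: eq_Rintegral => z _; exact: mulrBr.
rewrite -subr_gt0 -zD.
have -> : \int[N]_z (z * D z) = \int[N]_z ((z - z0) * D z).
  transitivity (\int[N]_z (z * D z) - z0 * \int[N]_z D z).
    by rewrite D0 mulr0 subr0.
  rewrite -(RintegralZl z0 measurableT iD) -(RintegralB measurableT izD i0D).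
  by apply: eq_Rintegral => z _; exact: esym (mulrBl (D z) _ _).
have arg z : (th' + g' * z) - (th + g * z) = (g' - g) * (z - z0).
  by rewrite /z0; field; rewrite gt_eqF.
apply: (Rintegral_normal_gt0 (x0 := z0)).
- have mz : measurable_fun [set: R] (fun z : R => z - z0).
    by apply: measurable_funB; [exact: measurable_id|exact: measurable_cst].
  exact: (measurable_funM mz mD).
- have := integrableB measurableT izD i0D.
  by apply: eq_integrable => [//|z _]; exact: (congr1 EFin (esym (mulrBl (D z) _ _))).
- by rewrite subrr mul0r.
- move=> z; rewrite neq_lt => /orP[h|h].
    have hz : z - z0 < 0 by rewrite subr_lt0.
    have hD : D z < 0.
      by rewrite /D subr_lt0; apply: drho_lt; rewrite -subr_lt0 arg pmulr_rlt0.
    by rewrite nmulr_rgt0.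
  have hz : 0 < z - z0 by rewrite subr_gt0.
  have hD : 0 < D z.
    by rewrite /D subr_gt0; apply: drho_lt; rewrite -subr_gt0 arg mulr_gt0.
  exact: mulr_gt0.
Qed.

Lemma mom_pi_sup q g : q < 1 -> exists th, q < mom_pi th g.
Proof.
move=> q1; set C := 2 + 4 * g ^+ 2 * normal_m2.
have C0 : 0 <= C.
  by rewrite addr_ge0// mulr_ge0 ?normal_m2_ge0// mulr_ge0// sqr_ge0.
(* The tail bound is C / th; this choice makes it smaller than 1 - q and keeps th >= 1. *)
exists (1 + C / (1 - q)).
have q0 : 0 < 1 - q by rewrite subr_gt0.
have h0 : 0 <= C / (1 - q) by rewrite divr_ge0// ltW.
have := @mom_pi_tail (1 + C / (1 - q)) g; rewrite lerDl -/C => /(_ h0).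
have : C / (1 + C / (1 - q)) < 1 - q.
  rewrite ltr_pdivrMr; last by lra.
  by rewrite mulrDr mulr1 [X in _ < _ + X]mulrC mulfVK ?gt_eqF// ltrDr.
move: (mom_pi _ _) (C / _) => y y'; lra.
Qed.

Lemma mom_pi_inf q g : 0 < q -> exists th, mom_pi th g < q.
Proof.
move=> q0; have [|th h] := @mom_pi_sup (1 - q) (- g); first by lra.
by exists (- th); move: h; rewrite -(opprK g) mom_piN opprK; move: (mom_pi _ _) => y; lra.
Qed.

End MomentFacts.

(** * Inversion of the moment maps from monotonicity and Lipschitz bounds *)

Section MomentInverse.
Context {R : realType}.
Variables (pi_ zeta : R -> R -> R) (m1 m2 : R).
Implicit Types (x z th g q s u : R).
Hypothesis m1_ge0 : 0 <= m1.
Hypothesis m2_ge0 : 0 <= m2.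
Hypothesis pi_gt0 : forall th g, 0 < pi_ th g.
Hypothesis pi_lt1 : forall th g, pi_ th g < 1.
Hypothesis pi_lt : forall th th' g, th < th' -> pi_ th g < pi_ th' g.
Hypothesis pi_unbounded1 : forall q g, q < 1 -> exists th, q < pi_ th g.
Hypothesis pi_unbounded0 : forall q g, 0 < q -> exists th, pi_ th g < q.
Hypothesis pi_lip : forall th g th' g',
  `|pi_ th g - pi_ th' g'| <= `|th - th'| + `|g - g'| * m1.
Hypothesis zeta_lip : forall th g th' g',
  `|zeta th g - zeta th' g'| <= `|th - th'| * m1 + `|g - g'| * m2.
Hypothesis zeta0 : forall th, zeta th 0 = 0.
Hypothesis zeta_lt : forall th g th' g', g < g' -> pi_ th g = pi_ th' g' ->
  zeta th g < zeta th' g'.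

Lemma pi_le th th' g : (pi_ th g <= pi_ th' g) = (th <= th').
Proof.
have [h|h] := leP th th'; last by apply/negbTE; rewrite -ltNge pi_lt.
by move: h; rewrite le_eqVlt => /predU1P[->|/(pi_lt g)/ltW ->]; rewrite ?lexx.
Qed.

Lemma pi_inj g : injective (pi_ ^~ g : R -> R).
Proof. by move=> th th' /= e; apply/eqP; rewrite eq_le -(pi_le th th' g) -(pi_le th' th g) e lexx. Qed.

Lemma continuous_pi_ g : continuous (pi_ ^~ g : R -> R).
Proof.
move=> th; apply/cvgrPdist_le => /= e e0; near=> th'.
have := pi_lip th g th' g; rewrite (subrr g) normr0 mul0r addr0 => h.
apply: le_trans h _; near: th'.
by apply/nbhs_ballP; exists e => //= y /ltW.
Unshelve. all: by end_near. Qed.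

Lemma pi_surj q g : 0 < q < 1 -> exists th, pi_ th g = q.
Proof.
move=> /andP[q0 q1].
have [a ha] := pi_unbounded0 g q0; have [b hb] := pi_unbounded1 g q1.
have ab : a <= b by rewrite -(pi_le a b g) (le_trans (ltW ha) (ltW hb)).
have hq : Num.min (pi_ a g) (pi_ b g) <= q <= Num.max (pi_ a g) (pi_ b g).
  by rewrite ge_min le_max (ltW ha) (ltW hb) orbT.
have [c _ hc] := IVT ab (continuous_subspaceT (@continuous_pi_ g)) hq.
by exists c.
Qed.

(** The level curve pi = q as a graph over g. For q outside (0, 1) there is no such curve and the
    value is the default 0. *)
Definition moment_theta q g : R := xget 0 [set th | pi_ th g = q].

Lemma moment_thetaK q g : 0 < q < 1 -> pi_ (moment_theta q g) g = q.
Proof.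
by move=> /pi_surj-/(_ g)[th h]; rewrite /moment_theta; case: xgetP => [? ->//|/(_ th)].
Qed.

Lemma moment_theta_unique q g th : pi_ th g = q -> moment_theta q g = th.
Proof.
move=> h; apply: (@pi_inj g); rewrite moment_thetaK// -h.
by rewrite pi_gt0 pi_lt1.
Qed.

Lemma moment_theta_le q g u : 0 < q < 1 -> (moment_theta q g <= u) = (q <= pi_ u g).
Proof. by move=> q01; rewrite -(pi_le _ _ g) moment_thetaK. Qed.

Lemma moment_theta_ge q g u : 0 < q < 1 -> (u <= moment_theta q g) = (pi_ u g <= q).
Proof. by move=> q01; rewrite -(pi_le _ _ g) moment_thetaK. Qed.

(** Strict monotonicity takes the place of a lower bound on the derivative: pi at th - e and at th +
    e brackets q strictly, and the bracket survives small changes of q and g. *)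
Lemma moment_theta_cont q g e : 0 < q < 1 -> 0 < e -> exists2 r, 0 < r &
  forall q' g', 0 < q' < 1 -> `|q - q'| <= r -> `|g - g'| <= r ->
    `|moment_theta q g - moment_theta q' g'| <= e.
Proof.
move=> q01 e0; set th := moment_theta q g.
have thK : pi_ th g = q by exact: moment_thetaK.
have lo : pi_ (th - e) g < q by rewrite -thK pi_lt// ltrBlDr ltrDl.
have hi : q < pi_ (th + e) g by rewrite -thK pi_lt// ltrDl.
pose a := Num.min (q - pi_ (th - e) g) (pi_ (th + e) g - q).
have a0 : 0 < a by rewrite lt_min !subr_gt0 lo.
have m0 := m1_ge0.
(* An error r in q and an error r in g, which moves pi by at most r m1, together use up exactly the
   gap [a]. *)
exists (a / (1 + m1)); first by rewrite divr_gt0//; lra.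
move=> q' g' q'01 hq hg.
have K u : `|pi_ u g - pi_ u g'| <= a / (1 + m1) * m1.
  apply: le_trans (pi_lip _ _ _ _) _.
  by rewrite (subrr u) normr0 add0r ler_wpM2r.
have E : a / (1 + m1) + a / (1 + m1) * m1 = a.
  by have : 1 + m1 != 0 :> R by [lra]; move=> ?; field.
have [al ah] : a <= q - pi_ (th - e) g /\ a <= pi_ (th + e) g - q.
  by split; rewrite ge_min lexx ?orbT.
have h1 : moment_theta q' g' <= th + e.
  rewrite moment_theta_le//; have := K (th + e); rewrite ler_norml => /andP[_ ?].
  by move: hq; rewrite ler_norml => /andP[? _]; lra.
have h2 : th - e <= moment_theta q' g'.
  rewrite moment_theta_ge//; have := K (th - e); rewrite ler_norml => /andP[? _].
  by move: hq; rewrite ler_norml => /andP[_ ?]; lra.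
by rewrite ler_norml; apply/andP; split; lra.
Qed.

Definition moment_zeta q g : R := zeta (moment_theta q g) g.

Lemma moment_zeta0 q : moment_zeta q 0 = 0.
Proof. exact: zeta0. Qed.

Lemma moment_zeta_lt q g g' : 0 < q < 1 -> g < g' -> moment_zeta q g < moment_zeta q g'.
Proof. by move=> q01 gg'; apply: zeta_lt => //; rewrite !moment_thetaK. Qed.

Lemma moment_zeta_le q g g' : 0 < q < 1 -> (moment_zeta q g <= moment_zeta q g') = (g <= g').
Proof.
move=> q01; have [h|h] := leP g g'; last by apply/negbTE; rewrite -ltNge moment_zeta_lt.
by move: h; rewrite le_eqVlt => /predU1P[->|/(moment_zeta_lt q01)/ltW ->]; rewrite ?lexx.
Qed.

Lemma moment_zeta_cont q g e : 0 < q < 1 -> 0 < e -> exists2 r, 0 < r &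
  forall q' g', 0 < q' < 1 -> `|q - q'| <= r -> `|g - g'| <= r ->
    `|moment_zeta q g - moment_zeta q' g'| <= e.
Proof.
move=> q01 e0.
have m10 := m1_ge0; have m20 := m2_ge0.
set M := 1 + m1 + m2.
have M0 : 0 < M by rewrite /M; lra.
have eM0 : 0 < e / M by rewrite divr_gt0.
have [r r0 H] := moment_theta_cont g q01 eM0.
exists (Num.min r (e / M)); first by rewrite lt_min r0.
move=> q' g' q'01; rewrite !le_min => /andP[h1 _] /andP[h2 h3].
have h4 := H _ _ q'01 h1 h2.
apply: le_trans (zeta_lip _ _ _ _) _.
apply: (@le_trans _ _ (e / M * m1 + e / M * m2)).
  by rewrite lerD// ler_wpM2r.
rewrite -mulrDr -[leRHS](divfK (lt0r_neq0 M0)) ler_wpM2l ?(ltW eM0)// /M; lra.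
Qed.

Definition moment_sol q s (v : R * R) : Prop :=
  [/\ 0 <= v.2, pi_ v.1 v.2 = q & zeta v.1 v.2 = s].

Definition moment_est q s : R * R := xget (0, 0) [set v | unique (moment_sol q s) v].

Lemma moment_sol_theta q s v : moment_sol q s v ->
  [/\ 0 < q < 1, v.1 = moment_theta q v.2 & moment_zeta q v.2 = s].
Proof.
move=> [g0 hq hs]; have e := moment_theta_unique hq.
by rewrite /moment_zeta e hs -hq pi_gt0 pi_lt1.
Qed.

(** Both solutions lie on the level curve of q, along which zeta is strictly increasing in g. *)
Lemma moment_sol_unique q s v : moment_sol q s v -> unique (moment_sol q s) v.
Proof.
move=> hv; split=> // v' hv'.
have [q01 t z] := moment_sol_theta hv; have [_ t' z'] := moment_sol_theta hv'.
have e : v.2 = v'.2.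
  by apply/eqP; rewrite eq_le -(moment_zeta_le v.2 v'.2 q01) -(moment_zeta_le v'.2 v.2 q01) z z' lexx.
by move: v v' t t' e {hv hv' z z'} => [a b] [a' b'] /= -> -> ->.
Qed.

Lemma moment_est_sol q s v : moment_sol q s v -> moment_est q s = v.
Proof.
move=> hv; rewrite /moment_est; case: xgetP => [v' -> [h _]|/(_ v) H].
  by have [_ /(_ _ h) ->] := moment_sol_unique hv.
by exfalso; apply: H; exact: moment_sol_unique.
Qed.

Lemma moment_est_none q s : (forall v, ~ moment_sol q s v) -> moment_est q s = (0, 0).
Proof. by move=> H; rewrite /moment_est; case: xgetP => // v _ [/H]. Qed.

Lemma continuous_moment_zeta q : 0 < q < 1 -> continuous (moment_zeta q).
Proof.
move=> q01 g; apply/cvgrPdist_le => /= e e0.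
have [r r0 H] := moment_zeta_cont g q01 e0.
apply/nbhs_ballP; exists r => //= g' /ltW gg'; apply: H => //.
by rewrite subrr normr0 ltW.
Qed.

Lemma moment_sol_exists q s a b : 0 < q < 1 -> 0 <= a -> a <= b ->
  moment_zeta q a <= s -> s <= moment_zeta q b ->
  exists2 g, a <= g <= b & moment_sol q s (moment_theta q g, g).
Proof.
move=> q01 a0 ab sa sb.
have hs : Num.min (moment_zeta q a) (moment_zeta q b) <= s <=
    Num.max (moment_zeta q a) (moment_zeta q b).
  by rewrite ge_min le_max sa sb orbT.
have [g] := IVT ab (continuous_subspaceT (continuous_moment_zeta q01)) hs.
rewrite in_itv/= => /andP[ag gb] hg; exists g; first by rewrite ag.
by split => /=; [exact: le_trans ag|exact: moment_thetaK|].
Qed.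

(** At the true q, zeta along the level curve lies strictly on either side of the true value at g0 -
    d and g0 + d. For nearby q and s the bracket persists, so the intermediate value theorem
    produces a solution between; by uniqueness it is the estimate, and theta follows from
    [moment_theta_cont]. *)
Lemma moment_est_cvg th0 g0 e : 0 <= g0 -> 0 < e -> exists2 r, 0 < r &
  forall q s, 0 <= s -> `|pi_ th0 g0 - q| <= r -> `|zeta th0 g0 - s| <= r ->
    [/\ moment_sol q s (moment_est q s), `|th0 - (moment_est q s).1| <= e &
      `|g0 - (moment_est q s).2| <= e].
Proof.
move=> g00 e0; set q0 := pi_ th0 g0; set s0 := zeta th0 g0.
have q01 : 0 < q0 < 1 by rewrite pi_gt0 pi_lt1.
have th0E : moment_theta q0 g0 = th0 by exact: moment_theta_unique.
have s0E : moment_zeta q0 g0 = s0 by rewrite /moment_zeta th0E.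
have [r1 r10 H1] := moment_theta_cont g0 q01 e0.
(* Being at most r1, d keeps every g of the bracket within reach of the modulus for theta. *)
pose d := Num.min r1 e.
have d0 : 0 < d by rewrite lt_min r10.
have [dr de] : d <= r1 /\ d <= e by split; rewrite ge_min lexx ?orbT.
have hb : s0 < moment_zeta q0 (g0 + d) by rewrite -s0E moment_zeta_lt// ltrDl.
(* Half the gap: s may use one half and the change of the curve with q the other. *)
pose b1 := (moment_zeta q0 (g0 + d) - s0) / 2.
have b10 : 0 < b1 by rewrite divr_gt0// subr_gt0.
have [r2 r20 H2] := moment_zeta_cont (g0 + d) q01 b10.
(* The lower endpoint of the bracket is 0 when the interval sticks out of the
   domain, where the inequality is moment_zeta q 0 = 0 <= s. *)
pose a := Num.max 0 (g0 - d).
have [r3 r30 H3] : exists2 r3, 0 < r3 & forall q s, 0 <= s -> 0 < q < 1 ->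
    `|q0 - q| <= r3 -> `|s0 - s| <= r3 -> moment_zeta q a <= s.
  rewrite /a; case: (leP (g0 - d) 0) => [h|h].
    by exists 1 => // q s s00 _ _ _; rewrite moment_zeta0.
  have ha : moment_zeta q0 (g0 - d) < s0 by rewrite -s0E moment_zeta_lt// ltrBlDr ltrDl.
  pose b2 := (s0 - moment_zeta q0 (g0 - d)) / 2.
  have b20 : 0 < b2 by rewrite divr_gt0// subr_gt0.
  have [r3 r30 H3] := moment_zeta_cont (g0 - d) q01 b20.
  exists (Num.min r3 b2); first by rewrite lt_min r30.
  move=> q s s00 q01'; rewrite !le_min => /andP[h1 _] /andP[_ h2].
  have := H3 q (g0 - d) q01' h1; rewrite subrr normr0 => /(_ (ltW r30)).
  move: h2; rewrite !ler_norml /b2 => /andP[_ ?] /andP[? _].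
  lra.
(* This keeps q inside (0, 1). *)
pose r4 := Num.min q0 (1 - q0) / 2.
have r40 : 0 < r4 by rewrite divr_gt0// lt_min subr_gt0.
have [r4a r4b] : r4 <= q0 / 2 /\ r4 <= (1 - q0) / 2.
  by split; rewrite /r4 ler_pM2r ?invr_gt0// ge_min lexx ?orbT.
exists (Num.min (Num.min r1 r2) (Num.min (Num.min r3 r4) b1)).
  by rewrite !lt_min r10 r20 r30 r40.
move=> q s s00; rewrite !le_min => /andP[/andP[hq1 hq2] /andP[/andP[hq3 hq4] _]].
move=> /andP[/andP[_ _] /andP[/andP[hs3 _] hsb]].
have q01' : 0 < q < 1.
  move: hq4 q01; rewrite ler_norml => /andP[? ?] /andP[? ?].
  by apply/andP; split; lra.
have sb : s <= moment_zeta q (g0 + d).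
  have := H2 q (g0 + d) q01' hq2; rewrite subrr normr0 => /(_ (ltW r20)).
  by move: hsb; rewrite !ler_norml /b1 => /andP[? _] /andP[_ ?]; lra.
have sa := H3 _ _ s00 q01' hq3 hs3.
have a0 : 0 <= a by rewrite /a le_max lexx.
have ab : a <= g0 + d by rewrite /a ge_max addr_ge0 ?(ltW d0)//=; lra.
have [g /andP[ag gb] hg] := moment_sol_exists q01' a0 ab sa sb.
have gd : `|g0 - g| <= d.
  have : g0 - d <= g by apply: le_trans ag; rewrite /a le_max lexx orbT.
  by rewrite ler_norml => ?; apply/andP; split; lra.
rewrite (moment_est_sol hg) /=; split => //; last exact: le_trans gd de.
by rewrite -th0E; apply: H1 => //; exact: le_trans gd dr.
Qed.

Section Measurability.
Context d (T : measurableType d).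

Lemma measurable_set_lt (f h : T -> R) : measurable_fun setT f ->
  measurable_fun setT h -> measurable [set w | f w < h w].
Proof.
by move=> mf mh; rewrite -[X in measurable X]setTI; exact: measurable_fun_ltr.
Qed.

Lemma measurable_set_le (f h : T -> R) : measurable_fun setT f ->
  measurable_fun setT h -> measurable [set w | f w <= h w].
Proof.
by move=> mf mh; rewrite -[X in measurable X]setTI; exact: measurable_fun_ler.
Qed.

Lemma measurable_fun_gtP (f : T -> R) :
  (forall u, measurable [set w | u < f w]) -> measurable_fun setT f.
Proof.
move=> H; apply: (measurability _ (RGenOInfty.measurableE R)) => /= _ [_ [u ->] <-].
rewrite setTI; have := H u; congr measurable.
by apply/seteqP; split => w /=; rewrite in_itv/= andbT.
Qed.

Variables (q s : T -> R).
Hypotheses (mq : measurable_fun setT q) (ms : measurable_fun setT s).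

Lemma measurable_unit : measurable [set w | 0 < q w < 1].
Proof.
rewrite (_ : [set w | _] = [set w | 0 < q w] `&` [set w | q w < 1]).
  by apply: measurableI; apply: measurable_set_lt.
by apply/seteqP; split => w /=; [move=> /andP[]|move=> [-> ->]].
Qed.

Lemma measurable_pi_ u (g : T -> R) : measurable_fun setT g ->
  measurable_fun setT (fun w => pi_ u (g w)).
Proof.
move=> mg; apply: (measurableT_comp (f := pi_ u)) mg.
apply: continuous_measurable_fun => x; apply/cvgrPdist_le => /= e e0.
have m0 := m1_ge0; have e1 : 0 < e / (1 + m1) by rewrite divr_gt0//; lra.
apply/nbhs_ballP; exists (e / (1 + m1)) => //= y /ltW xy.
apply: le_trans (pi_lip _ _ _ _) _; rewrite subrr normr0 add0r.
apply: (@le_trans _ _ (e / (1 + m1) * m1)); first by rewrite ler_wpM2r.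
rewrite -[leRHS](@divfK _ (1 + m1)); last by apply: lt0r_neq0; lra.
by rewrite ler_wpM2l ?(ltW e1)//; lra.
Qed.

Lemma moment_theta_out q' g : ~~ (0 < q' < 1) -> moment_theta q' g = 0.
Proof.
move=> h; rewrite /moment_theta; case: xgetP => // th _ e; move: h.
by rewrite -e pi_gt0 pi_lt1.
Qed.

(** By monotonicity theta > u amounts to pi u < q, so the superlevel sets of a value defined by
    choice become explicit inequalities. *)
Lemma measurable_moment_theta (g : T -> R) : measurable_fun setT g ->
  measurable_fun setT (fun w => moment_theta (q w) (g w)).
Proof.
move=> mg; apply: measurable_fun_gtP => u.
rewrite (_ : [set w | _] =
  ([set w | 0 < q w < 1] `&` [set w | pi_ u (g w) < q w]) `|`
  (* Outside the unit interval the value is 0, which exceeds u exactly when u < 0. *)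
  (~` [set w | 0 < q w < 1] `&` [set w | u < 0])).
  apply: measurableU; apply: measurableI.
  - exact: measurable_unit.
  - by apply: measurable_set_lt => //; exact: measurable_pi_.
  - exact/measurableC/measurable_unit.
  - by apply: measurable_set_lt; exact: measurable_cst.
apply/seteqP; split => w /=.
  have [h|h] := boolP (0 < q w < 1).
    by rewrite ltNge moment_theta_le// -ltNge; left.
  by rewrite moment_theta_out//; right; split=> //; exact/negP.
move=> [[h]|[/negP h u0]]; last by rewrite moment_theta_out.
by rewrite (ltNge u) moment_theta_le// -ltNge.
Qed.

Lemma measurable_moment_zeta t : measurable_fun setT (fun w => moment_zeta (q w) t).
Proof.
apply: (measurableT_comp (f := zeta ^~ t)); last exact: measurable_moment_theta.
apply: continuous_measurable_fun => x; apply/cvgrPdist_le => /= e e0.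
have m0 := m1_ge0; have e1 : 0 < e / (1 + m1) by rewrite divr_gt0//; lra.
apply/nbhs_ballP; exists (e / (1 + m1)) => //= y /ltW xy.
apply: le_trans (zeta_lip _ _ _ _) _; rewrite (subrr t) normr0 mul0r addr0.
apply: (@le_trans _ _ (e / (1 + m1) * m1)); first by rewrite ler_wpM2r.
rewrite -[leRHS](@divfK _ (1 + m1)); last by apply: lt0r_neq0; lra.
by rewrite ler_wpM2l ?(ltW e1)//; lra.
Qed.

Hypothesis s_ge0 : forall w, 0 <= s w.

(** For u >= 0 the estimate exceeds u exactly when there is a solution beyond u, that is, when s is
    above the curve at u and is reached by some integer. Existence enters through a countable union
    because the curve need not take all values. *)
Lemma measurable_moment_est2 : measurable_fun setT (fun w => (moment_est (q w) (s w)).2).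
Proof.
apply: measurable_fun_gtP => u.
(* Solutions and the default are nonnegative, so a negative u is always exceeded. *)
have [u0|u0] := ltP u 0.
  rewrite (_ : [set w | _] = setT)//; apply/seteqP; split => // w _ /=.
  have [[v hv]|h] := pselect (exists v, moment_sol (q w) (s w) v).
    by rewrite (moment_est_sol hv); case: hv => g0 _ _; exact: lt_le_trans g0.
  by rewrite moment_est_none// => v hv; apply: h; exists v.
rewrite (_ : [set w | _] = ([set w | 0 < q w < 1] `&` [set w | moment_zeta (q w) u < s w])
   `&` \bigcup_n [set w | s w <= moment_zeta (q w) n%:R]).
  apply: measurableI; first apply: measurableI.
  - exact: measurable_unit.
  - by apply: measurable_set_lt => //; exact: measurable_moment_zeta.
  - by apply: bigcup_measurable => n _; apply: measurable_set_le => //; exact: measurable_moment_zeta.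
apply/seteqP; split => w /=.
  have [[v hv]|h] := pselect (exists v, moment_sol (q w) (s w) v); last first.
    by rewrite moment_est_none/= ?ltNge ?u0// => v hv; apply: h; exists v.
  rewrite (moment_est_sol hv) => uv; have [q01 _ hs] := moment_sol_theta hv.
  split; first by split => //=; rewrite -hs; exact: moment_zeta_lt.
  exists (Num.truncn v.2).+1 => //=; rewrite -hs moment_zeta_le// ltW//.
  by have := truncnS_gt v.2.
move=> [[q01 us] [n _ /= sn]].
have un : u <= n%:R by rewrite -(moment_zeta_le _ _ q01) (le_trans (ltW us)).
have [g /andP[ug _] hg] := moment_sol_exists q01 u0 un (ltW us) sn.
rewrite (moment_est_sol hg)/= lt_neqAle ug andbT; apply/eqP => e.
by have [_ _ /=] := moment_sol_theta hg; rewrite -e => e'; move: us; rewrite e' ltxx.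
Qed.

Lemma measurable_moment_est1 : measurable_fun setT (fun w => (moment_est (q w) (s w)).1).
Proof.
(* The event that a solution exists: the lower end of the bracket is automatic, since the curve
   starts at 0 <= s. Off this event the indicator produces the default 0. *)
pose S := [set w | 0 < q w < 1] `&` \bigcup_n [set w | s w <= moment_zeta (q w) n%:R].
have mS : measurable S.
  apply: measurableI; first exact: measurable_unit.
  by apply: bigcup_measurable => n _; apply: measurable_set_le => //; exact: measurable_moment_zeta.
rewrite (_ : (fun w => _) = fun w => \1_S w * moment_theta (q w) (moment_est (q w) (s w)).2).
  apply: measurable_funM; first exact: measurable_indic.
  exact/measurable_moment_theta/measurable_moment_est2.
apply/funext => w; rewrite indicE.
have [[v hv]|h] := pselect (exists v, moment_sol (q w) (s w) v).
  rewrite (moment_est_sol hv); have [q01 -> hs] := moment_sol_theta hv.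
  rewrite mem_set ?mul1r//; split => //.
  exists (Num.truncn v.2).+1 => //=; rewrite -hs moment_zeta_le// ltW//.
  by have := truncnS_gt v.2.
rewrite moment_est_none/=; last by move=> v hv; apply: h; exists v.
rewrite memNset ?mul0r// => -[q01 [n _ sn]]; apply: h.
have [|g _ hg] := moment_sol_exists q01 (lexx 0) (ler0n _ n) _ sn.
  by rewrite moment_zeta0.
by exists (moment_theta (q w) g, g).
Qed.

End Measurability.

End MomentInverse.

(** * Independence *)

Lemma measurable_preimage d d1 (T : measurableType d) (U : measurableType d1) (X : T -> U) A :
  measurable_fun setT X -> measurable A -> measurable (X @^-1` A).
Proof. by move=> mX mA; rewrite -[X in measurable X]setTI; exact: mX. Qed.

Section Independence.
Context d (T : measurableType d) (R : realType) (P : probability T R).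
Local Open Scope ereal_scope.

Lemma independent2_sym d1 (U : measurableType d1) d2 (V : measurableType d2)
    (X : T -> U) (Y : T -> V) :
  independent2 P X Y -> independent2 P Y X.
Proof. by move=> h A B mA mB; rewrite setIC h// muleC. Qed.

Lemma independent2_comp d1 (U : measurableType d1) d2 (V : measurableType d2)
    d3 (U' : measurableType d3) d4 (V' : measurableType d4)
    (X : T -> U) (Y : T -> V) (f : U -> U') (g : V -> V') :
  measurable_fun setT f -> measurable_fun setT g ->
  independent2 P X Y -> independent2 P (f \o X) (g \o Y).
Proof.
move=> mf mg h A B mA mB.
exact: (h _ _ (measurable_preimage mf mA) (measurable_preimage mg mB)).
Qed.

(** In A, both sides are finite measures, and they agree on a generator stable under intersection,
    hence everywhere. *)
Lemma independent_event_gen d1 (U : measurableType d1) (X : T -> U)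
    (G : set (set U)) (E : set T) :
  measurable_fun setT X -> measurable E ->
  @measurable _ U = <<s G >> -> setI_closed G -> G setT ->
  (forall A, G A -> P ((X @^-1` A) `&` E) = P (X @^-1` A) * P E) ->
  forall A, measurable A -> P ((X @^-1` A) `&` E) = P (X @^-1` A) * P E.
Proof.
move=> mX mE GE GI GT GP A mA.
pose X' : {mfun T >-> U} := mfun_Sub (mem_set mX).
have r0 : (0 <= fine (P E))%R by rewrite fine_ge0.
have [m1 m1E] : exists m1 : {measure set U -> \bar R}, forall C, m1 C = P (X @^-1` C `&` E).
  by unshelve eexists (pushforward (mrestr P mE) X' : {measure set U -> \bar R}).
pose m2 := mscale (NngNum r0) (distribution P X').
have m2E C : m2 C = P (X @^-1` C) * P E.
  by rewrite /m2 /mscale /distribution /pushforward/= fineK ?fin_num_measure// muleC.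
rewrite -m1E -m2E.
apply: (measure_unique G (fun=> [set: U])) => //.
- by rewrite bigcup_const.
- by move=> C GC; rewrite m1E [RHS]m2E -GP.
- move=> _; rewrite m1E.
  apply: (le_lt_trans (probability_le1 P _)); last exact: ltry.
  by apply: measurableI => //; exact: measurable_preimage.
Qed.

Lemma independent2_gen d1 (U : measurableType d1) d2 (V : measurableType d2)
    (X : T -> U) (Y : T -> V) (G : set (set U)) :
  measurable_fun setT X -> measurable_fun setT Y ->
  @measurable _ U = <<s G >> -> setI_closed G -> G setT ->
  (forall A B, G A -> measurable B ->
     P ((X @^-1` A) `&` (Y @^-1` B)) = P (X @^-1` A) * P (Y @^-1` B)) ->
  independent2 P X Y.
Proof.
move=> mX mY GE GI GT GP A B mA mB.
by apply: (independent_event_gen mX (measurable_preimage mY mB) GE GI GT) => // C GC; exact: GP.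
Qed.

Lemma setI_closed_rectangles d1 (U1 : measurableType d1) d2 (U2 : measurableType d2) :
  setI_closed [set A `*` B | A in @measurable _ U1 & B in @measurable _ U2].
Proof.
move=> _ _ [A1 mA1 [A2 mA2 <-]] [B1 mB1 [B2 mB2 <-]]; rewrite -setXI.
by exists (A1 `&` B1); [exact: measurableI|exists (A2 `&` B2) => //; exact: measurableI].
Qed.

Lemma setT_rectangle d1 (U1 : measurableType d1) d2 (U2 : measurableType d2) :
  [set A `*` B | A in @measurable _ U1 & B in @measurable _ U2] setT.
Proof. by exists setT => //; exists setT => //; rewrite setXTT. Qed.

Lemma independent2_pair d1 (U1 : measurableType d1) d2 (U2 : measurableType d2)
    d3 (V : measurableType d3) (X1 : T -> U1) (X2 : T -> U2) (Y : T -> V) :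
  measurable_fun setT X1 -> measurable_fun setT X2 -> measurable_fun setT Y ->
  (forall A1 A2 B, measurable A1 -> measurable A2 -> measurable B ->
    P ((X1 @^-1` A1 `&` X2 @^-1` A2) `&` (Y @^-1` B)) =
    P (X1 @^-1` A1 `&` X2 @^-1` A2) * P (Y @^-1` B)) ->
  independent2 P (fun w => (X1 w, X2 w)) Y.
Proof.
move=> mX1 mX2 mY H.
apply: (independent2_gen _ mY (measurable_prod_measurableType U1 U2)
  (@setI_closed_rectangles _ U1 _ U2) (setT_rectangle U1 U2)).
- exact: measurable_fun_pair.
- by move=> _ B [A1 mA1 [A2 mA2 <-]] mB; exact: H.
Qed.

(** The generator argument runs once per side: rectangles for Y with a rectangle event for X held
    fixed, then rectangles for X with an arbitrary event for Y. *)
Lemma independent2_pairs d1 (U1 : measurableType d1) d2 (U2 : measurableType d2)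
    d3 (V1 : measurableType d3) d4 (V2 : measurableType d4)
    (X1 : T -> U1) (X2 : T -> U2) (Y1 : T -> V1) (Y2 : T -> V2) :
  measurable_fun setT X1 -> measurable_fun setT X2 ->
  measurable_fun setT Y1 -> measurable_fun setT Y2 ->
  (forall A1 A2 B1 B2, measurable A1 -> measurable A2 -> measurable B1 -> measurable B2 ->
    P ((X1 @^-1` A1 `&` X2 @^-1` A2) `&` (Y1 @^-1` B1 `&` Y2 @^-1` B2)) =
    P (X1 @^-1` A1 `&` X2 @^-1` A2) * P (Y1 @^-1` B1 `&` Y2 @^-1` B2)) ->
  independent2 P (fun w => (X1 w, X2 w)) (fun w => (Y1 w, Y2 w)).
Proof.
move=> mX1 mX2 mY1 mY2 H.
apply: independent2_pair => //; first exact: measurable_fun_pair.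
move=> A1 A2 B mA1 mA2 mB; rewrite setIC muleC.
have mE : measurable (X1 @^-1` A1 `&` X2 @^-1` A2).
  by apply: measurableI; exact: measurable_preimage.
apply: (independent_event_gen (measurable_fun_pair mY1 mY2) mE
  (measurable_prod_measurableType V1 V2) (@setI_closed_rectangles _ V1 _ V2)
  (setT_rectangle V1 V2)) => //.
by move=> _ [B1 mB1 [B2 mB2 <-]]; rewrite setIC muleC; exact: H.
Qed.

(** Boxes, unlike cylinders over one coordinate, are stable under intersection, as the generator
    argument requires. *)
Lemma tuple_measurable_boxes d1 (U : measurableType d1) n :
  @measurable _ (n.-tuple U) =
  <<s [set [set t : n.-tuple U | forall i, A i (tnth t i)] |
      A in [set A : 'I_n -> set U | forall i, measurable (A i)]] >>.
Proof.
rewrite eqEsubset; split.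
  apply: smallest_sub; first exact: smallest_sigma_algebra.
  move=> B; rewrite -bigcup_seq/= => -[i _ [A mA <-]].
  apply: sub_sigma_algebra => /=; exists (fun j => if j == i then A else setT).
    by move=> j; case: ifP.
  apply/seteqP; split => t /=.
    by move=> /(_ i); rewrite eqxx; split.
  by move=> [_ h] j; case: eqP => // ->.
apply: smallest_sub; first exact: sigma_algebra_measurable.
move=> _ [A mA <-].
rewrite (_ : [set t | _] = \bigcap_(i in [set: 'I_n]) ((@tnth n U ^~ i) @^-1` A i)).
  apply: fin_bigcap_measurable => // i _.
  by rewrite -[X in measurable X]setTI; exact: measurable_tnth.
by apply/seteqP; split => t /= h i; [move=> _|]; exact: h.
Qed.

Lemma independent2_tuple n d1 (U : measurableType d1) d2 (V : measurableType d2)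
    (X : 'I_n -> T -> U) (Y : T -> V) :
  (forall i, measurable_fun setT (X i)) -> measurable_fun setT Y ->
  (forall (A : 'I_n -> set U) B, (forall i, measurable (A i)) -> measurable B ->
    P ((\bigcap_i (X i @^-1` A i)) `&` (Y @^-1` B)) =
    P (\bigcap_i (X i @^-1` A i)) * P (Y @^-1` B)) ->
  independent2 P (fun w => [tuple X i w | i < n]) Y.
Proof.
move=> mX mY H.
have E (A : 'I_n -> set U) : (fun w => [tuple X i w | i < n]) @^-1`
    [set t : n.-tuple U | forall i, A i (tnth t i)] = \bigcap_i (X i @^-1` A i).
  apply/seteqP; split => w /= h i; first by move=> _; have := h i; rewrite tnth_mktuple.
  by rewrite tnth_mktuple; exact: h.
apply: (independent2_gen _ _ (tuple_measurable_boxes U n)) => //.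
- apply/measurable_fun_tnthP => i; rewrite [X in measurable_fun _ X](_ : _ = X i)//.
  by apply/funext => w /=; rewrite tnth_mktuple.
- move=> _ _ [A mA <-] [B mB <-]; exists (fun i => A i `&` B i).
    by move=> i; exact: measurableI.
  apply/seteqP; split => t /=; first by move=> h; split => i; have [] := h i.
  by move=> [h1 h2] i; split.
- exists (fun=> setT) => //; by apply/seteqP; split.
- by move=> _ B [A mA <-] mB; rewrite E; exact: H.
Qed.

(* The k-th component is overwritten by a constant rather than removed, so that
   all the tuples of "other" components have the same type. *)
Definition others n (U : Type) (u0 : U) (X : 'I_n -> T -> U) (k : 'I_n) (w : T) : n.-tuple U :=
  [tuple if i == k then u0 else X i w | i < n].

Lemma measurable_mktuple n d1 (U : measurableType d1) (X : 'I_n -> T -> U) :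
  (forall i, measurable_fun setT (X i)) ->
  measurable_fun setT (fun w => [tuple X i w | i < n]).
Proof.
move=> mX; apply/measurable_fun_tnthP => i.
rewrite [X in measurable_fun _ X](_ : _ = X i)//.
by apply/funext => w /=; rewrite tnth_mktuple.
Qed.

Lemma measurable_others n d1 (U : measurableType d1) u0 (X : 'I_n -> T -> U) k :
  (forall i, measurable_fun setT (X i)) -> measurable_fun setT (others u0 X k).
Proof. by move=> mX; apply: measurable_mktuple => i; case: (i == k). Qed.

(** The constant in slot [k] either violates its constraint, and the event is empty, or satisfies
    it, and the slot is free. In the second case B can be put there, and the product rule applies
    with and without it. *)
Lemma mutually_independent_others n d1 (U : measurableType d1) (u0 : U)
    (X : 'I_n -> T -> U) (k : 'I_n) :
  (forall i, measurable_fun setT (X i)) -> mutually_independent P X ->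
  independent2 P (others u0 X k) (X k).
Proof.
move=> mX iX; apply: independent2_tuple => //.
  by move=> i; case: (i == k).
move=> A B mA mB.
have [Ak|Ak] := pselect (A k u0); last first.
  rewrite (_ : \bigcap_i _ = set0); first by rewrite set0I measure0 mul0e.
  by rewrite -subset0 => w /(_ k I) /=; rewrite eqxx.
pose C i : set U := if i == k then setT else A i.
have mC i : measurable (C i) by rewrite /C; case: ifP.
have -> : \bigcap_i ((fun w => if i == k then u0 else X i w) @^-1` A i) =
    \bigcap_i (X i @^-1` C i).
  apply/seteqP; split => w h i _; have := h i I; rewrite /C /=; case: eqP => // -> _.
  exact: Ak.
pose D i : set U := if i == k then B else A i.
have mD i : measurable (D i) by rewrite /D; case: ifP.
have -> : \bigcap_i (X i @^-1` C i) `&` X k @^-1` B = \bigcap_i (X i @^-1` D i).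
  apply/seteqP; split => w /=.
    by move=> [h hB] i _; have := h i I; rewrite /C /D /=; case: eqP => // ->.
  move=> h; split; last by have := h k I; rewrite /D /= eqxx.
  by move=> i _; have := h i I; rewrite /C /D /=; case: eqP.
rewrite (iX _ mD) (iX _ mC) (bigD1 k)//= [in RHS](bigD1 k)//= /C /D eqxx.
rewrite preimage_setT probability_setT mul1e muleC; congr (_ * _).
by apply: eq_bigr => i /negbTE ->.
Qed.

End Independence.

Section Freezing.
Context d (T : measurableType d) (R : realType) (P : probability T R).
Context d1 (U : measurableType d1) d2 (V : measurableType d2).
Variables (X : T -> U) (Y : T -> V).
Hypotheses (mX : measurable_fun setT X) (mY : measurable_fun setT Y).
Hypothesis XY : independent2 P X Y.
Local Open Scope ereal_scope.

Let X' : {RV P >-> U} := mfun_Sub (mem_set mX).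
Let Y' : {RV P >-> V} := mfun_Sub (mem_set mY).
Let mZ : measurable_fun setT (fun w => (X w, Y w)).
Proof. exact: measurable_fun_pair. Qed.
Let Z' : {RV P >-> (U * V)%type} := mfun_Sub (mem_set mZ).

Let joint A : measurable A ->
  (distribution P X' \x distribution P Y') A = distribution P Z' A.
Proof.
by move=> mA; apply: product_measure_unique.
Qed.

(** Independence makes the joint law the product of the marginal laws, so Tonelli applies. The inner
    integral averages over X while Y is frozen. *)
Lemma ge0_integral_independent2 (f : U * V -> \bar R) :
  measurable_fun setT f -> (forall z, 0 <= f z) ->
  \int[P]_w f (X w, Y w) = \int[P]_w \int[P]_v f (X v, Y w).
Proof.
move=> mf f0.
have -> : \int[P]_w f (X w, Y w) = \int[distribution P Z']_z f z.
  by rewrite ge0_integral_distribution.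
rewrite (eq_measure_integral (distribution P X' \x distribution P Y')); last first.
  by move=> A mA _; exact/esym/joint.
rewrite fubini_tonelli2// ge0_integral_distribution; last 2 first.
- exact: measurable_fun_fubini_tonelli_G.
- by move=> y; exact: integral_ge0.
apply: eq_integral => w _ /=; rewrite /fubini_G ge0_integral_distribution//.
exact: (measurableT_comp mf (measurable_pair2 (Y w))).
Qed.

(** Fubini for signed f, with X frozen this time. Integrability is asked of every section, not of
    almost every one, so that each inner integral can be moved from the law of Y back to P. *)
Lemma integral_independent2 (f : U * V -> R) : measurable_fun setT f ->
  P.-integrable setT (fun w => (f (X w, Y w))%:E) ->
  (forall x, P.-integrable setT (fun v => (f (x, Y v))%:E)) ->
  \int[P]_w (f (X w, Y w))%:E = \int[P]_w \int[P]_v (f (X w, Y v))%:E.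
Proof.
move=> mf intf intf1; have mE : measurable_fun setT (EFin \o f) by exact/measurable_EFinP.
have iprod : (distribution P X' \x distribution P Y').-integrable setT (EFin \o f).
  apply/integrableP; split => //.
  rewrite (eq_measure_integral (distribution P Z')); last first.
    by move=> A mA _; exact: joint.
  rewrite ge0_integral_distribution//; last exact: measurableT_comp.
  by case/integrableP: intf.
have -> : \int[P]_w (f (X w, Y w))%:E = \int[distribution P Z']_z (EFin \o f) z.
  by rewrite integral_distribution.
rewrite (eq_measure_integral (distribution P X' \x distribution P Y')); last first.
  by move=> A mA _; exact/esym/joint.
rewrite -integral12_prod_meas1//.
have mG : measurable_fun setT (fubini_F (distribution P Y') (EFin \o f)).
  exact: (measurable_fubini_F iprod).
rewrite integral_distribution//; last first.
  apply/integrableP; split; first exact: measurableT_comp.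
  have /integrableP[_] := integrable_fubini_F iprod.
  by rewrite ge0_integral_distribution//; exact: measurableT_comp.
apply: eq_integral => w _ /=; rewrite /fubini_F integral_distribution//; last exact: intf1.
exact: (measurableT_comp mE (measurable_pair1 (X w))).
Qed.

Lemma expectation_product_independent2 (f : U -> R) (g : V -> R) :
  measurable_fun setT f -> measurable_fun setT g ->
  P.-integrable setT (EFin \o (f \o X)) -> P.-integrable setT (EFin \o (g \o Y)) ->
  P.-integrable setT (fun w => (f (X w) * g (Y w))%:E) /\
  Rintegral P setT (fun w => (f (X w) * g (Y w))%R) =
  (Rintegral P setT (f \o X) * Rintegral P setT (g \o Y))%R.
Proof.
move=> mf mg intf intg.
have mfg : measurable_fun setT (fun z : U * V => f z.1 * g z.2)%R.
  by apply: measurable_funM; [exact: measurableT_comp mf measurable_fst|exact: measurableT_comp mg measurable_snd].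
have int1 : P.-integrable setT (fun w => (f (X w) * g (Y w))%:E).
  apply/integrableP; split.
    by apply/measurable_EFinP/measurable_funM; exact: measurableT_comp.
  rewrite (@ge0_integral_independent2 (fun z => `|(f z.1 * g z.2)%:E|))//; last first.
    by apply: measurableT_comp => //; exact/measurable_EFinP.
  under eq_integral.
    move=> w _; under eq_integral do rewrite /= normrM EFinM.
    rewrite ge0_integralZr//; last first.
      by apply/measurable_EFinP/measurableT_comp => //; exact: measurableT_comp.
    over.
  have /integrableP[_ If] := intf; have /integrableP[_ Ig] := intg.
  rewrite ge0_integralZl//; last 2 first.
  - by apply/measurable_EFinP/measurableT_comp => //; exact: measurableT_comp.
  - exact: integral_ge0.
  by apply: lte_mul_pinfty => //; [exact: integral_ge0|rewrite ge0_fin_numE//; exact: integral_ge0].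
split => //.
have H := @integral_independent2 (fun z => f z.1 * g z.2)%R mfg int1.
have intE w : \int[P]_v (f (X w) * g (Y v))%:E =
    (f (X w) * Rintegral P setT (g \o Y))%:E.
  rewrite EFinM /Rintegral fineK ?integrable_fin_num// -integralZl//.
transitivity (fine (\int[P]_w (f (X w) * Rintegral P setT (g \o Y))%:E)).
  rewrite {1}/Rintegral H; last first.
    move=> x; have := integrableZl measurableT (f x) intg.
    by apply: eq_integrable.
  by congr fine; apply: eq_integral => w _; exact: intE.
exact: (RintegralZr (Rintegral P setT (g \o Y)) measurableT intf).
Qed.

End Freezing.

(** * Second moments of sums and U-statistics *)

Lemma measurable_sum_cond d (T : measurableType d) (R : realType) I (s : seq I)
    (A : pred I) (F : I -> T -> R) :
  (forall i, A i -> measurable_fun setT (F i)) ->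
  measurable_fun setT (fun w => \sum_(i <- s | A i) F i w).
Proof.
move=> mF; elim: s => [|i s ih].
  by under eq_fun do rewrite big_nil; exact: measurable_cst.
under eq_fun do rewrite big_cons; have [/mF Ai|//] := boolP (A i).
exact: measurable_funD.
Qed.

Lemma sum_offdiag (R : pzRingType) n (F : 'I_n -> 'I_n -> R) :
  (forall i j, F i j = F j i) ->
  \sum_(i < n) \sum_(j < n | i != j) F i j =
  2 * \sum_(j < n) \sum_(i < n | (i < j)%N) F i j.
Proof.
move=> Fs.
have -> : \sum_(i < n) \sum_(j < n | i != j) F i j =
    \sum_(i < n) (\sum_(j < n | (j < i)%N) F i j + \sum_(j < n | (i < j)%N) F i j).
  apply: eq_bigr => i _; rewrite (bigID (fun j : 'I_n => (j < i)%N))/=; congr (_ + _).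
    apply: eq_bigl => j; rewrite andbC; case: ltnP => //= ji.
    by apply/eqP => e; move: ji; rewrite e ltnn.
  by apply: eq_bigl => j; rewrite -leqNgt ltn_neqAle -(inj_eq val_inj).
rewrite big_split/= mulr2n mulrDl !mul1r; congr (_ + _).
  by apply: eq_bigr => i _; apply: eq_bigr => j _; rewrite Fs.
rewrite (exchange_big_dep predT)//=.
Qed.

Section OrthogonalSums.
Context d (T : measurableType d) (R : realType) (P : probability T R).

Lemma le_Rintegral_ge0 (f g : T -> R) : P.-integrable setT (EFin \o f) ->
  P.-integrable setT (EFin \o g) -> (forall w, f w <= g w) ->
  \int[P]_w f w <= \int[P]_w g w.
Proof. by move=> hf hg fg; apply: le_Rintegral. Qed.

Lemma Rintegral_sqr_sum_orthogonal n (A : pred 'I_n) (v : 'I_n -> T -> R) :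
  (forall i, square_integrable P (v i)) ->
  (forall i j, i != j -> \int[P]_w (v i w * v j w) = 0) ->
  \int[P]_w (\sum_(i | A i) v i w) ^+ 2 = \sum_(i | A i) \int[P]_w (v i w ^+ 2).
Proof.
move=> v2 orth.
have int2 i j : P.-integrable setT (EFin \o (fun w => v i w * v j w)).
  exact: square_integrable_mul.
have int1 i : P.-integrable setT (EFin \o (fun w => \sum_(j <- [seq j <- index_enum 'I_n | A j]) v i w * v j w)).
  by have [] := Rintegral_sum [seq j <- index_enum 'I_n | A j] (int2 i).
transitivity (\int[P]_w (\sum_(i <- [seq i <- index_enum 'I_n | A i]) \sum_(j <- [seq j <- index_enum 'I_n | A j]) v i w * v j w)).
  apply: eq_Rintegral => w _; rewrite big_filter expr2 mulr_suml.
  by apply: eq_bigr => i _; rewrite mulr_sumr big_filter.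
have [_ ->] := Rintegral_sum [seq i <- index_enum 'I_n | A i] int1.
rewrite big_filter; apply: eq_bigr => i Ai.
have [_ ->] := Rintegral_sum [seq j <- index_enum 'I_n | A j] (int2 i).
rewrite big_filter (bigD1 i)//= big1 ?addr0; first by under eq_Rintegral do rewrite -expr2.
by move=> j /andP[_ ji]; apply: orth; rewrite eq_sym.
Qed.

(** Integrate the tangent inequality 2 c f - c^2 <= f^2 at the mean c. *)
Lemma sqr_Rintegral_le (f : T -> R) : square_integrable P f ->
  (\int[P]_w f w) ^+ 2 <= \int[P]_w (f w ^+ 2).
Proof.
move=> f2; set c := \int[P]_w f w.
have i1 : P.-integrable setT (EFin \o (fun w => (2 * c) * f w)).
  by apply: square_integrable_integrable; exact: square_integrableZ.
have i2 : P.-integrable setT (EFin \o (fun w => 2 * c * f w - c ^+ 2)).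
  apply: square_integrable_integrable; apply: square_integrableB; last exact: square_integrable_cst.
  exact: square_integrableZ.
apply: (@le_trans _ _ (\int[P]_w (2 * c * f w - c ^+ 2))).
  rewrite RintegralB//; last exact: (finite_measure_integrable_cst P (c ^+ 2)).
  rewrite RintegralZl//; last exact: square_integrable_integrable.
  by rewrite Rintegral_prob_cst -/c; nra.
by apply: le_Rintegral_ge0 => // [|w]; [exact: f2.2|have := sqr_ge0 (f w - c); nra].
Qed.

Lemma square_integrable_independent_mul d1 (U : measurableType d1) d2
    (V : measurableType d2) (X : T -> U) (Y : T -> V) (f : U -> R) (g : V -> R) :
  measurable_fun setT X -> measurable_fun setT Y -> independent2 P X Y ->
  measurable_fun setT f -> measurable_fun setT g ->
  square_integrable P (f \o X) -> square_integrable P (g \o Y) ->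
  square_integrable P (fun w => f (X w) * g (Y w)).
Proof.
move=> mX mY XY mf mg [mfX f2] [mgY g2]; split; first exact: measurable_funM.
have mf2 : measurable_fun setT (fun u => f u ^+ 2) by exact: measurable_funX.
have mg2 : measurable_fun setT (fun u => g u ^+ 2) by exact: measurable_funX.
have [H _] := expectation_product_independent2 mX mY XY mf2 mg2 f2 g2.
by move: H; apply: eq_integrable => // w _; rewrite exprMn.
Qed.

Section IndependentSample.
Context d1 (U : measurableType d1) (n : nat) (Z : 'I_n -> T -> U) (u0 : U).
Hypothesis mZ : forall k, measurable_fun setT (Z k).
Hypothesis indepZ : forall k, independent2 P (others u0 Z k) (Z k).

Let mO k : measurable_fun setT (others u0 Z k).
Proof. exact: measurable_others. Qed.

Lemma tnth_others k i w : i != k -> tnth (others u0 Z k w) i = Z i w.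
Proof. by move=> /negbTE ik; rewrite tnth_mktuple ik. Qed.

Lemma independent2_pairwise i j : i != j -> independent2 P (Z i) (Z j).
Proof.
move=> ij; have -> : Z i = (@tnth n U ^~ i) \o others u0 Z j.
  by apply/funext => w /=; rewrite tnth_others.
exact: (independent2_comp (measurable_tnth i) (@measurable_id _ _ setT) (indepZ j)).
Qed.

Lemma centered_orthogonal (f : U -> R) i j : measurable_fun setT f ->
  (forall k, square_integrable P (f \o Z k)) -> (forall k, \int[P]_w f (Z k w) = 0) ->
  i != j -> \int[P]_w (f (Z i w) * f (Z j w)) = 0.
Proof.
move=> mf f2 f0 ij.
have f1 k : P.-integrable setT (EFin \o (f \o Z k)) by exact: square_integrable_integrable.
have [_ ->] := expectation_product_independent2 (mZ i) (mZ j) (independent2_pairwise ij) mf mf (f1 i) (f1 j).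
by rewrite [X in X * _](f0 i) mul0r.
Qed.

(** Pairwise independence makes the centered terms orthogonal, and each variance is at most the
    second moment. The predicate [A] lets one bound serve both the full sums and the partial sums
    over i < j of the U-statistic. *)
Lemma sum_centered_sqr (f : U -> R) (mu B : R) (A : pred 'I_n) : measurable_fun setT f ->
  (forall k, square_integrable P (f \o Z k)) ->
  (forall k, \int[P]_w f (Z k w) = mu) ->
  (forall k, \int[P]_w (f (Z k w) ^+ 2) <= B) ->
  square_integrable P (fun w => \sum_(k | A k) (f (Z k w) - mu)) /\
  \int[P]_w (\sum_(k | A k) (f (Z k w) - mu)) ^+ 2 <= n%:R * B.
Proof.
move=> mf f2 fmu fB.
have g2 k : square_integrable P ((fun u => f u - mu) \o Z k).
  by apply: square_integrableB; [exact: f2|exact: square_integrable_cst].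
have mg : measurable_fun setT (fun u => f u - mu).
  by apply: measurable_funB => //; exact: measurable_cst.
have g0 k : \int[P]_w (f (Z k w) - mu) = 0.
  rewrite RintegralB//; last exact: (finite_measure_integrable_cst P mu).
    by rewrite fmu Rintegral_prob_cst subrr.
  exact: square_integrable_integrable (f2 k).
have B0 (k : 'I_n) : 0 <= B by apply: le_trans (fB k); apply: Rintegral_ge0 => w _; exact: sqr_ge0.
split; first by apply: square_integrable_sum => k; exact: g2.
rewrite (@Rintegral_sqr_sum_orthogonal _ A (fun k w => f (Z k w) - mu)) => [|//|i j ij].
  apply: (@le_trans _ _ (\sum_(k | A k) B)).
    apply: ler_sum => k _; apply: le_trans (fB k).
    by apply: (@le_Rintegral_sqr_sub _ _ _ P (f \o Z k) mu) => //; rewrite fmu.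
  apply: (@le_trans _ _ (\sum_(k < n) B)).
    rewrite [leRHS](bigID A)/= lerDl sumr_ge0// => k _; exact: B0.
  by rewrite sumr_const card_ord -[leLHS]mulr_natl.
exact: (centered_orthogonal mg g2 g0 ij).
Qed.

(* Hoeffding's decomposition, with h centered as u = h - m: up to its mean, the
   off-diagonal sum is 2 (n - 1) times a sum of independent centered variables
   plus twice the sum over j of <u (Z j), sum_(i < j) u (Z i)>, whose terms are
   pairwise orthogonal. *)
Section UStatistic.
Context (p : nat) (h : 'I_p -> U -> R) (m : 'I_p -> R) (C : R).
Hypothesis mh : forall a, measurable_fun setT (h a).
Hypothesis h2 : forall a k, square_integrable P (h a \o Z k).
Hypothesis hm : forall a k, \int[P]_w h a (Z k w) = m a.
Hypothesis C0 : 0 <= C.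
(** The second-moment matrix of h is at most C times the identity. An operator bound, rather than a
    trace, keeps the dimension out of the linear term. *)
Hypothesis hC : forall k (c : 'I_p -> R),
  \int[P]_w (\sum_a c a * h a (Z k w)) ^+ 2 <= C * \sum_a c a ^+ 2.

Let u a z := h a z - m a.

Let mu_ a : measurable_fun setT (u a).
Proof. by apply: measurable_funB => //; exact: measurable_cst. Qed.

Let u2 a k : square_integrable P (u a \o Z k).
Proof. by apply: square_integrableB; [exact: h2|exact: square_integrable_cst]. Qed.

Let uE a k : \int[P]_w u a (Z k w) = 0.
Proof.
rewrite /u RintegralB//; last exact: (finite_measure_integrable_cst P (m a)).
  by rewrite hm Rintegral_prob_cst subrr.
exact: square_integrable_integrable (h2 a k).
Qed.

Let lin_sqint k (c : 'I_p -> R) : square_integrable P (fun w => \sum_a c a * h a (Z k w)).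
Proof. by apply: square_integrable_sum => a; apply: square_integrableZ; exact: h2. Qed.

Let lin_mean k (c : 'I_p -> R) : \int[P]_w (\sum_a c a * h a (Z k w)) = \sum_a c a * m a.
Proof.
have i1 a : P.-integrable setT (EFin \o (fun w => c a * h a (Z k w))).
  by apply: square_integrable_integrable; apply: square_integrableZ; exact: h2.
have [_ ->] := Rintegral_sum (index_enum 'I_p) i1.
by apply: eq_bigr => a _; rewrite RintegralZl ?hm//; exact: square_integrable_integrable (h2 a k).
Qed.

Let uC k (c : 'I_p -> R) :
  \int[P]_w (\sum_a c a * u a (Z k w)) ^+ 2 <= C * \sum_a c a ^+ 2.
Proof.
apply: le_trans (hC k c).
have -> : (fun w => (\sum_a c a * u a (Z k w)) ^+ 2) =
    (fun w => (\sum_a c a * h a (Z k w) - \sum_a c a * m a) ^+ 2).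
  apply/funext => w; congr (_ ^+ 2); rewrite -sumrB.
  by apply: eq_bigr => a _; rewrite /u mulrBr.
apply: (@le_Rintegral_sqr_sub _ _ _ P (fun w => \sum_a c a * h a (Z k w))) => //.
Qed.

(** Apply [hC] in the direction m itself: |m|^4 = (E <m, h>)^2 <= C |m|^2. *)
Lemma ustat_mean_sqr_le (k : 'I_n) : \sum_a m a ^+ 2 <= C.
Proof.
have M0 : 0 <= \sum_a m a ^+ 2 by apply: sumr_ge0 => a _; exact: sqr_ge0.
move: M0; rewrite le_eqVlt => /predU1P[<-//|M0].
have := le_trans (sqr_Rintegral_le (lin_sqint k m)) (hC k m).
rewrite lin_mean (eq_bigr (fun a => m a ^+ 2)); last by move=> a _; rewrite expr2.
by rewrite expr2 ler_pM2r.
Qed.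

(** A function on tuples rather than on T: evaluated at [others], it reads only slots below j, never
    the dummy slot j, and is therefore independent of Z j. *)
Let W (j : 'I_n) a (o : n.-tuple U) := \sum_(i < n | (i < j)%N) u a (tnth o i).

Let mW j a : measurable_fun setT (W j a).
Proof.
apply: measurable_sum_cond => i _.
exact: (measurableT_comp (mu_ a) (measurable_tnth i)).
Qed.

Let WE j a w : W j a (others u0 Z j w) = \sum_(i < n | (i < j)%N) u a (Z i w).
Proof.
by apply: eq_bigr => i ij; rewrite tnth_others// neq_ltn ij.
Qed.

Let hB a k : \int[P]_w (h a (Z k w) ^+ 2) <= C.
Proof.
have := hC k (fun b => (b == a)%:R).
rewrite [X in _ * X](bigD1 a)//= eqxx expr1n big1 ?addr0 ?mulr1; last first.
  by move=> b /negbTE ->; rewrite expr0n.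
apply: le_trans; rewrite le_eqVlt; apply/orP; left; apply/eqP; apply: eq_Rintegral => w _.
congr (_ ^+ 2); rewrite (bigD1 a)//= eqxx mul1r big1 ?addr0// => b /negbTE ->.
by rewrite mul0r.
Qed.

Let W2 j a : square_integrable P (W j a \o others u0 Z j) /\
  \int[P]_w (W j a (others u0 Z j w) ^+ 2) <= n%:R * C.
Proof.
have [H1 H2] := sum_centered_sqr (fun i : 'I_n => (i < j)%N) (mh a) (h2 a) (hm a) (hB a).
split; first by rewrite [X in square_integrable _ X](funext (WE j a)).
by under eq_Rintegral do rewrite WE.
Qed.

Let D j w := \sum_a u a (Z j w) * W j a (others u0 Z j w).

Let uW2 j a : square_integrable P (fun w => u a (Z j w) * W j a (others u0 Z j w)).
Proof.
have := square_integrable_independent_mul (mO j) (mZ j) (indepZ j) (mW j a) (mu_ a) (W2 j a).1 (u2 a j).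
by under eq_fun do rewrite mulrC.
Qed.

Let D2 j : square_integrable P (D j).
Proof. exact: square_integrable_sum. Qed.

(** For i < j every factor except u a (Z j) is a function of the other components, and that last
    factor is centered and independent of them. *)
Let DD (i j : 'I_n) : (i < j)%N -> \int[P]_w (D i w * D j w) = 0.
Proof.
move=> ij.
have ne : i != j by rewrite neq_ltn ij.
pose Dt (o : n.-tuple U) := \sum_a u a (tnth o i) * \sum_(l < n | (l < i)%N) u a (tnth o l).
have mDt : measurable_fun setT Dt.
  apply: measurable_sum => a; apply: measurable_funM.
    exact: (measurableT_comp (mu_ a) (measurable_tnth i)).
  by apply: measurable_sum_cond => l _; exact: (measurableT_comp (mu_ a) (measurable_tnth l)).
have DtE w : Dt (others u0 Z j w) = D i w.
  apply: eq_bigr => a _; rewrite tnth_others// WE; congr (_ * _).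
  by apply: eq_bigr => l li; rewrite tnth_others// neq_ltn (ltn_trans li ij).
have Dt2 : square_integrable P (Dt \o others u0 Z j).
  by rewrite [X in square_integrable _ X](funext DtE).
have H a : P.-integrable setT (EFin \o (fun w => (Dt (others u0 Z j w) * W j a (others u0 Z j w)) * u a (Z j w))) /\
    \int[P]_w ((Dt (others u0 Z j w) * W j a (others u0 Z j w)) * u a (Z j w)) = 0.
  have mg : measurable_fun setT (fun o => Dt o * W j a o) by exact: measurable_funM.
  have ig : P.-integrable setT (EFin \o ((fun o => Dt o * W j a o) \o others u0 Z j)).
    exact: (square_integrable_mul Dt2 (W2 j a).1).
  have iu : P.-integrable setT (EFin \o (u a \o Z j)) by exact: square_integrable_integrable (u2 a j).
  have [H1 H2] := expectation_product_independent2 (mO j) (mZ j) (indepZ j) mg (mu_ a) ig iu.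
  by split => //; rewrite H2 [X in _ * X](uE a j) mulr0.
have [_ E] := Rintegral_sum (index_enum 'I_p) (fun a => (H a).1).
transitivity (\int[P]_w \sum_a (Dt (others u0 Z j w) * W j a (others u0 Z j w)) * u a (Z j w)).
  apply: eq_Rintegral => w _; rewrite -DtE mulr_sumr; apply: eq_bigr => a _.
  by rewrite mulrCA mulrA mulrC mulrA mulrC mulrA.
by rewrite E big1// => a _; exact: (H a).2.
Qed.

(** With the other components frozen, D j is a linear form in u (Z j), whose second moment is at
    most C |W|^2. Averaging |W|^2 over its p coordinates costs p n C. *)
Let D2C j : \int[P]_w (D j w ^+ 2) <= n%:R * p%:R * C ^+ 2.
Proof.
pose f (z : U * n.-tuple U) := (\sum_a W j a z.2 * u a z.1) ^+ 2.
have mf : measurable_fun setT f.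
  apply: measurable_funX; apply: measurable_sum => a; apply: measurable_funM.
    exact: (measurableT_comp (mW j a) measurable_snd).
  exact: (measurableT_comp (mu_ a) measurable_fst).
have DE w : D j w ^+ 2 = f (Z j w, others u0 Z j w).
  by congr (_ ^+ 2); apply: eq_bigr => a _; rewrite mulrC.
pose g w := C * \sum_a W j a (others u0 Z j w) ^+ 2.
have iW a : P.-integrable setT (EFin \o (fun w => W j a (others u0 Z j w) ^+ 2)).
  exact: (W2 j a).1.2.
have [iS SE] := Rintegral_sum (index_enum 'I_p) iW.
have ig : P.-integrable setT (EFin \o g).
  by have := integrableZl measurableT C iS; apply: eq_integrable.
have gE : \int[P]_w g w <= n%:R * p%:R * C ^+ 2.
  rewrite RintegralZl// SE.
  rewrite (_ : n%:R * p%:R * C ^+ 2 = C * (p%:R * (n%:R * C))); last by ring.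
  rewrite ler_wpM2l//; apply: (@le_trans _ _ (\sum_(a < p) n%:R * C)).
    by apply: ler_sum => a _; exact: (W2 j a).2.
  by rewrite sumr_const card_ord -[leLHS]mulr_natl.
apply: le_trans gE; rewrite -lee_fin /Rintegral !fineK ?integrable_fin_num//; last first.
  exact: (D2 j).2.
have -> : (\int[P]_w (D j w ^+ 2)%:E = \int[P]_w (EFin \o f) (Z j w, others u0 Z j w))%E.
  by apply: eq_integral => w _; rewrite /= -DE.
have mEf : measurable_fun setT (EFin \o f) by exact/measurable_EFinP.
have f0 z : (0 <= (EFin \o f) z)%E by rewrite /= lee_fin sqr_ge0.
rewrite (ge0_integral_independent2 (mZ j) (mO j) (independent2_sym (@indepZ j)) mEf f0).
apply: ge0_le_integral => //.
- by move=> w _; exact: integral_ge0.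
- have mG : measurable_fun setT (fun o => \int[P]_v (EFin \o f) (Z j v, o))%E.
    apply: (measurable_fun_fubini_tonelli_G (m1 := P) (fun z => (EFin \o f) (Z j z.1, z.2))) => //.
    apply: measurableT_comp mEf _; apply: measurable_fun_pair; last exact: measurable_snd.
    exact: measurableT_comp (mZ j) measurable_fst.
  exact: (measurableT_comp mG (mO j)).
- exact: measurable_int ig.
- move=> w _.
  have lu (c : 'I_p -> R) : square_integrable P (fun v => \sum_a c a * u a (Z j v)).
    by apply: square_integrable_sum => a; apply: square_integrableZ; exact: u2.
  have := uC j (fun a => W j a (others u0 Z j w)).
  by rewrite -lee_fin /Rintegral fineK// integrable_fin_num//; exact: (lu _).2.
Qed.

Lemma ustat_offdiag_sqr :
  square_integrable P (fun w => \sum_(i < n) \sum_(j < n | i != j)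
    \sum_a h a (Z i w) * h a (Z j w) - n%:R * (n%:R - 1) * \sum_a m a ^+ 2) /\
  \int[P]_w (\sum_(i < n) \sum_(j < n | i != j) \sum_a h a (Z i w) * h a (Z j w) -
    n%:R * (n%:R - 1) * \sum_a m a ^+ 2) ^+ 2 <=
  8 * (n%:R - 1) ^+ 2 * n%:R * C * \sum_a m a ^+ 2 + 8 * n%:R ^+ 2 * p%:R * C ^+ 2.
Proof.
set M := \sum_a m a ^+ 2.
pose l z := \sum_a m a * h a z.
pose L w := \sum_(k < n) (l (Z k w) - M).
pose S w := \sum_(j < n) D j w.
have ml : measurable_fun setT l.
  by apply: measurable_sum => a; apply: measurable_funM => //; exact: measurable_cst.
have ME : M = \sum_a m a * m a by apply: eq_bigr => a _; rewrite expr2.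
have [L2 LB] := sum_centered_sqr xpredT ml (fun k => lin_sqint k m)
  (fun k => etrans (lin_mean k m) (esym ME)) (fun k => hC k m).
have S2 : square_integrable P S by exact: square_integrable_sum.
have SB : \int[P]_w (S w ^+ 2) <= n%:R * (n%:R * p%:R * C ^+ 2).
  rewrite (@Rintegral_sqr_sum_orthogonal n xpredT D) => [|//|i j].
    apply: (@le_trans _ _ (\sum_(j < n) (n%:R * p%:R * C ^+ 2))).
      by apply: ler_sum => j _; exact: D2C.
    by rewrite sumr_const card_ord -[leLHS]mulr_natl.
  rewrite neq_ltn => /orP[|/DD]; first exact: DD.
  by under eq_Rintegral do rewrite mulrC.
have E w : \sum_(i < n) \sum_(j < n | i != j) \sum_a h a (Z i w) * h a (Z j w) -
    n%:R * (n%:R - 1) * M = 2 * (n%:R - 1) * L w + 2 * S w.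
  have cnt (c : R) (i : 'I_n) : \sum_(j < n | i != j) c = (n%:R - 1) * c.
    have e1 : \sum_(j < n) c = n%:R * c by rewrite sumr_const card_ord; rewrite mulr_natl.
    have e2 : \sum_(j < n) c = c + \sum_(j < n | i != j) c.
      by rewrite (bigD1 i)//=; congr (_ + _); apply: eq_bigl => j; rewrite eq_sym.
    by rewrite mulrBl mul1r -e1 e2 addrC addKr.
  pose la i := \sum_a m a * u a (Z i w).
  pose G i j := \sum_a u a (Z i w) * u a (Z j w).
  have laE i : la i = l (Z i w) - M.
    by rewrite /la /l ME -sumrB; apply: eq_bigr => a _; rewrite /u mulrBr.
  have F i j : \sum_a h a (Z i w) * h a (Z j w) = (M + la i) + (la j + G i j).
    rewrite /M /la /G -!big_split/=; apply: eq_bigr => a _; rewrite /u; ring.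
  have -> : \sum_(i < n) \sum_(j < n | i != j) \sum_a h a (Z i w) * h a (Z j w) =
      \sum_(i < n) (n%:R - 1) * (M + la i) +
      (\sum_(i < n) \sum_(j < n | i != j) la j + \sum_(i < n) \sum_(j < n | i != j) G i j).
    rewrite -!big_split/=; apply: eq_bigr => i _.
    by rewrite (eq_bigr _ (fun j _ => F i j)) big_split/= cnt big_split/=.
  have -> : \sum_(i < n) \sum_(j < n | i != j) la j = (n%:R - 1) * \sum_(j < n) la j.
    rewrite (exchange_big_dep predT)//= mulr_sumr; apply: eq_bigr => j _.
    by rewrite -(cnt (la j) j); apply: eq_bigl => i; rewrite eq_sym.
  rewrite sum_offdiag; last by move=> i j; apply: eq_bigr => a _; rewrite mulrC.
  have -> : \sum_(j < n) \sum_(i < n | (i < j)%N) G i j = S w.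
    apply: eq_bigr => j _; rewrite /G exchange_big/=; apply: eq_bigr => a _.
    by rewrite WE mulr_sumr; apply: eq_bigr => i _; rewrite mulrC.
  have -> : L w = \sum_(j < n) la j by apply: eq_bigr => j _; rewrite laE.
  rewrite -mulr_sumr big_split/= sumr_const card_ord -mulr_natl.
  ring.
have H2 : square_integrable P (fun w => 2 * (n%:R - 1) * L w + 2 * S w).
  by apply: square_integrableD; apply: square_integrableZ.
have EE : (fun w => \sum_(i < n) \sum_(j < n | i != j) \sum_a h a (Z i w) * h a (Z j w) -
    n%:R * (n%:R - 1) * M) = (fun w => 2 * (n%:R - 1) * L w + 2 * S w) by exact/funext.
split; first by rewrite EE.
have -> : \int[P]_w (\sum_(i < n) \sum_(j < n | i != j) \sum_a h a (Z i w) * h a (Z j w) -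
    n%:R * (n%:R - 1) * M) ^+ 2 = \int[P]_w (2 * (n%:R - 1) * L w + 2 * S w) ^+ 2.
  by apply: eq_Rintegral => w _; rewrite E.
have iL : P.-integrable setT (EFin \o (fun w => 8 * (n%:R - 1) ^+ 2 * L w ^+ 2)).
  have := integrableZl measurableT (8 * (n%:R - 1) ^+ 2) L2.2.
  by apply: eq_integrable.
have iS : P.-integrable setT (EFin \o (fun w => 8 * S w ^+ 2)).
  by have := integrableZl measurableT 8 S2.2; apply: eq_integrable.
apply: (@le_trans _ _ (\int[P]_w (8 * (n%:R - 1) ^+ 2 * L w ^+ 2 + 8 * S w ^+ 2))).
  apply: le_Rintegral_ge0; [exact: H2.2|exact: integrableDR|move=> w].
  (* The 8 is 2 times 2^2, from (a + b)^2 <= 2 a^2 + 2 b^2. *)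
  have := sqr_ge0 (2 * (n%:R - 1) * L w - 2 * S w); nra.
have L2' : P.-integrable setT (EFin \o (fun w => L w ^+ 2)) by exact: L2.2.
have S2' : P.-integrable setT (EFin \o (fun w => S w ^+ 2)) by exact: S2.2.
rewrite RintegralD// (RintegralZl _ measurableT L2') (RintegralZl _ measurableT S2').
apply: lerD.
  have -> : 8 * (n%:R - 1) ^+ 2 * n%:R * C * M = 8 * (n%:R - 1) ^+ 2 * (n%:R * (C * M)) by ring.
  by rewrite ler_wpM2l// mulr_ge0// sqr_ge0.
have -> : 8 * n%:R ^+ 2 * p%:R * C ^+ 2 = 8 * (n%:R * (n%:R * p%:R * C ^+ 2)) by ring.
by rewrite ler_wpM2l.
Qed.

End UStatistic.
End IndependentSample.
End OrthogonalSums.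

(** * Isotropic Gaussian vectors *)

Section GaussianVector.
Context d (T : measurableType d) (R : realType) (P : probability T R).
Context (p : nat) (s : R) (x : T -> p.-tuple R).
Hypothesis s0 : 0 < s.
Hypothesis mx : measurable_fun setT x.
Hypothesis gx : isotropic_gaussian P s x.
Notation N := (@normal_prob R 0 1).
Implicit Types (b : 'I_p -> R) (f : R -> R).

Let xi (j : 'I_p) (w : T) : R := tnth (x w) j.

Lemma measurable_coord j : measurable_fun setT (xi j).
Proof. exact: (measurableT_comp (measurable_tnth j) mx). Qed.

Lemma gaussian_coord_law j (A : set R) : measurable A ->
  P (xi j @^-1` A) = normal_prob 0 s A.
Proof.
move=> mA; pose B (i : 'I_p) : set R := if i == j then A else setT.
have mB i : measurable (B i) by rewrite /B; case: ifP.
have := gx mB; rewrite (bigD1 j)//= big1 ?mule1; last first.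
  by move=> i /negbTE ij; rewrite /B ij probability_setT.
rewrite /B eqxx => <-; congr (P _); apply/seteqP; split => w /=.
  by move=> h i; case: eqP => // ->.
by move=> /(_ j); rewrite eqxx.
Qed.

Lemma gaussian_coord_independent : mutually_independent P xi.
Proof.
move=> A mA; rewrite [X in P X](_ : _ = [set w | forall j, A j (tnth (x w) j)]).
  by rewrite gx//; apply: eq_bigr => j _; rewrite gaussian_coord_law.
by apply/seteqP; split => w /= h j; [exact: h|move=> _; exact: h].
Qed.

Lemma gaussian_coord_others j : independent2 P (others (0 : R) xi j) (xi j).
Proof.
exact: (mutually_independent_others (0 : R) j measurable_coord gaussian_coord_independent).
Qed.

Let mO j : measurable_fun setT (others (0 : R) xi j).
Proof. exact: measurable_others measurable_coord. Qed.

Lemma ge0_integral_gaussian_coord j f : continuous f -> (forall t, 0 <= f t) ->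
  (\int[P]_w (f (xi j w))%:E = \int[N]_z (f (s * z))%:E)%E.
Proof.
move=> cf f0; have mf : measurable_fun setT f by exact: continuous_measurable_fun.
have mxi : measurable_fun setT (xi j : T -> measurableTypeR R) by exact: measurable_coord.
pose X : {RV P >-> measurableTypeR R} := @mfun_Sub _ _ T (measurableTypeR R) _ (mem_set mxi).
have -> : (\int[P]_w (f (xi j w))%:E = \int[distribution P X]_t (f t)%:E)%E.
  by rewrite ge0_integral_distribution//; apply/measurable_EFinP.
transitivity (\int[normal_prob 0 s]_t (f t)%:E)%E.
  by apply: eq_measure_integral => A mA _; exact: gaussian_coord_law.
rewrite (integral_normal_prob_scale 0 s0 cf f0).
by apply: eq_integral => z _; rewrite add0r.
Qed.

Lemma integral_gaussian_coord j f : continuous f ->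
  (\int[P]_w (f (xi j w))%:E = \int[N]_z (f (s * z))%:E)%E.
Proof.
move=> cf; rewrite integralE [RHS]integralE.
have cpos : continuous (fun t => Num.max (f t) 0 : R).
  by move=> t; apply: (@continuous_max R R f (cst 0)); [exact: cf|exact: cst_continuous].
have cneg : continuous (fun t => Num.max (- f t) 0 : R).
  move=> t; apply: (@continuous_max R R (fun t => - f t) (cst 0)); last exact: cst_continuous.
  by apply: cvgN; exact: cf.
have Hp (S : Type) (g : S -> R) v : (((fun w => (f (g w))%:E)^\+) v = (Num.max (f (g v)) 0)%:E)%E.
  by rewrite funeposE EFin_max.
have Hn (S : Type) (g : S -> R) v : (((fun w => (f (g w))%:E)^\-) v = (Num.max (- f (g v)) 0)%:E)%E.
  by rewrite funenegE -EFinN EFin_max.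
congr (_ - _)%E.
  under eq_integral do rewrite Hp.
  under [RHS]eq_integral do rewrite Hp.
  by apply: (ge0_integral_gaussian_coord j cpos) => t; rewrite le_max lexx orbT.
under eq_integral do rewrite Hn.
under [RHS]eq_integral do rewrite Hn.
by apply: (ge0_integral_gaussian_coord j cneg) => t; rewrite le_max lexx orbT.
Qed.

Let lin b k (w : T) : R := \sum_(j < p | (j < k)%N) b j * xi j w.
Let nrm b k : R := Num.sqrt (\sum_(j < p | (j < k)%N) b j ^+ 2).

Let mlin b k : measurable_fun setT (lin b k).
Proof. by apply: measurable_sum_cond => j _; apply: measurable_funM => //; exact: measurable_coord. Qed.

Let lin_succ b (k : 'I_p) (F : 'I_p -> R) :
  \sum_(j < p | (j < k.+1)%N) F j = \sum_(j < p | (j < k)%N) F j + F k.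
Proof.
rewrite (bigD1 k)//= addrC; congr (_ + _); apply: eq_bigl => j.
by rewrite ltnS ltn_neqAle andbC.
Qed.

(** Coordinates are added one at a time. Freezing the new coordinate shifts the test function, so
    the induction runs over all f; the old sum becomes a one-dimensional Gaussian, and
    [normal_rotation] merges it with the new coordinate. *)
Let integral_lin b k f : (k <= p)%N -> continuous f -> (forall t, 0 <= f t) ->
  (\int[P]_w (f (lin b k w))%:E = \int[N]_z (f (s * nrm b k * z))%:E)%E.
Proof.
elim: k f => [|k ih] f kp cf f0.
  rewrite /nrm; under eq_integral do rewrite /lin big1//.
  under [RHS]eq_integral do rewrite big1// sqrtr0 mulr0 mul0r.
  by rewrite !integral_cst//= !probability_setT.
have mf : measurable_fun setT f by exact: continuous_measurable_fun.
pose K := Ordinal kp.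
pose O := others (0 : R) xi K.
pose L (o : p.-tuple R) := \sum_(j < p | (j < k)%N) b j * tnth o j.
have mL : measurable_fun setT L.
  by apply: measurable_sum_cond => j _; apply: measurable_funM => //; exact: measurable_tnth.
have LE w : L (O w) = lin b k w.
  by apply: eq_bigr => j jk; rewrite tnth_others// neq_ltn jk.
have sE w : lin b k.+1 w = L (O w) + b K * xi K w by rewrite LE /lin (lin_succ b K).
pose F (z : p.-tuple R * R) := (f (L z.1 + b K * z.2))%:E.
have mF : measurable_fun setT F.
  apply/measurable_EFinP; apply: measurableT_comp mf _; apply: measurable_funD.
    exact: measurableT_comp mL measurable_fst.
  by apply: measurable_funM => //; exact: measurable_snd.
have -> : (\int[P]_w (f (lin b k.+1 w))%:E = \int[P]_w F (O w, xi K w))%E.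
  by apply: eq_integral => w _; rewrite /F -sE.
rewrite (ge0_integral_independent2 (mO K) (measurable_coord K) (gaussian_coord_others K) mF); last first.
  by move=> z; rewrite /F lee_fin.
pose a := s * nrm b k; pose c := s * b K.
transitivity (\int[P]_w \int[N]_z (f (a * z + b K * xi K w))%:E)%E.
  apply: eq_integral => w _.
  rewrite -(ih (fun t => f (t + b K * xi K w)) (ltnW kp))//.
    by apply: eq_integral => v _; rewrite /F /= LE.
  move=> t; apply: (@continuous_comp _ _ _ (fun t => t + b K * xi K w) f); last exact: cf.
  by apply: cvgD; [exact: cvg_id|exact: cvg_cst].
rewrite (@fubini_tonelli _ _ T (measurableTypeR R) R P N (fun wz => (f (a * wz.2 + b K * xi K wz.1))%:E)); last 2 first.
- apply/measurable_EFinP; apply: measurableT_comp mf _; apply: measurable_funD.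
    by apply: measurable_funM => //; exact: measurable_snd.
  apply: measurable_funM => //; exact: measurableT_comp (measurable_coord K) measurable_fst.
- by move=> z; rewrite lee_fin.
transitivity (\int[N]_z \int[N]_y (f (a * z + c * y))%:E)%E.
  apply: eq_integral => z _ /=.
  rewrite (ge0_integral_gaussian_coord K (f := fun t => f (a * z + b K * t)))//.
    by apply: eq_integral => y _; congr ((f (_ + _))%:E); rewrite /c; ring.
  by move=> t; apply: continuous_comp; [exact: continuous_affine|exact: cf].
rewrite normal_rotation//; apply: eq_integral => z _; congr ((f (_ * _))%:E).
rewrite /a /c /nrm (lin_succ b K (fun j => b j ^+ 2)).
rewrite !exprMn sqr_sqrtr ?sumr_ge0//; last by move=> j _; exact: sqr_ge0.
rewrite -mulrDr sqrtrM ?sqr_ge0// sqrtr_sqr ger0_norm// ltW//.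
Qed.

Definition gauss_norm b : R := s * Num.sqrt (\sum_j b j ^+ 2).

Lemma ge0_integral_gaussian_lin b f : continuous f -> (forall t, 0 <= f t) ->
  (\int[P]_w (f (\sum_j b j * tnth (x w) j))%:E = \int[N]_z (f (gauss_norm b * z))%:E)%E.
Proof.
move=> cf f0; have := integral_lin b (leqnn p) cf f0.
have e (F : 'I_p -> R) : \sum_(j < p | (j < p)%N) F j = \sum_j F j.
  by apply: eq_bigl => j; rewrite ltn_ord.
under eq_integral do rewrite /lin e.
by rewrite /nrm e.
Qed.

Lemma measurable_gaussian_lin b : measurable_fun setT (fun w => \sum_j b j * tnth (x w) j).
Proof. by apply: measurable_sum => j; apply: measurable_funM => //; exact: measurable_coord. Qed.

(** Stein's identity for f = id; the constant function 1 gives the mean below. *)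
Lemma normal_m2E : @normal_m2 R = 1.
Proof.
have h (t : R) : is_derive t 1 id (1 : R) by exact: is_derive_id.
have := @normal_stein R id (fun=> 1) 1 h.
rewrite Rintegral_prob_cst => <-.
- by apply: eq_Rintegral => z _; rewrite expr2.
- by move=> z; exact: cst_continuous.
- by move=> z; rewrite mul1r lerDr.
- by move=> z; rewrite normr1.
Qed.

Lemma normal_mean0 : \int[N]_z (z : R) = 0.
Proof.
have h (t : R) : is_derive t 1 (fun=> 1 : R) (0 : R) by exact: is_derive_cst.
have H : \int[N]_z (z * 1) = \int[N]_z (0 : R).
  apply: (@normal_stein R (fun=> 1) (fun=> 0) 1 h).
  - by move=> z; exact: cst_continuous.
  - by move=> z; rewrite mul1r normr1 lerDl.
  - by move=> z; rewrite normr0.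
rewrite Rintegral_prob_cst in H; rewrite -[RHS]H.
by congr (Rintegral _ _ _); apply/funext => z; rewrite mulr1.
Qed.

Lemma gaussian_coord_mean j : \int[P]_w xi j w = 0.
Proof.
have cid : continuous (@id R) by move=> t; exact: cvg_id.
have := integral_gaussian_coord j cid.
rewrite {1}/Rintegral => -> /=.
have i1 := square_integrable_integrable (@square_integrable_normal_id R).
have -> : (\int[N]_z (s * z)%:E = s%:E * \int[N]_z z%:E)%E.
  by rewrite -integralZl//; apply: eq_integral => z _; rewrite EFinM.
by rewrite fineM ?integrable_fin_num//= [X in _ * X]normal_mean0 mulr0.
Qed.

Lemma gaussian_lin_sqr b :
  square_integrable P (fun w => \sum_j b j * tnth (x w) j) /\
  \int[P]_w ((\sum_j b j * tnth (x w) j) ^+ 2) = s ^+ 2 * \sum_j b j ^+ 2.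
Proof.
have csq : continuous (fun t : R => t ^+ 2) by exact: sqr_continuous.
have sq0 (t : R) : 0 <= t ^+ 2 by exact: sqr_ge0.
have H := ge0_integral_gaussian_lin b csq sq0.
have E : (\int[P]_w ((\sum_j b j * tnth (x w) j) ^+ 2)%:E = (s ^+ 2 * \sum_j b j ^+ 2)%:E)%E.
  rewrite H; have i2 := (@square_integrable_normal_id R).2.
  transitivity (\int[N]_z ((gauss_norm b ^+ 2)%:E * (z ^+ 2)%:E))%E.
    by apply: eq_integral => z _; rewrite exprMn EFinM.
  rewrite integralZl// -[X in (_ * X)%E]fineK ?integrable_fin_num//.
  rewrite -EFinM -/(Rintegral _ _ _) -/(@normal_m2 R) normal_m2E mulr1.
  by rewrite /gauss_norm exprMn sqr_sqrtr// sumr_ge0// => j _; exact: sqr_ge0.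
split; last by rewrite /Rintegral E.
split; first exact: measurable_gaussian_lin.
apply/integrableP; split.
  by apply/measurable_EFinP/measurable_funX; exact: measurable_gaussian_lin.
rewrite (_ : \int[P]_w _ = \int[P]_w ((\sum_j b j * tnth (x w) j) ^+ 2)%:E)%E.
  by rewrite E ltry.
by apply: eq_integral => w _; rewrite gee0_abs// lee_fin sqr_ge0.
Qed.

Lemma gaussian_coord_sqr j : square_integrable P (xi j) /\ \int[P]_w (xi j w ^+ 2) = s ^+ 2.
Proof.
have [H1 H2] := gaussian_lin_sqr (fun i => (i == j)%:R).
have e w : \sum_i (i == j)%:R * tnth (x w) i = xi j w.
  rewrite (bigD1 j)//= eqxx mul1r big1 ?addr0// => i /negbTE ->.
  by rewrite mul0r.
split; first by move: H1; under eq_fun do rewrite e.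
transitivity (\int[P]_w (\sum_i (i == j)%:R * tnth (x w) i) ^+ 2).
  by apply: eq_Rintegral => w _; rewrite e.
rewrite H2 (bigD1 j)//= eqxx expr1n big1 ?addr0 ?mulr1// => i /negbTE ->.
by rewrite expr0n.
Qed.

Let continuous_shiftc (g : R -> R) (th : R) : continuous g -> continuous (fun t : R => g (th + t) : R).
Proof.
move=> cg t; apply: (@continuous_comp _ _ _ (fun t => th + t) g); last exact: cg.
by apply: cvgD; [exact: cvg_cst|exact: cvg_id].
Qed.

Lemma gaussian_drho_mean th b :
  \int[P]_w drho (th + \sum_j b j * tnth (x w) j) = mom_pi th (gauss_norm b).
Proof.
rewrite /mom_pi /Rintegral; congr fine.
have drho0 (t : R) : 0 <= drho (th + t) by exact/ltW/drho_gt0.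
exact: (ge0_integral_gaussian_lin b (@continuous_shiftc _ th (@continuous_drho R)) drho0).
Qed.

Lemma gaussian_ddrho_mean th b :
  \int[P]_w ddrho (th + \sum_j b j * tnth (x w) j) = mom_c th (gauss_norm b).
Proof.
rewrite /mom_c /Rintegral; congr fine.
have ddrho0 (t : R) : 0 <= ddrho (th + t) by exact/ltW/ddrho_gt0.
exact: (ge0_integral_gaussian_lin b (@continuous_shiftc _ th (@continuous_ddrho R)) ddrho0).
Qed.

(** This is [mom_zetaE] at slope c s, once the coordinate is written as s Z. *)
Let coord_stein j r c :
  (\int[P]_w (xi j w * drho (r + c * xi j w))%:E =
   (s ^+ 2 * c)%:E * \int[P]_w (ddrho (r + c * xi j w))%:E)%E.
Proof.
have cd (g : R -> R) : continuous g -> continuous (fun t => g (r + c * t)).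
  by move=> cg t; apply: continuous_comp; [exact: continuous_affine|exact: cg].
rewrite (integral_gaussian_coord j (f := fun t => t * drho (r + c * t))); last first.
  by move=> t; apply: cvgM; [exact: cvg_id|exact: cd (@continuous_drho R) t].
rewrite (integral_gaussian_coord j (f := fun t => ddrho (r + c * t))); last first.
  exact: cd (@continuous_ddrho R).
have E1 : (\int[N]_z (s * z * drho (r + c * (s * z)))%:E =
    s%:E * \int[N]_z (z * drho (r + c * s * z))%:E)%E.
  rewrite -integralZl//; last exact: integrable_zdrho.
  by apply: eq_integral => z _; rewrite -EFinM !mulrA.
have E2 : (\int[N]_z (ddrho (r + c * (s * z)))%:E = \int[N]_z (ddrho (r + c * s * z))%:E)%E.
  by apply: eq_integral => z _; rewrite mulrA.
rewrite E1 E2.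
have i1 := integrable_zdrho r (c * s).
have i2 := square_integrable_integrable (square_integrable_ddrho r (c * s)).
have := mom_zetaE r (c * s); rewrite /mom_zeta /mom_c => Z.
rewrite -(fineK (integrable_fin_num measurableT i1)) -(fineK (integrable_fin_num measurableT i2)).
rewrite -!EFinM; congr EFin.
rewrite [X in s * X]Z /Rintegral/=; ring.
Qed.

(** Multivariate Stein identity: the coordinates other than j are frozen into an intercept,
    [coord_stein] is used in coordinate j, and the result is averaged back. *)
Lemma gaussian_drho_coord th b j :
  \int[P]_w (drho (th + \sum_i b i * tnth (x w) i) * tnth (x w) j) =
  s ^+ 2 * b j * mom_c th (gauss_norm b).
Proof.
pose O := others (0 : R) xi j.
pose L (o : p.-tuple R) := th + \sum_(i < p | i != j) b i * tnth o i.
have mL : measurable_fun setT L.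
  apply: measurable_funD => //; apply: measurable_sum_cond => i _.
  by apply: measurable_funM => //; exact: measurable_tnth.
have LE w : th + \sum_i b i * tnth (x w) i = L (O w) + b j * xi j w.
  rewrite /L -addrA; congr (_ + _); rewrite (bigD1 j)//= addrC; congr (_ + _).
  by apply: eq_bigr => i ij; rewrite tnth_others.
have marg : measurable_fun setT (fun z : p.-tuple R * R => L z.1 + b j * z.2).
  apply: measurable_funD; first exact: measurableT_comp mL measurable_fst.
  by apply: measurable_funM => //; exact: measurable_snd.
pose f (z : p.-tuple R * R) := z.2 * drho (L z.1 + b j * z.2).
pose g (z : p.-tuple R * R) := ddrho (L z.1 + b j * z.2).
have mf : measurable_fun setT f.
  by apply: measurable_funM; [exact: measurable_snd|exact: measurableT_comp (@measurable_drho R) marg].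
have mg : measurable_fun setT g by exact: measurableT_comp (@measurable_ddrho R) marg.
have [xi2 _] := gaussian_coord_sqr j.
have iXD (h : T -> R) : measurable_fun setT h ->
    P.-integrable setT (EFin \o (fun w => xi j w * drho (h w))).
  move=> mh; apply: square_integrable_mul xi2 _.
  apply: (@square_integrable_bounded _ _ _ _ _ 1); last by move=> w; exact: normr_drho_le1.
  exact: measurableT_comp (@measurable_drho R) mh.
have iD (h : T -> R) : measurable_fun setT h ->
    P.-integrable setT (EFin \o (fun w => ddrho (h w))).
  move=> mh; apply: (@integrable_bounded _ _ _ _ _ 1); last by move=> w; exact: normr_ddrho_le1.
  exact: measurableT_comp (@measurable_ddrho R) mh.
have mj := measurable_coord j.
have mLO : measurable_fun setT (fun w => L (O w) + b j * xi j w).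
  apply: measurable_funD; first exact: measurableT_comp mL (mO j).
  exact: measurable_funM.
have mLo o : measurable_fun setT (fun w => L o + b j * xi j w).
  by apply: measurable_funD => //; exact: measurable_funM.
have key : (\int[P]_w (f (O w, xi j w))%:E = (s ^+ 2 * b j)%:E * \int[P]_w (g (O w, xi j w))%:E)%E.
  rewrite (integral_independent2 (mO j) mj (gaussian_coord_others j) mf); last 2 first.
  - exact: iXD mLO.
  - by move=> o; exact: iXD (mLo o).
  rewrite (integral_independent2 (mO j) mj (gaussian_coord_others j) mg); last 2 first.
  - exact: iD mLO.
  - by move=> o; exact: iD (mLo o).
  have fin w : (\int[P]_v (g (O w, xi j v))%:E)%E \is a fin_num.
    by apply: integrable_fin_num => //; exact: iD (mLo (O w)).
  transitivity (\int[P]_w ((s ^+ 2 * b j)%:E * \int[P]_v (g (O w, xi j v))%:E))%E.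
    by apply: eq_integral => w _; exact: (coord_stein j (L (O w)) (b j)).
  have mG : measurable_fun setT (fun o => \int[P]_v (g (o, xi j v))%:E)%E.
    apply: (measurable_fun_fubini_tonelli_F (m2 := P) (fun z => (g (z.1, xi j z.2))%:E)).
      apply/measurable_EFinP; apply: measurableT_comp mg _; apply: measurable_fun_pair.
        exact: measurable_fst.
      exact: measurableT_comp mj measurable_snd.
    by move=> z; rewrite lee_fin ltW// ddrho_gt0.
  rewrite integralZl//; apply/integrableP; split.
    exact: measurableT_comp mG (mO j).
  (* The inner average of [ddrho] lies between 0 and 1, hence is integrable. *)
  apply: (@le_lt_trans _ _ (\int[P]_w (cst 1%:E) w)%E); last first.
    by rewrite integral_cst//= probability_setT mule1 ltry.
  apply: ge0_le_integral => //.
  - by apply: measurableT_comp => //; exact: measurableT_comp mG (mO j).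
  - move=> w _ /=; rewrite gee0_abs; last first.
      by apply: integral_ge0 => v _; rewrite lee_fin ltW// ddrho_gt0.
    apply: (@le_trans _ _ (\int[P]_w (cst 1%:E) w)%E); last first.
      by rewrite integral_cst//= probability_setT mule1.
    apply: ge0_le_integral => //.
    + by move=> v _; rewrite lee_fin ltW// ddrho_gt0.
    + by apply/measurable_EFinP; exact: measurableT_comp (@measurable_ddrho R) (mLo (O w)).
    + by move=> v _; rewrite lee_fin ltW// ddrho_lt1.
have fE w : drho (th + \sum_i b i * tnth (x w) i) * tnth (x w) j = f (O w, xi j w).
  by rewrite LE mulrC.
have gE w : ddrho (th + \sum_i b i * tnth (x w) i) = g (O w, xi j w) by rewrite LE.
rewrite -gaussian_ddrho_mean.
have -> : \int[P]_w (drho (th + \sum_i b i * tnth (x w) i) * tnth (x w) j) =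
    \int[P]_w f (O w, xi j w) by apply: eq_Rintegral => w _; exact: fE.
have -> : \int[P]_w ddrho (th + \sum_i b i * tnth (x w) i) =
    \int[P]_w g (O w, xi j w) by apply: eq_Rintegral => w _; exact: gE.
rewrite /Rintegral key fineM//; apply: integrable_fin_num => //; exact: iD mLO.
Qed.

End GaussianVector.

(** * Estimators at fixed parameters *)

Lemma uniform_prob_itv (R : realType) (q : R) : 0 < q < 1 ->
  uniform_prob (@ltr01 R) [set t | t < q] = q%:E.
Proof.
move=> /andP[q0 q1]; rewrite /uniform_prob integral_uniform_pdf.
have -> : [set t | t < q] `&` `[0, 1] = `[0, q[%classic.
  apply/seteqP; split => t /=; rewrite !in_itv/=; first by move=> [-> /andP[->]].
  by move=> /andP[-> tq]; split=> //; rewrite ltW// (lt_trans tq).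
transitivity (\int[lebesgue_measure]_(t in `[0%R, q[%classic) cst 1%E t)%E.
  apply: eq_integral => t; rewrite inE/= in_itv/= => /andP[t0 tq].
  by rewrite /uniform_pdf t0 subr0 invr1 (ltW (lt_trans tq q1)).
by rewrite integral_cst//= mul1e lebesgue_measure_itv/= lte_fin q0 oppr0 adde0.
Qed.

Lemma dot_sum (R : realType) k (u v : 'rV[R]_k) : dot u v = \sum_j u 0 j * v 0 j.
Proof. by rewrite /dot mxE; apply: eq_bigr => j _; rewrite mxE. Qed.

Lemma dot_vec (R : realType) k (u v : k.-tuple R) :
  dot (vec u) (vec v) = \sum_j tnth u j * tnth v j.
Proof. by rewrite dot_sum; apply: eq_bigr => j _; rewrite !mxE. Qed.

Lemma average_subr (R : realType) n (F : 'I_n -> R) m : (0 < n)%N ->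
  n%:R^-1 * (\sum_i F i) - m = n%:R^-1 * \sum_i (F i - m).
Proof.
move=> n0; rewrite sumrB mulrBr sumr_const card_ord -[m *+ n]mulr_natl mulKf//.
by rewrite pnatr_eq0 -lt0n.
Qed.

(** The bound of [ustat_offdiag_sqr] at C = 1 / k, with the normalization of [zeta2_hat] squared in
    front; replacing S by 1 / k gives the right-hand side exactly. *)
Lemma ustat_rate (R : realType) (n k S : R) : 0 < n -> 0 < n - 1 -> 0 < k -> S <= k^-1 ->
  (k / (n * (n - 1))) ^+ 2 * (8 * (n - 1) ^+ 2 * n * k^-1 * S + 8 * n ^+ 2 * k * k^-1 ^+ 2) <=
  8 / n + 8 * k / (n - 1) ^+ 2.
Proof.
move=> n0 n1 k0 Sk.
have -> : 8 / n + 8 * k / (n - 1) ^+ 2 = (k / (n * (n - 1))) ^+ 2 *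
    (8 * (n - 1) ^+ 2 * n * k^-1 * k^-1 + 8 * n ^+ 2 * k * k^-1 ^+ 2).
  by field; rewrite !gt_eqF.
rewrite ler_wpM2l ?sqr_ge0// lerD2r ler_wpM2l//.
by rewrite !mulr_ge0 ?sqr_ge0 ?invr_ge0 ?ltW.
Qed.

(** The square of a sum of three terms costs a factor 3, and n / (n - 1) <= 2 costs another 4. *)
Lemma sqr_rate (R : realType) (n T1 T2 y m M : R) : 2 <= n -> `|y| <= 1 -> `|m| <= M ->
  (n / (n - 1) * (T1 - y * T2) + m / (n - 1)) ^+ 2 <=
  12 * T1 ^+ 2 + (12 * T2 ^+ 2 + 3 * M ^+ 2 / (n - 1) ^+ 2).
Proof.
move=> n2 y1 mM.
have n1 : 0 < n - 1 by lra.
have m2 : (m / (n - 1)) ^+ 2 <= M ^+ 2 / (n - 1) ^+ 2.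
  rewrite expr_div_n ler_wpM2r ?invr_ge0 ?sqr_ge0//.
  by rewrite -(real_normK (num_real m)) lerXn2r ?nnegrE// (le_trans _ mM).
have q2 : (n / (n - 1)) ^+ 2 <= 4.
  rewrite (_ : 4 = 2 ^+ 2); last by ring.
  rewrite lerXn2r ?nnegrE//; first by rewrite divr_ge0//; lra.
  by rewrite ler_pdivrMr//; lra.
have y2 : y ^+ 2 <= 1.
  by rewrite -(real_normK (num_real y)) expr_le1.
move: (n / (n - 1)) (m / (n - 1)) q2 m2 => q e q2 m2.
rewrite -mulrA; move: (M ^+ 2 / _) m2 => E m2.
have h1 : (q * (T1 - y * T2) + e) ^+ 2 <= 3 * (q ^+ 2 * T1 ^+ 2 + q ^+ 2 * (y ^+ 2 * T2 ^+ 2) + e ^+ 2).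
  have := sqr_ge0 (q * T1 + q * (y * T2)); have := sqr_ge0 (q * T1 - e).
  have := sqr_ge0 (q * (y * T2) + e); nra.
have h2 : q ^+ 2 * T1 ^+ 2 <= 4 * T1 ^+ 2 by rewrite ler_wpM2r// sqr_ge0.
have h3 : q ^+ 2 * (y ^+ 2 * T2 ^+ 2) <= 4 * T2 ^+ 2.
  have h4 : y ^+ 2 * T2 ^+ 2 <= T2 ^+ 2 by rewrite -[leRHS]mul1r ler_wpM2r// sqr_ge0.
  apply: le_trans (ler_wpM2l (sqr_ge0 _) h4) _.
  by rewrite ler_wpM2r// sqr_ge0.
lra.
Qed.

Section FrozenParameters.
Context d (T : measurableType d) (R : realType) (P : probability T R).
Context (n k : nat) (th : R) (b0 bP : k.-tuple R).
Variables (eps : 'I_n -> T -> R) (x : 'I_n -> T -> k.-tuple R).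
Hypothesis k0 : (0 < k)%N.
Hypothesis n2 : (1 < n)%N.
Hypothesis meps : forall i, measurable_fun setT (eps i).
Hypothesis mx : forall i, measurable_fun setT (x i).
Hypothesis leps : forall i, has_law P (eps i) (uniform_prob (@ltr01 R)).
Let s : R := (Num.sqrt k%:R)^-1.
Hypothesis lx : forall i, isotropic_gaussian P (Num.sqrt k%:R)^-1 (x i).
Hypothesis ieps : mutually_independent P eps.
Hypothesis ix : mutually_independent P x.
Hypothesis epsx : independent2 P (fun w => [tuple eps i w | i < n]) (fun w => [tuple x i w | i < n]).

Let Z i w : R * k.-tuple R := (eps i w, x i w).
Let x0 : k.-tuple R := [tuple 0 | i < k].
Let u0 : R * k.-tuple R := (0, x0).

Let s_gt0 : 0 < s.
Proof. by rewrite invr_gt0 sqrtr_gt0 ltr0n. Qed.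

Let s2E : s ^+ 2 = k%:R^-1.
Proof. by rewrite exprVn sqr_sqrtr. Qed.

Let mZ i : measurable_fun setT (Z i).
Proof. exact: measurable_fun_pair. Qed.

Let epsx1 i : independent2 P (eps i) (x i).
Proof.
have e1 : eps i = (@tnth n R ^~ i) \o (fun w => [tuple eps i w | i < n]).
  by apply/funext => w /=; rewrite tnth_mktuple.
have e2 : x i = (@tnth n _ ^~ i) \o (fun w => [tuple x i w | i < n]).
  by apply/funext => w /=; rewrite tnth_mktuple.
rewrite e1 e2; apply: independent2_comp epsx; exact: measurable_tnth.
Qed.

(** Independence of the noise from the design factors a four-fold event into a noise part and a
    design part, and mutual independence splits component i off each part. The pair of tuples is
    then zipped into a tuple of pairs. *)
Let indepZ i : independent2 P (others u0 Z i) (Z i).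
Proof.
have H : independent2 P (fun w => (others (0 : R) eps i w, others x0 x i w)) (Z i).
  apply: independent2_pairs => //; try exact: measurable_others.
  move=> A1 A2 B1 B2 mA1 mA2 mB1 mB2.
  have iE := mutually_independent_others (0 : R) i meps ieps.
  have iX := mutually_independent_others x0 i mx ix.
  pose O d' (V : measurableType d') (v : V) (t : n.-tuple V) : n.-tuple V :=
    others v (fun j (t : n.-tuple V) => tnth t j) i t.
  have mO d' (V : measurableType d') (v : V) : measurable_fun setT (O d' V v).
    by apply: measurable_others => j; exact: measurable_tnth.
  have OE d' (V : measurableType d') (v : V) (X : 'I_n -> T -> V) :
      O d' V v \o (fun w => [tuple X l w | l < n]) = others v X i.
    by apply/funext => w; apply: eq_from_tnth => j; rewrite !tnth_mktuple.
  have OP d' (V : measurableType d') (v : V) (X : 'I_n -> T -> V) A B :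
      (fun w => [tuple X l w | l < n]) @^-1` (O d' V v @^-1` A `&` (@tnth n V ^~ i) @^-1` B) =
      others v X i @^-1` A `&` X i @^-1` B.
    by rewrite -(OE d' V v X) preimage_setI; congr (_ `&` _); apply/seteqP; split => w /=; rewrite tnth_mktuple.
  have mOP d' (V : measurableType d') (v : V) A B : measurable A -> measurable B ->
      measurable (O d' V v @^-1` A `&` (@tnth n V ^~ i) @^-1` B).
    move=> mA mB; apply: measurableI; first exact: measurable_preimage (mO _ _ v) mA.
    exact: measurable_preimage (@measurable_tnth _ _ _ i) mB.
  rewrite setIACA.
  have := epsx (mOP _ _ (0 : R) _ _ mA1 mB1) (mOP _ _ x0 _ _ mA2 mB2).
  rewrite !OP => ->; rewrite iE// iX//.
  have := independent2_comp (mO _ _ (0 : R)) (mO _ _ x0) epsx mA1 mA2.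
  by rewrite !OE => ->; rewrite (@epsx1 i _ _ mB1 mB2) muleACA.
pose zipf (o : n.-tuple R * n.-tuple (k.-tuple R)) := [tuple (tnth o.1 j, tnth o.2 j) | j < n].
have mzip : measurable_fun setT zipf.
  apply: measurable_mktuple => j; apply: measurable_fun_pair.
    exact: measurableT_comp (measurable_tnth j) measurable_fst.
  exact: measurableT_comp (measurable_tnth j) measurable_snd.
have -> : others u0 Z i = zipf \o (fun w => (others (0 : R) eps i w, others x0 x i w)).
  apply/funext => w; apply: eq_from_tnth => j /=.
  by rewrite /others !tnth_mktuple; case: ifP.
exact: (independent2_comp mzip (@measurable_id _ _ setT) H).
Qed.

Let lin (b : k.-tuple R) (v : k.-tuple R) : R := \sum_j tnth b j * tnth v j.

Let mlin b : measurable_fun setT (lin b).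
Proof. by apply: measurable_sum => j; apply: measurable_funM => //; exact: measurable_tnth. Qed.

Let Yf (z : R * k.-tuple R) : R := if z.1 < drho (th + lin b0 z.2) then 1 else 0.

Let mYf : measurable_fun setT Yf.
Proof.
apply: measurable_fun_ifT => //; apply: measurable_fun_ltr; first exact: measurable_fst.
apply: measurableT_comp (@measurable_drho R) _; apply: measurable_funD => //.
exact: measurableT_comp (mlin b0) measurable_snd.
Qed.

Let Yf_le1 z : `|Yf z| <= 1.
Proof. by rewrite /Yf; case: ifP; rewrite ?normr1// normr0. Qed.

(** With x_i frozen, the response compares a uniform variable with a level in (0, 1), so its mean is
    that level. *)
Let response_mean i (g : k.-tuple R -> R) : measurable_fun setT g ->
  P.-integrable setT (EFin \o (g \o x i)) ->
  \int[P]_w (Yf (Z i w) * g (x i w)) = \int[P]_w (drho (th + lin b0 (x i w)) * g (x i w)).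
Proof.
move=> mg ig.
pose f (z : k.-tuple R * R) := Yf (z.2, z.1) * g z.1.
have mYs : measurable_fun setT (fun z : k.-tuple R * R => Yf (z.2, z.1)).
  by apply: measurableT_comp mYf _; apply: measurable_fun_pair; [exact: measurable_snd|exact: measurable_fst].
have mf : measurable_fun setT f.
  by apply: measurable_funM => //; exact: measurableT_comp mg measurable_fst.
have ing : P.-integrable setT (EFin \o (fun w => `|g (x i w)|)).
  by have := integrable_norm ig; apply: eq_integrable.
have H := integral_independent2 (mx i) (meps i) (independent2_sym (@epsx1 i)) mf.
rewrite /Rintegral; congr fine; rewrite H.
- apply: eq_integral => w _; rewrite /f /=.
  set q := drho (th + lin b0 (x i w)).
  transitivity (\int[P]_v ((g (x i w))%:E * (\1_(eps i @^-1` [set t | (t < q)%R]) v)%:E))%E.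
    apply: eq_integral => v _; rewrite -EFinM /Yf/= mulrC indicE -/q; congr (_ * _)%:E.
    by case: ifP => h; [rewrite mem_set|rewrite memNset//= h].
  have mE : measurable (eps i @^-1` [set t | t < q]).
    apply: measurable_preimage (meps i) _.
    by rewrite -[X in measurable X]setTI; exact: measurable_fun_ltr.
  rewrite integralZl//; last exact: integrable_indic.
  have -> : (\int[P]_v (\1_(eps i @^-1` [set t | (t < q)%R]) v)%:E = q%:E)%E.
    rewrite integral_indic// setIT; transitivity (uniform_prob (@ltr01 R) [set t | t < q]).
      by apply: leps; rewrite -[X in measurable X]setTI; exact: measurable_fun_ltr.
    by rewrite uniform_prob_itv// drho_gt0 drho_lt1.
  by rewrite -EFinM mulrC.
- apply: integrable_le_norm (ing) _ => [|w].
    apply: measurable_funM; first exact: measurableT_comp mYf (mZ i).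
    exact: measurableT_comp mg (mx i).
  by rewrite normrM -[leRHS]mul1r ler_wpM2r.
- move=> v; apply: (@integrable_bounded _ _ _ _ _ `|g v|) => [|w].
    have m1 : measurable_fun setT (fun w => (eps i w, v)) by exact: measurable_fun_pair.
    have m2 : measurable_fun setT (fun w => Yf (eps i w, v)) by exact: (measurableT_comp mYf m1).
    exact: (measurable_funM m2 (@measurable_cst _ _ T R setT (g v))).
  by rewrite normrM -[leRHS]mul1r ler_wpM2r.
Qed.

Let Y i w := response (eps i w) th (vec (x i w)) (vec b0).
Let X i w := vec (x i w).
Let gam := gauss_norm s (tnth b0).
Let c := mom_c th gam.

Let YE i w : Y i w = Yf (Z i w).
Proof.
have E : dot (vec (x i w)) (vec b0) = lin b0 (x i w).
  by rewrite dot_vec; apply: eq_bigr => j _; rewrite mulrC.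
by rewrite /Y /response E.
Qed.

Let n_gt0 : 0 < n%:R :> R.
Proof. by rewrite ltr0n ltnW. Qed.

Let n1_gt0 : 0 < n%:R - 1 :> R.
Proof. by rewrite subr_gt0 ltr1n. Qed.

Let Y2 i : square_integrable P (Yf \o Z i).
Proof.
apply: (@square_integrable_bounded _ _ _ _ _ 1) => [|w]; last exact: Yf_le1.
exact: measurableT_comp mYf (mZ i).
Qed.

Let Y_mean i : \int[P]_w Yf (Z i w) = mom_pi th gam.
Proof.
have ig : P.-integrable setT (EFin \o ((fun=> 1 : R) \o x i)).
  exact: (finite_measure_integrable_cst P 1).
have H := @response_mean i (fun=> 1) (@measurable_cst _ _ _ R setT 1) ig.
have -> : \int[P]_w Yf (Z i w) = \int[P]_w (Yf (Z i w) * 1).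
  by apply: eq_Rintegral => w _; rewrite mulr1.
rewrite H -(gaussian_drho_mean s_gt0 (mx i) (lx i) th (tnth b0)).
by apply: eq_Rintegral => w _; rewrite mulr1.
Qed.

Let ybarE w : pi_hat (Y ^~ w) = n%:R^-1 * \sum_i Yf (Z i w).
Proof. exact: (congr1 ( *%R n%:R^-1) (eq_bigr _ (fun i _ => YE i w))). Qed.

Lemma pi_hat_sqr :
  square_integrable P (fun w => pi_hat (Y ^~ w) - mom_pi th gam) /\
  \int[P]_w (pi_hat (Y ^~ w) - mom_pi th gam) ^+ 2 <= n%:R^-1.
Proof.
have B1 i : \int[P]_w (Yf (Z i w) ^+ 2) <= 1.
  rewrite -[leRHS](Rintegral_prob_cst P); apply: le_Rintegral_ge0 => [||w].
  - exact: (Y2 i).2.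
  - exact: (finite_measure_integrable_cst P 1).
  by rewrite /Yf; case: ifP; rewrite ?expr1n// expr0n.
have [H1 H2] := sum_centered_sqr mZ indepZ xpredT mYf Y2 Y_mean B1.
have E' m w : pi_hat (Y ^~ w) - m = n%:R^-1 * \sum_(k < n) (Yf (Z k w) - m).
  rewrite -average_subr; last exact: ltnW.
  by rewrite ybarE.
have E w := E' (mom_pi th gam) w.
split.
  by rewrite (funext E); exact: square_integrableZ.
have -> : \int[P]_w (pi_hat (Y ^~ w) - mom_pi th gam) ^+ 2 =
    \int[P]_w (n%:R^-1 ^+ 2 * (\sum_(k < n) (Yf (Z k w) - mom_pi th gam)) ^+ 2).
  by apply: eq_Rintegral => w _; rewrite E exprMn.
rewrite RintegralZl//; last exact: H1.2.
move: H2; rewrite mulr1 => H2.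
apply: (le_trans (ler_wpM2l _ H2)); first exact: sqr_ge0.
by rewrite expr2 -mulrA mulVf ?gt_eqF// mulr1.
Qed.

Let lin2 b i : square_integrable P (fun w => lin b (x i w)) /\
  \int[P]_w (lin b (x i w) ^+ 2) = k%:R^-1 * \sum_j tnth b j ^+ 2.
Proof. by rewrite -s2E; exact: (gaussian_lin_sqr s_gt0 (mx i) (lx i) (tnth b)). Qed.

Let Ylin2 b i : square_integrable P (fun w => Yf (Z i w) * lin b (x i w)).
Proof. exact: (square_integrable_bddM (Y2 i).1 (fun w => Yf_le1 (Z i w)) (lin2 b i).1). Qed.

Let Ylin_sqr b i : \int[P]_w ((Yf (Z i w) * lin b (x i w)) ^+ 2) <= k%:R^-1 * \sum_j tnth b j ^+ 2.
Proof.
rewrite -(lin2 b i).2; apply: le_Rintegral_ge0; [exact: (Ylin2 b i).2|exact: (lin2 b i).1.2|move=> w].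
rewrite exprMn -[leRHS]mul1r ler_wpM2r ?sqr_ge0//.
by rewrite /Yf; case: ifP; rewrite ?expr1n// expr0n.
Qed.

Let coord2 j i : square_integrable P (fun w => tnth (x i w) j).
Proof. exact: (gaussian_coord_sqr s_gt0 (mx i) (lx i) j).1. Qed.

Let Ycoord_mean j i : \int[P]_w (Yf (Z i w) * tnth (x i w) j) = k%:R^-1 * tnth b0 j * c.
Proof.
have := @response_mean i (@tnth k R ^~ j) (measurable_tnth j) (square_integrable_integrable (coord2 j i)).
by rewrite (gaussian_drho_coord s_gt0 (mx i) (lx i) th (tnth b0) j) s2E.
Qed.

Let Ycoord2 j i : square_integrable P (fun w => Yf (Z i w) * tnth (x i w) j).
Proof. exact: (square_integrable_bddM (Y2 i).1 (fun w => Yf_le1 (Z i w)) (coord2 j i)). Qed.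

(** The U-statistic has kernel <h, h> with h = Y x, of mean m = c beta0 / k. Its target is k |m|^2 =
    gam^2 c^2, the square of zeta by [mom_zetaE]. Since |Y| <= 1, [hC] holds with C = 1 / k. *)
Lemma zeta2_hat_sqr :
  square_integrable P (fun w => zeta2_hat (Y ^~ w) (X ^~ w) - mom_zeta th gam ^+ 2) /\
  \int[P]_w (zeta2_hat (Y ^~ w) (X ^~ w) - mom_zeta th gam ^+ 2) ^+ 2 <=
    8 / n%:R + 8 * k%:R / (n%:R - 1) ^+ 2.
Proof.
have k_gt0 : 0 < k%:R :> R by rewrite ltr0n.
pose h (a : 'I_k) (z : R * k.-tuple R) := Yf z * tnth z.2 a.
pose m (a : 'I_k) := k%:R^-1 * tnth b0 a * c.
have mh a : measurable_fun setT (h a).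
  by apply: measurable_funM => //; exact: measurableT_comp (measurable_tnth a) measurable_snd.
have h2 a i : square_integrable P (h a \o Z i) by exact: Ycoord2.
have hm a i : \int[P]_w h a (Z i w) = m a by exact: Ycoord_mean.
have C0 : 0 <= k%:R^-1 :> R by rewrite invr_ge0.
have hC i (e : 'I_k -> R) : \int[P]_w (\sum_a e a * h a (Z i w)) ^+ 2 <= k%:R^-1 * \sum_a e a ^+ 2.
  pose b := [tuple e j | j < k].
  have -> : \sum_a e a ^+ 2 = \sum_a tnth b a ^+ 2 by apply: eq_bigr => a _; rewrite tnth_mktuple.
  have -> : \int[P]_w (\sum_a e a * h a (Z i w)) ^+ 2 = \int[P]_w ((Yf (Z i w) * lin b (x i w)) ^+ 2).
    apply: eq_Rintegral => w _; congr (_ ^+ 2); rewrite /lin mulr_sumr.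
    by apply: eq_bigr => a _; rewrite tnth_mktuple /h/= mulrCA.
  exact: Ylin_sqr.
have M := ustat_mean_sqr_le h2 hm C0 hC (Ordinal n2).
have [H1 H2] := ustat_offdiag_sqr mZ indepZ mh h2 hm C0 hC.
set S := \sum_a m a ^+ 2 in M H1 H2.
have zE : mom_zeta th gam ^+ 2 = k%:R * S.
  rewrite mom_zetaE -/c exprMn /gam /gauss_norm exprMn s2E sqr_sqrtr; last first.
    by apply: sumr_ge0 => j _; exact: sqr_ge0.
  rewrite /S /m; move: c => c'.
  have -> : \sum_a (k%:R^-1 * tnth b0 a * c') ^+ 2 = (k%:R^-1 ^+ 2 * c' ^+ 2) * \sum_j tnth b0 j ^+ 2.
    by rewrite mulr_sumr; apply: eq_bigr => a _; ring.
  by field; rewrite gt_eqF.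
have E w : zeta2_hat (Y ^~ w) (X ^~ w) - mom_zeta th gam ^+ 2 =
    k%:R / (n%:R * (n%:R - 1)) * (\sum_(i < n) \sum_(j < n | i != j)
      \sum_a h a (Z i w) * h a (Z j w) - n%:R * (n%:R - 1) * S).
  rewrite zE; clear zE; move: (S) => S'; rewrite mulrBr; congr (_ - _); last by field; rewrite !gt_eqF.
  rewrite /zeta2_hat; congr (_ * _); apply: eq_bigr => i _; apply: eq_bigr => j _.
  rewrite dot_vec mulr_sumr !YE; apply: eq_bigr => a _; exact: mulrACA.
split; first by rewrite (funext E); exact: square_integrableZ.
set G := (fun w => \sum_(i < n) _ - _) in H1 H2.
have -> : \int[P]_w (zeta2_hat (Y ^~ w) (X ^~ w) - mom_zeta th gam ^+ 2) ^+ 2 =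
    \int[P]_w ((k%:R / (n%:R * (n%:R - 1))) ^+ 2 * (G w ^+ 2)).
  by apply: eq_Rintegral => w _; rewrite E exprMn.
rewrite RintegralZl//; last exact: H1.2.
apply: (le_trans (ler_wpM2l (sqr_ge0 _) H2)).
exact: ustat_rate.
Qed.

Let lin_mean b i : \int[P]_w lin b (x i w) = 0.
Proof.
have coord0 j : \int[P]_w tnth (x i w) j = 0 by exact: (gaussian_coord_mean s_gt0 (mx i) (lx i) j).
have i1 j : P.-integrable setT (EFin \o (fun w => tnth b j * tnth (x i w) j)).
  exact: (square_integrable_integrable (square_integrableZ _ (coord2 j i))).
have [_ ->] := Rintegral_sum (index_enum 'I_k) i1.
apply: big1 => j _; rewrite RintegralZl ?coord0 ?mulr0//.
exact: (square_integrable_integrable (coord2 j i)).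
Qed.

Let Ylin_mean b i : \int[P]_w (Yf (Z i w) * lin b (x i w)) =
  k%:R^-1 * (\sum_j tnth b0 j * tnth b j) * c.
Proof.
have i1 j : P.-integrable setT (EFin \o (fun w => tnth b j * (Yf (Z i w) * tnth (x i w) j))).
  exact: (square_integrable_integrable (square_integrableZ _ (Ycoord2 j i))).
have -> : \int[P]_w (Yf (Z i w) * lin b (x i w)) =
    \int[P]_w \sum_j (tnth b j * (Yf (Z i w) * tnth (x i w) j)).
  by apply: eq_Rintegral => w _; rewrite mulr_sumr; apply: eq_bigr => j _; rewrite mulrCA.
have [_ ->] := Rintegral_sum (index_enum 'I_k) i1.
rewrite -mulrA mulr_suml mulr_sumr; apply: eq_bigr => j _.
rewrite RintegralZl ?Ycoord_mean//; last exact: (square_integrable_integrable (Ycoord2 j i)).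
by ring.
Qed.

Let c_le1 : `|c| <= 1.
Proof.
rewrite ger0_norm ?(ltW (mom_c_gt0 _ _))// /c -(gaussian_ddrho_mean s_gt0 (mx (Ordinal n2)) (lx (Ordinal n2)) th (tnth b0)).
rewrite -[leRHS](Rintegral_prob_cst P); apply: le_Rintegral_ge0 => [||w].
- apply: (@integrable_bounded _ _ _ _ _ 1) => [|w]; last exact: normr_ddrho_le1.
  apply: measurableT_comp (@measurable_ddrho R) _; apply: measurable_funD => //.
  exact: measurable_gaussian_lin (mx (Ordinal n2)) _.
- exact: (finite_measure_integrable_cst P 1).
- exact/ltW/ddrho_lt1.
Qed.

(** The sample covariance is the average of Y L minus the product of the averages, times n / (n -
    1). Centering Y L at m leaves the bias n m / (n - 1) - m = m / (n - 1); subtracting 0 from L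
    matches the shape of [sum_centered_sqr]. *)
Let b_hatE w : let L i := lin bP (x i w) in let m := k%:R^-1 * dot (vec b0) (vec bP) * c in
  b_hat (Y ^~ w) (X ^~ w) (vec bP) - m =
  n%:R / (n%:R - 1) * (n%:R^-1 * (\sum_i (Yf (Z i w) * L i - m)) -
    ybar (Y ^~ w) * (n%:R^-1 * \sum_i (L i - 0))) + m / (n%:R - 1).
Proof.
move=> L m; rewrite /b_hat.
have LE i : dot (vec bP) (X i w - xbar (X ^~ w)) = L i - n%:R^-1 * \sum_j L j.
  rewrite dot_sum /L /lin exchange_big/= mulr_sumr -sumrB; apply: eq_bigr => j _.
  rewrite !mxE summxE -mulr_sumr [n%:R^-1 * (_ * _)]mulrCA -mulrBr; congr (_ * (_ - _ * _)).
  by apply: eq_bigr => l _; rewrite mxE.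
set yb := ybar _; set Lb := n%:R^-1 * \sum_j L j.
have sL : \sum_j L j = n%:R * Lb by rewrite mulVKf// gt_eqF.
have sY : \sum_i Yf (Z i w) = n%:R * yb.
  by rewrite /yb -[ybar _]/(pi_hat _) ybarE mulVKf ?gt_eqF.
have -> : \sum_i (Y i w - yb) * dot (vec bP) (X i w - xbar (X ^~ w)) =
    \sum_i Yf (Z i w) * L i - n%:R * yb * Lb.
  under eq_bigr do rewrite LE YE -/Lb mulrBl !mulrBr.
  rewrite !sumrB -mulr_suml -mulr_sumr sL sY sumr_const card_ord -[X in _ - (_ - X)]mulr_natl.
  ring.
rewrite !sumrB sL sumr_const card_ord -[m *+ n]mulr_natl big1_eq.
by field; rewrite !gt_eqF.
Qed.

(** Each of the two averages in [b_hatE] has second moment at most B / n, whence 12 + 12 = 24 by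
    [sqr_rate]; the last term is three times the squared bias, where c <= 1 gives |m| <= M. *)
Lemma b_hat_sqr (B M : R) : k%:R^-1 * \sum_j tnth bP j ^+ 2 <= B ->
    `|k%:R^-1 * dot (vec b0) (vec bP)| <= M ->
  let m := k%:R^-1 * dot (vec b0) (vec bP) * c in
  square_integrable P (fun w => b_hat (Y ^~ w) (X ^~ w) (vec bP) - m) /\
  \int[P]_w (b_hat (Y ^~ w) (X ^~ w) (vec bP) - m) ^+ 2 <=
    24 * B / n%:R + 3 * M ^+ 2 / (n%:R - 1) ^+ 2.
Proof.
move=> hB hM m.
have mYL : measurable_fun setT (fun z => Yf z * lin bP z.2).
  by apply: measurable_funM => //; exact: measurableT_comp (mlin bP) measurable_snd.
have mL : measurable_fun setT (fun z : R * k.-tuple R => lin bP z.2).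
  exact: measurableT_comp (mlin bP) measurable_snd.
have YLm i : \int[P]_w (Yf (Z i w) * lin bP (Z i w).2) = m by rewrite Ylin_mean /m dot_vec.
have [S1 I1] := @sum_centered_sqr _ _ _ P _ _ n Z u0 mZ indepZ (fun z => Yf z * lin bP z.2) m B xpredT mYL
  (Ylin2 bP) YLm (fun i => le_trans (Ylin_sqr bP i) hB).
have lin2B i : \int[P]_w (lin bP (Z i w).2 ^+ 2) <= B by rewrite (lin2 bP i).2.
have [S2 I2] := @sum_centered_sqr _ _ _ P _ _ n Z u0 mZ indepZ (fun z => lin bP z.2) 0 B xpredT mL
  (fun i => (lin2 bP i).1) (lin_mean bP) lin2B.
pose T1 w := n%:R^-1 * (\sum_i (Yf (Z i w) * lin bP (x i w) - m)).
pose T2 w := n%:R^-1 * (\sum_i (lin bP (x i w) - 0)).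
pose y w := ybar (Y ^~ w).
have y1 w : `|y w| <= 1.
  rewrite /y /ybar normrM ger0_norm ?invr_ge0 ?ler0n// ler_pdivrMl// mulr1.
  apply: le_trans (ler_norm_sum _ _ _) _.
  have -> : n%:R = \sum_(i < n) (1 : R) by rewrite sumr_const card_ord.
  by apply: ler_sum => i _; rewrite YE.
have my : measurable_fun setT y.
  apply: measurable_funM => //; apply: measurable_sum => i.
  rewrite [X in measurable_fun _ X](_ : _ = Yf \o Z i); last by apply/funext => w; exact: YE.
  exact: measurableT_comp mYf (mZ i).
have T1s : square_integrable P T1 by exact: square_integrableZ.
have T2s : square_integrable P T2 by exact: square_integrableZ.
have half (f : T -> R) : square_integrable P f -> \int[P]_w (f w ^+ 2) <= n%:R * B ->
    \int[P]_w ((n%:R^-1 * f w) ^+ 2) <= B / n%:R.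
  move=> fs fB.
  have -> : \int[P]_w ((n%:R^-1 * f w) ^+ 2) = \int[P]_w (n%:R^-1 ^+ 2 * f w ^+ 2).
    by apply: eq_Rintegral => w _; rewrite exprMn.
  rewrite RintegralZl//; last exact: fs.2.
  apply: (le_trans (ler_wpM2l (sqr_ge0 _) fB)).
  by rewrite le_eqVlt; apply/orP; left; apply/eqP; field; rewrite gt_eqF.
have T1B : \int[P]_w (T1 w ^+ 2) <= B / n%:R by exact: half S1 I1.
have T2B : \int[P]_w (T2 w ^+ 2) <= B / n%:R by exact: half S2 I2.
have mM : `|m| <= M.
  rewrite /m normrM; apply: le_trans hM; rewrite -[leRHS]mulr1 ler_wpM2l//.
have E w : b_hat (Y ^~ w) (X ^~ w) (vec bP) - m =
    n%:R / (n%:R - 1) * (T1 w - y w * T2 w) + m / (n%:R - 1) by exact: b_hatE.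
have D2 : square_integrable P (fun w => n%:R / (n%:R - 1) * (T1 w - y w * T2 w) + m / (n%:R - 1)).
  apply: square_integrableD; last exact: (square_integrable_cst P (m / (n%:R - 1))).
  apply: square_integrableZ; apply: square_integrableB => //.
  exact: (square_integrable_bddM my y1 T2s).
split; first by rewrite (funext E).
have -> : \int[P]_w (b_hat (Y ^~ w) (X ^~ w) (vec bP) - m) ^+ 2 =
    \int[P]_w (n%:R / (n%:R - 1) * (T1 w - y w * T2 w) + m / (n%:R - 1)) ^+ 2.
  by apply: eq_Rintegral => w _; rewrite E.
have iT (f : T -> R) (a : R) : square_integrable P f ->
    P.-integrable setT (EFin \o (fun w => a * f w ^+ 2)).
  by move=> fs; have := integrableZl measurableT a fs.2; apply: eq_integrable.
have icst a : P.-integrable setT (EFin \o (fun=> a : R)).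
  exact: (finite_measure_integrable_cst P a).
apply: (@le_trans _ _ (\int[P]_w (12 * T1 w ^+ 2 + (12 * T2 w ^+ 2 + 3 * M ^+ 2 / (n%:R - 1) ^+ 2)))).
  apply: le_Rintegral_ge0 => [||w]; first exact: D2.2.
    by apply: integrableDR; [exact: iT|apply: integrableDR; [exact: iT|exact: icst]].
  by apply: sqr_rate => //; rewrite ler_nat.
rewrite RintegralD//; [|exact: iT|by apply: integrableDR; [exact: iT|exact: icst]].
rewrite RintegralD//; [|exact: iT].
have iS (f : T -> R) : square_integrable P f ->
    \int[P]_w (12 * f w ^+ 2) = 12 * \int[P]_w (f w ^+ 2).
  by move=> fs; rewrite RintegralZl//; exact: fs.2.
rewrite (iS T1)// (iS T2)// Rintegral_prob_cst addrA lerD2r.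
apply: (le_trans (lerD (ler_wpM2l _ T1B) (ler_wpM2l _ T2B))) => //.
by rewrite le_eqVlt; apply/orP; left; apply/eqP; field; rewrite gt_eqF.
Qed.

Lemma frozen_deviation (B r : R) : 0 < r -> k%:R^-1 * \sum_j tnth bP j ^+ 2 <= B ->
    `|k%:R^-1 * dot (vec b0) (vec bP)| <= B ->
  (P ([set w | (r < `|pi_hat (Y ^~ w) - mom_pi th gam|)%R] `|`
      [set w | (r < `|zeta2_hat (Y ^~ w) (X ^~ w) - mom_zeta th gam ^+ 2|)%R] `|`
      [set w | (r < `|b_hat (Y ^~ w) (X ^~ w) (vec bP) - k%:R^-1 * dot (vec b0) (vec bP) * c|)%R]) <=
   ((n%:R^-1 + (8 / n%:R + 8 * k%:R / (n%:R - 1) ^+ 2) +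
     (24 * B / n%:R + 3 * B ^+ 2 / (n%:R - 1) ^+ 2)) / r ^+ 2)%:E)%E.
Proof.
move=> r0 hB hM.
have [S1 B1] := pi_hat_sqr.
have [S2 B2] := zeta2_hat_sqr.
have [S3 B3] := b_hat_sqr hB hM.
have mA (f : T -> R) : square_integrable P f -> measurable [set w | r < `|f w|].
  move=> [mf _]; rewrite -[X in measurable X]setTI.
  by apply: measurable_fun_ltr => //; exact: measurableT_comp.
have C (f : T -> R) K : square_integrable P f -> \int[P]_w (f w ^+ 2) <= K ->
    (P [set w | (r < `|f w|)%R] <= (K / r ^+ 2)%:E)%E.
  move=> fs fK; apply: le_trans (chebyshev_sqr fs r0) _.
  by rewrite lee_fin ler_wpM2r// invr_ge0 sqr_ge0.
have sub (A A' : set T) : measurable A -> measurable A' -> (P (A `|` A') <= P A + P A')%E.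
  by move=> hA hA'; exact: measureU2.
apply: le_trans (sub _ _ _ _) _; first by apply: measurableU; exact: mA.
  exact: mA.
rewrite mulrDl EFinD; apply: leeD; last exact: C.
apply: le_trans (sub _ _ _ _) _; [exact: mA|exact: mA|].
by rewrite mulrDl EFinD; apply: leeD; exact: C.
Qed.

End FrozenParameters.

(** As a clamp to [-m, m] the estimator is visibly measurable and Lipschitz, which the sign conceals
    at t = 0. *)
Lemma clip_sg (R : realDomainType) (t m : R) : 0 <= m ->
  Num.sg t * Num.min `|t| m = Num.max (- m) (Num.min t m).
Proof.
move=> m0; case: (ltrgt0P t) => [t0|t0|->].
- rewrite gtr0_sg// mul1r; apply/esym/max_idPr.
  by rewrite le_min; apply/andP; split; lra.
- rewrite ltr0_sg// mulN1r; have -> : Num.min t m = t by apply/min_idPl; lra.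
  by rewrite oppr_min opprK maxC.
- by rewrite sgr0 mul0r (min_idPl m0); apply/esym/max_idPr; lra.
Qed.

Lemma mom_zeta0 (R : realType) (th : R) : mom_zeta th 0 = 0.
Proof. by rewrite mom_zetaE mul0r. Qed.

Section ClippedEstimator.
Context (R : realType) (n k : nat).
Variables (y : 'I_n -> R) (x : 'I_n -> 'rV[R]_k) (bP : 'rV[R]_k).

Lemma gamma_hat_ge0 : 0 <= gamma_hat y x.
Proof.
rewrite /gamma_hat /theta_gamma_hat; case: xgetP => [v -> [[v2 _ _] _]|_] //.
Qed.

Lemma phi_hatE : phi_hat y x bP =
  Num.max (- (gamma_hat y x * delta_p bP)) (Num.min (phi_tilde y x bP) (gamma_hat y x * delta_p bP)).
Proof.
rewrite /phi_hat clip_sg// mulr_ge0// ?gamma_hat_ge0//.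
by rewrite mulr_ge0 ?invr_ge0 ?sqrtr_ge0.
Qed.

End ClippedEstimator.

(** * Measurability of the estimators *)

Section MeasurableEstimators.
Context d (T : measurableType d) (R : realType).
Notation N := (@normal_prob R 0 1).

Lemma measurable_normal_average (f : R -> R) (th g : T -> R) :
  measurable_fun setT f -> (forall t, 0 <= f t) ->
  measurable_fun setT th -> measurable_fun setT g ->
  measurable_fun setT (fun w => \int[N]_z f (th w + g w * z)).
Proof.
move=> mf f0 mth mg.
pose F (wz : T * measurableTypeR R) := (f (th wz.1 + g wz.1 * wz.2))%:E.
have mF : measurable_fun setT F.
  apply/measurable_EFinP; apply: measurableT_comp mf _; apply: measurable_funD.
    exact: measurableT_comp mth measurable_fst.
  apply: measurable_funM; first exact: measurableT_comp mg measurable_fst.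
  exact: measurable_snd.
have F0 z : (0 <= F z)%E by rewrite lee_fin.
have mG : measurable_fun setT (fun w => \int[N]_z F (w, z))%E.
  exact: (@measurable_fun_fubini_tonelli_F _ _ T (measurableTypeR R) R N F mF F0).
exact: (measurableT_comp (@fine_measurable R setT measurableT) mG).
Qed.

Lemma measurable_mom_pi (th g : T -> R) :
  measurable_fun setT th -> measurable_fun setT g ->
  measurable_fun setT (fun w => mom_pi (th w) (g w)).
Proof.
by apply: measurable_normal_average; [exact: measurable_drho|move=> t; exact/ltW/drho_gt0].
Qed.

Lemma measurable_mom_c (th g : T -> R) :
  measurable_fun setT th -> measurable_fun setT g ->
  measurable_fun setT (fun w => mom_c (th w) (g w)).
Proof.
by apply: measurable_normal_average; [exact: measurable_ddrho|move=> t; exact/ltW/ddrho_gt0].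
Qed.

Lemma measurable_mom_zeta (th g : T -> R) :
  measurable_fun setT th -> measurable_fun setT g ->
  measurable_fun setT (fun w => mom_zeta (th w) (g w)).
Proof.
move=> mth mg; under eq_fun do rewrite mom_zetaE.
by apply: measurable_funM => //; exact: measurable_mom_c.
Qed.

Lemma measurable_sqrt (f : T -> R) : measurable_fun setT f ->
  measurable_fun setT (fun w => Num.sqrt (f w)).
Proof.
move=> mf; apply: measurableT_comp mf; apply: continuous_measurable_fun.
exact: sqrt_continuous.
Qed.

Lemma measurable_div (f g : T -> R) : (forall w, 0 <= g w) ->
  measurable_fun setT f -> measurable_fun setT g ->
  measurable_fun setT (fun w => f w / g w).
Proof.
move=> g0 mf mg; apply: measurable_funM => //.
(* On nonnegative reals the power -1 is the inverse, also at 0, and powers are measurable. *)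
have -> : (fun w => (g w)^-1) = (fun w => (g w) `^ (-1)).
  by apply/funext => w; rewrite powR_inv1.
exact: (measurableT_comp (measurable_powR (-1)) mg).
Qed.

Context (n k : nat).

Lemma measurable_tnth_comp (v : T -> k.-tuple R) j : measurable_fun setT v ->
  measurable_fun setT (fun w => tnth (v w) j).
Proof. by move=> mv; exact: (measurableT_comp (measurable_tnth j) mv). Qed.

Lemma measurable_dot (u v : T -> k.-tuple R) :
  measurable_fun setT u -> measurable_fun setT v ->
  measurable_fun setT (fun w => dot (vec (u w)) (vec (v w))).
Proof.
move=> mu mv; under eq_fun do rewrite dot_vec.
by apply: measurable_sum => j; apply: measurable_funM; exact: measurable_tnth_comp.
Qed.

Lemma measurable_response (e th : T -> R) (x b : T -> k.-tuple R) :
  measurable_fun setT e -> measurable_fun setT th ->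
  measurable_fun setT x -> measurable_fun setT b ->
  measurable_fun setT (fun w => response (e w) (th w) (vec (x w)) (vec (b w))).
Proof.
move=> me mth mx mb; apply: measurable_fun_ifT => //.
apply: measurable_fun_ltr => //; apply: measurableT_comp; first exact: measurable_drho.
by apply: measurable_funD => //; exact: measurable_dot.
Qed.

Variables (y : T -> 'I_n -> R) (x : T -> 'I_n -> k.-tuple R) (bP : T -> k.-tuple R).
Hypothesis my : forall i, measurable_fun setT (y ^~ i).
Hypothesis mx : forall i, measurable_fun setT (x ^~ i).
Hypothesis mbP : measurable_fun setT bP.
Let X w i := vec (x w i).

Lemma measurable_pi_hat : measurable_fun setT (fun w => pi_hat (y w)).
Proof. by apply: measurable_funM => //; exact: measurable_sum. Qed.

Lemma measurable_zeta2_hat : measurable_fun setT (fun w => zeta2_hat (y w) (X w)).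
Proof.
apply: measurable_funM => //; apply: measurable_sum => i; apply: measurable_sum_cond => j _.
apply: measurable_funM; first exact: measurable_funM.
exact: measurable_dot.
Qed.

Lemma measurable_zeta_hat : measurable_fun setT (fun w => zeta_hat (y w) (X w)).
Proof. by apply: measurable_sqrt; apply: measurable_maxr => //; exact: measurable_zeta2_hat. Qed.

Lemma measurable_b_hat : measurable_fun setT (fun w => b_hat (y w) (X w) (vec (bP w))).
Proof.
apply: measurable_funM => //; apply: measurable_sum => i; apply: measurable_funM.
  by apply: measurable_funB => //; exact: measurable_pi_hat.
have -> : (fun w => dot (vec (bP w)) (X w i - xbar (X w))) =
    (fun w => \sum_j tnth (bP w) j * (tnth (x w i) j - n%:R^-1 * \sum_l tnth (x w l) j)).
  apply/funext => w; rewrite dot_sum; apply: eq_bigr => j _.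
  rewrite !mxE summxE; congr (_ * (_ - _ * _)).
  by apply: eq_bigr => l _; rewrite mxE.
apply: measurable_sum => j; apply: measurable_funM; first exact: measurable_tnth_comp.
apply: measurable_funB; first exact: measurable_tnth_comp.
by apply: measurable_funM => //; apply: measurable_sum => l; exact: measurable_tnth_comp.
Qed.

Let zeta_hat_ge0 w : 0 <= zeta_hat (y w) (X w).
Proof. exact: sqrtr_ge0. Qed.

Lemma measurable_theta0_hat : measurable_fun setT (fun w => theta0_hat (y w) (X w)).
Proof.
exact: (measurable_moment_est1 normal_m1_ge0 normal_m2_ge0 (@mom_pi_gt0 R) (@mom_pi_lt1 R)
  (@mom_pi_lt R) (@mom_pi_sup R) (@mom_pi_inf R) (@mom_pi_lip R) (@mom_zeta_lip R)
  (@mom_zeta0 R) (@mom_zeta_lt R) measurable_pi_hat measurable_zeta_hat zeta_hat_ge0).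
Qed.

Lemma measurable_gamma_hat : measurable_fun setT (fun w => gamma_hat (y w) (X w)).
Proof.
exact: (measurable_moment_est2 normal_m1_ge0 normal_m2_ge0 (@mom_pi_gt0 R) (@mom_pi_lt1 R)
  (@mom_pi_lt R) (@mom_pi_sup R) (@mom_pi_inf R) (@mom_pi_lip R) (@mom_zeta_lip R)
  (@mom_zeta_lt R) measurable_pi_hat measurable_zeta_hat).
Qed.

Lemma measurable_phi_hat : measurable_fun setT (fun w => phi_hat (y w) (X w) (vec (bP w))).
Proof.
pose m w := gamma_hat (y w) (X w) * delta_p (vec (bP w)).
pose t w := b_hat (y w) (X w) (vec (bP w)) / mom_c (theta0_hat (y w) (X w)) (gamma_hat (y w) (X w)).
have -> : (fun w => phi_hat (y w) (X w) (vec (bP w))) = (fun w => Num.max (- m w) (Num.min (t w) (m w))).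
  by apply/funext => w; exact: phi_hatE.
have mm : measurable_fun setT m.
  apply: measurable_funM; first exact: measurable_gamma_hat.
  apply: measurable_funM => //; apply: measurable_sqrt; exact: measurable_dot.
have mt : measurable_fun setT t.
  apply: measurable_div => [w||]; first exact/ltW/mom_c_gt0.
    exact: measurable_b_hat.
  by apply: measurable_mom_c; [exact: measurable_theta0_hat|exact: measurable_gamma_hat].
apply: measurable_maxr; first exact: measurable_funN.
exact: measurable_minr.
Qed.

End MeasurableEstimators.

(** * Deviation events, from frozen to random parameters *)

Section Deviation.
Context (R : realType) (n k : nat) (r B : R).
Variables (e : 'I_n -> R) (x : 'I_n -> k.-tuple R) (th : R) (b0 bP : k.-tuple R).

Let X i := vec (x i).
Let Y i := response (e i) th (X i) (vec b0).
Let gam := gauss_norm (Num.sqrt k%:R)^-1 (tnth b0).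

Definition pi_error : R := pi_hat Y - mom_pi th gam.
Definition zeta2_error : R := zeta2_hat Y X - mom_zeta th gam ^+ 2.
Definition b_error : R :=
  b_hat Y X (vec bP) - k%:R^-1 * dot (vec b0) (vec bP) * mom_c th gam.

Definition deviates : Prop := [\/ r < `|pi_error|, r < `|zeta2_error| | r < `|b_error|].

Definition bounded_params : Prop :=
  k%:R^-1 * (\sum_j tnth bP j ^+ 2) <= B /\ `|k%:R^-1 * dot (vec b0) (vec bP)| <= B.

End Deviation.

Section MeasurableDeviation.
Context d (S : measurableType d) (R : realType) (n k : nat) (r B : R).
Variables (e : S -> 'I_n -> R) (x : S -> 'I_n -> k.-tuple R) (th : S -> R) (b0 bP : S -> k.-tuple R).
Hypothesis me : forall i, measurable_fun setT (e ^~ i).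
Hypothesis mx : forall i, measurable_fun setT (x ^~ i).
Hypothesis mth : measurable_fun setT th.
Hypothesis mb0 : measurable_fun setT b0.
Hypothesis mbP : measurable_fun setT bP.

Let my i : measurable_fun setT (fun w => response (e w i) (th w) (vec (x w i)) (vec (b0 w))).
Proof. exact: measurable_response. Qed.

Let mgam : measurable_fun setT (fun w => gauss_norm (Num.sqrt k%:R)^-1 (tnth (b0 w))).
Proof.
apply: measurable_funM => //; apply: measurable_sqrt; apply: measurable_sum => j.
by apply: measurable_funX; exact: measurable_tnth_comp.
Qed.

Let mdot : measurable_fun setT (fun w => k%:R^-1 * dot (vec (b0 w)) (vec (bP w))).
Proof. by apply: measurable_funM => //; exact: measurable_dot. Qed.

Lemma measurable_set_norm_gt (f : S -> R) : measurable_fun setT f -> measurable [set w | r < `|f w|].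
Proof. by move=> mf; apply: measurable_set_lt => //; exact: measurableT_comp. Qed.

Let p1 w := pi_error (e w) (x w) (th w) (b0 w).
Let p2 w := zeta2_error (e w) (x w) (th w) (b0 w).
Let p3 w := b_error (e w) (x w) (th w) (b0 w) (bP w).

Lemma deviationE : [set w | deviates r (e w) (x w) (th w) (b0 w) (bP w)] =
  [set w | r < `|p1 w|] `|` [set w | r < `|p2 w|] `|` [set w | r < `|p3 w|].
Proof. by apply/seteqP; split => w; [case=> h; [left; left|left; right|right]|case=> [[h|h]|h]; [apply: Or31|apply: Or32|apply: Or33]]. Qed.

Lemma measurable_deviation : measurable [set w | deviates r (e w) (x w) (th w) (b0 w) (bP w)].
Proof.
rewrite deviationE.
apply: measurableU; first apply: measurableU; apply: measurable_set_norm_gt; apply: measurable_funB.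
- exact: (@measurable_pi_hat _ _ _ _ (fun w i => response (e w i) (th w) (vec (x w i)) (vec (b0 w)))).
- exact: measurable_mom_pi.
- exact: (@measurable_zeta2_hat _ _ _ _ _ (fun w i => response (e w i) (th w) (vec (x w i)) (vec (b0 w)))).
- by apply: measurable_funX; exact: measurable_mom_zeta.
- exact: (@measurable_b_hat _ _ _ _ _ (fun w i => response (e w i) (th w) (vec (x w i)) (vec (b0 w)))).
- by apply: measurable_funM => //; exact: measurable_mom_c.
Qed.

Lemma measurable_bounded_params : measurable [set w | bounded_params B (b0 w) (bP w)].
Proof.
apply: measurableI; apply: measurable_set_le => //.
  apply: measurable_funM => //; apply: measurable_sum => j; apply: measurable_funX.
  exact: measurable_tnth_comp.
exact: measurableT_comp.
Qed.

End MeasurableDeviation.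

Definition deviation_rate (R : realType) (n k : nat) (B r : R) : R :=
  (n%:R^-1 + (8 / n%:R + 8 * k%:R / (n%:R - 1) ^+ 2) +
     (24 * B / n%:R + 3 * B ^+ 2 / (n%:R - 1) ^+ 2)) / r ^+ 2.

Section RandomParameters.
Context d (T : measurableType d) (R : realType) (P : probability T R).
Context (n k : nat).
Variables (eps : 'I_n -> T -> R) (x : 'I_n -> T -> k.-tuple R).
Variables (th thP : T -> R) (b0 bP : T -> k.-tuple R).
Hypothesis k0 : (0 < k)%N.
Hypothesis n2 : (1 < n)%N.
Hypothesis meps : forall i, measurable_fun setT (eps i).
Hypothesis mx : forall i, measurable_fun setT (x i).
Hypothesis leps : forall i, has_law P (eps i) (uniform_prob (@ltr01 R)).
Hypothesis lx : forall i, isotropic_gaussian P (Num.sqrt k%:R)^-1 (x i).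
Hypothesis ieps : mutually_independent P eps.
Hypothesis ix : mutually_independent P x.
Hypothesis mth : measurable_fun setT th.
Hypothesis mthP : measurable_fun setT thP.
Hypothesis mb0 : measurable_fun setT b0.
Hypothesis mbP : measurable_fun setT bP.
Hypothesis eps_other : independent2 P (fun w => [tuple eps i w | i < n])
  (fun w => ([tuple x i w | i < n], (th w, thP w, b0 w, bP w))).
Hypothesis x_other : independent2 P (fun w => (th w, thP w, b0 w, bP w))
  (fun w => [tuple x i w | i < n]).

Let et w := [tuple eps i w | i < n].
Let xt w := [tuple x i w | i < n].
Let par w := (th w, thP w, b0 w, bP w).

Let met : measurable_fun setT et. Proof. exact: measurable_mktuple. Qed.
Let mxt : measurable_fun setT xt. Proof. exact: measurable_mktuple. Qed.
Let mpar : measurable_fun setT par.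
Proof. by do 3 apply: measurable_fun_pair => //. Qed.

Let epsx : independent2 P et xt.
Proof. exact: (independent2_comp (@measurable_id _ _ setT) measurable_fst eps_other). Qed.

(** [eps_other] detaches the noise from the design and the parameters together, and [x_other] then
    separates these two. *)
Let sample_par : independent2 P (fun w => (et w, xt w)) par.
Proof.
apply: independent2_pair => // A1 A2 B mA1 mA2 mB.
have := eps_other mA1 (measurableX mA2 mB).
have -> : (fun w => ([tuple x i w | i < n], (th w, thP w, b0 w, bP w))) @^-1` (A2 `*` B) =
    par @^-1` B `&` xt @^-1` A2 by rewrite setIC.
rewrite (x_other mB mA2) => H.
have -> : et @^-1` A1 `&` xt @^-1` A2 `&` par @^-1` B = et @^-1` A1 `&` (par @^-1` B `&` xt @^-1` A2).
  by rewrite -setIA [xt @^-1` A2 `&` _]setIC.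
by rewrite H (epsx mA1 mA2) muleA muleAC.
Qed.

Let Z := ((n.-tuple R * n.-tuple (k.-tuple R)) * ((R * R * k.-tuple R) * k.-tuple R))%type.

(** The bounded-parameter event depends on the parameters alone: once they are frozen, the inner
    probability is either 0 or covered by [frozen_deviation], with a rate that does not depend on
    their values. *)
Lemma deviation_le (B r : R) : 0 <= B -> 0 < r ->
  (P [set w | deviates r (eps ^~ w) (x ^~ w) (th w) (b0 w) (bP w) /\ bounded_params B (b0 w) (bP w)] <=
   (deviation_rate n k B r)%:E)%E.
Proof.
move=> B0 r0.
(* The event is written on the space of values, where its indicator is a function of (sample,
   parameters) and Tonelli applies. *)
pose DG : set Z :=
  [set z : Z | deviates r (fun i => tnth z.1.1 i) (fun i => tnth z.1.2 i) z.2.1.1.1 z.2.1.2 z.2.2 /\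
     bounded_params B z.2.1.2 z.2.2].
have m2 : measurable_fun setT (fun z : Z => z.2) by exact: measurable_snd.
have m21 : measurable_fun setT (fun z : Z => z.2.1) by exact: measurableT_comp measurable_fst m2.
have mDG : measurable DG.
  apply: measurableI.
    apply: (measurable_deviation r (e := fun z i => tnth z.1.1 i) (x := fun z i => tnth z.1.2 i)).
    - move=> i; apply: measurableT_comp (measurable_tnth i) _.
      exact: measurableT_comp measurable_fst measurable_fst.
    - move=> i; apply: measurableT_comp (measurable_tnth i) _.
      exact: measurableT_comp measurable_snd measurable_fst.
    - apply: measurableT_comp measurable_fst _; exact: measurableT_comp measurable_fst m21.
    - exact: measurableT_comp measurable_snd m21.
    - exact: measurableT_comp measurable_snd m2.
  apply: measurable_bounded_params.
    exact: measurableT_comp measurable_snd m21.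
  exact: measurableT_comp measurable_snd m2.
have tE (V : Type) (v : 'I_n -> T -> V) w : (fun i => tnth [tuple v i w | i < n] i) = v ^~ w.
  by apply/funext => i; rewrite tnth_mktuple.
have DGE w v : DG ((et v, xt v), par w) =
    (deviates r (eps ^~ v) (x ^~ v) (th w) (b0 w) (bP w) /\ bounded_params B (b0 w) (bP w)).
  by rewrite /DG /= tE tE.
have preE : [set w | deviates r (eps ^~ w) (x ^~ w) (th w) (b0 w) (bP w) /\ bounded_params B (b0 w) (bP w)] =
    (fun w => ((et w, xt w), par w)) @^-1` DG.
  by apply/funext => w; rewrite /preimage /mkset DGE.
have mpre : measurable ((fun w => ((et w, xt w), par w)) @^-1` DG).
  apply: measurable_preimage mDG; do 2 apply: measurable_fun_pair => //.
pose f (z : Z) : \bar R := (\1_DG z)%:E.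
have mf : measurable_fun setT f by exact/measurable_EFinP/measurable_indic.
have f0 z : (0 <= f z)%E by rewrite lee_fin.
rewrite preE -[X in P X]setIT -integral_indic//.
have -> : (\int[P]_w (\1_((fun w => ((et w, xt w), par w)) @^-1` DG) w)%:E =
    \int[P]_w f ((et w, xt w), par w))%E by [].
have mex : measurable_fun setT (fun w => (et w, xt w)) by exact: measurable_fun_pair.
rewrite (ge0_integral_independent2 mex mpar sample_par mf f0).
have K0 : 0 <= deviation_rate n k B r.
  have i0 : 0 <= n%:R^-1 :> R by rewrite invr_ge0.
  have j0 : 0 <= (n%:R - 1) ^- 2 :> R by rewrite invr_ge0 sqr_ge0.
  have B2 : 0 <= B ^+ 2 by exact: sqr_ge0.
  have k1 : 0 <= k%:R :> R by exact: ler0n.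
  by rewrite /deviation_rate divr_ge0 ?sqr_ge0// !(addr_ge0, mulr_ge0).
have inner w : (\int[P]_v f ((et v, xt v), par w) <= (deviation_rate n k B r)%:E)%E.
  have [[G1 G2]|nG] := pselect (bounded_params B (b0 w) (bP w)); last first.
    rewrite integral0_eq; first exact: K0.
    by move=> v _; rewrite /f indicE memNset// DGE => -[].
  pose D := [set v | deviates r (eps ^~ v) (x ^~ v) (th w) (b0 w) (bP w)].
  have mD : measurable D by apply: (measurable_deviation r (e := fun v i => eps i v) (x := fun v i => x i v)).
  have PD : (P D <= (deviation_rate n k B r)%:E)%E.
    have := frozen_deviation (th w) k0 n2 meps mx leps lx ieps ix epsx r0 G1 G2.
    by rewrite /D (deviationE r (fun v i => eps i v) (fun v i => x i v) (fun=> th w) (fun=> b0 w) (fun=> bP w)).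
  apply: (@le_trans _ _ (\int[P]_v (\1_D v)%:E)%E); last by rewrite integral_indic// setIT.
  apply: ge0_le_integral => //.
  - by apply: measurableT_comp mf _; apply: measurable_fun_pair.
  - exact/measurable_EFinP/measurable_indic.
  - move=> v _; rewrite lee_fin !indicE ler_nat.
    have [h|//] := boolP (((et v, xt v), par w) \in DG).
    by rewrite (mem_set (u := v))//; move: h; rewrite inE DGE => -[].
apply: (@le_trans _ _ (\int[P]_w (cst (deviation_rate n k B r)%:E w))%E); last first.
  by rewrite integral_cst//= probability_setT mule1.
apply: ge0_le_integral => //.
- by move=> w _; exact: integral_ge0.
- have mG : measurable_fun setT (fun a => \int[P]_v f ((et v, xt v), a))%E.
    apply: (measurable_fun_fubini_tonelli_G (m1 := P) (fun z => f ((et z.1, xt z.1), z.2))) => //.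
    apply: measurableT_comp mf _; apply: measurable_fun_pair; last exact: measurable_snd.
    exact: measurableT_comp mex measurable_fst.
  exact: (measurableT_comp mG mpar).
Qed.

End RandomParameters.

(** * The spectral norm of symmetric 2 x 2 matrices *)

(** Necessity comes from test vectors; for sufficiency with p > 0, multiply by p and complete the
    square. *)
Lemma psd2P (R : realFieldType) (p q s : R) :
  (forall x y, 0 <= p * x ^+ 2 + 2 * q * (x * y) + s * y ^+ 2) <->
  [/\ 0 <= p, 0 <= s & q ^+ 2 <= p * s].
Proof.
split=> [h|[p0 s0 qps] x y].
  have p0 : 0 <= p by have := h 1 0; rewrite expr1n expr0n/= !mulr0 mulr1 !addr0.
  have s0 : 0 <= s by have := h 0 1; rewrite expr1n expr0n/= !(mulr0,mul0r) mulr1 !add0r.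
  split=> //; move: p0; rewrite le_eqVlt => /predU1P[p0|p0].
    have [->|q0] := eqVneq q 0; first by rewrite expr0n/= -p0 mul0r.
    (* With p = 0 the form takes the value -1 here. *)
    have := h (- (s + 1) / (2 * q)) 1; rewrite -p0 expr1n !mulr1 mul0r add0r.
    by rewrite mulrCA divff ?mulf_neq0// mulr1; lra.
  (* The form equals p (p s - q^2) at this vector. *)
  by have := h q (- p); nra.
move: p0; rewrite le_eqVlt => /predU1P[p0|p0].
  have q0 : q = 0 by apply/eqP; rewrite -sqrf_eq0 eq_le sqr_ge0 andbT; move: qps; rewrite -p0 mul0r.
  by rewrite q0 -p0 mulr0 !mul0r !add0r mulr_ge0// sqr_ge0.
rewrite -(pmulr_rge0 _ p0).
have -> : p * (p * x ^+ 2 + 2 * q * (x * y) + s * y ^+ 2) =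
  (p * x + q * y) ^+ 2 + (p * s - q ^+ 2) * y ^+ 2 by ring.
by rewrite addr_ge0 ?sqr_ge0// mulr_ge0 ?sqr_ge0// subr_ge0.
Qed.

Section SpectralNorm2.
Context {R : realType}.
Implicit Types a b c t x y : R.

Let row2 x y : 'rV[R]_2 := \row_(j < 2) if j == 0 then x else y.

Let dot2 (u v : 'rV[R]_2) : dot u v = u 0 0 * v 0 0 + u 0 1 * v 0 1.
Proof.
rewrite dot_sum !big_ord_recl big_ord0 addr0.
by rewrite (_ : lift ord0 ord0 = 1)//; exact/val_inj.
Qed.

Let mul_symm a b c (v : 'rV[R]_2) :
  (v *m symmx2 a b c) 0 0 = a * v 0 0 + b * v 0 1 /\
  (v *m symmx2 a b c) 0 1 = b * v 0 0 + c * v 0 1.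
Proof.
have l1 : lift ord0 ord0 = 1 :> 'I_2 by exact/val_inj.
rewrite !mxE !big_ord_recl !big_ord0 !mxE/= !l1 /= !addr0.
by split; ring.
Qed.

Let tr_symm a b c : (symmx2 a b c)^T = symmx2 a b c :> 'M[R]_2.
Proof.
apply/matrixP => i j; rewrite !mxE eq_sym.
by case: eqVneq => // ->.
Qed.

Let l2norm_symm a b c v : l2norm (v *m (symmx2 a b c)^T) =
  Num.sqrt ((a * v 0 0 + b * v 0 1) ^+ 2 + (b * v 0 0 + c * v 0 1) ^+ 2).
Proof. by rewrite tr_symm /l2norm dot2 (mul_symm a b c v).1 (mul_symm a b c v).2 !expr2. Qed.

Let l2norm_ball x y : (l2norm (row2 x y) <= 1) = (x ^+ 2 + y ^+ 2 <= 1).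
Proof.
rewrite /l2norm dot2 !mxE/= -!expr2 -[X in _ <= X]sqrtr1 ler_sqrt//.
Qed.

Let ballE (v : 'rV[R]_2) : (l2norm v <= 1) = (v 0 0 ^+ 2 + v 0 1 ^+ 2 <= 1).
Proof. by rewrite /l2norm dot2 -!expr2 -[X in _ <= X]sqrtr1 ler_sqrt. Qed.

(** A supremum can be compared with t only for a nonempty bounded set; the bound is Cauchy-Schwarz
    on each row. *)
Lemma opnorm2_symmP a b c t : 0 <= t ->
  opnorm2 (symmx2 a b c) <= t <->
  forall x y, x ^+ 2 + y ^+ 2 <= 1 -> (a * x + b * y) ^+ 2 + (b * x + c * y) ^+ 2 <= t ^+ 2.
Proof.
move=> t0; set E := [set l2norm (v *m (symmx2 a b c)^T) | v in [set v : 'rV[R]_2 | l2norm v <= 1]].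
have E0 : E !=set0.
  exists (l2norm (0 *m (symmx2 a b c)^T)); exists 0 => //=.
  by rewrite ballE !mxE expr0n/= addr0 ler01.
have Eub : has_ubound E.
  exists (Num.sqrt (a ^+ 2 + b ^+ 2 + (b ^+ 2 + c ^+ 2))) => _ [v /= + <-].
  rewrite ballE l2norm_symm => v1; rewrite ler_wsqrtr//.
  move: (v 0 0) (v 0 1) v1 => x y xy.
  have CS p q : (p * x + q * y) ^+ 2 <= p ^+ 2 + q ^+ 2.
    apply: (@le_trans _ _ ((p ^+ 2 + q ^+ 2) * (x ^+ 2 + y ^+ 2))).
      by have := sqr_ge0 (p * y - q * x); nra.
    by rewrite -[leRHS]mulr1 ler_wpM2l// addr_ge0// sqr_ge0.
  by apply: lerD; exact: CS.
split=> [h x y xy|h].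
  have := ub_le_sup Eub; rewrite /ubound /= => /(_ (l2norm (row2 x y *m (symmx2 a b c)^T))).
  have xyb : l2norm (row2 x y) <= 1 by rewrite l2norm_ball.
  move=> /(_ (ex_intro2 _ _ (row2 x y) xyb erefl)) h1.
  have := le_trans h1 h; rewrite l2norm_symm !mxE/= => h2.
  rewrite -(@ler_sqrt _ _ (t ^+ 2)) ?sqr_ge0// sqrtr_sqr ger0_norm//.
apply: ge_sup => // _ [v /= + <-]; rewrite ballE l2norm_symm => vb.
by rewrite -[leRHS]ger0_norm// -sqrtr_sqr ler_wsqrtr// h.
Qed.

(** By homogeneity the inequality on the unit ball is an inequality on the plane, namely that the
    quadratic form of t^2 - M^2 is nonnegative; [psd2P] reads this off the entries. *)
Lemma opnorm2_symm_le a b c t : 0 <= t ->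
  opnorm2 (symmx2 a b c) <= t <->
  [/\ 0 <= t ^+ 2 - a ^+ 2 - b ^+ 2, 0 <= t ^+ 2 - b ^+ 2 - c ^+ 2 &
      (a * b + b * c) ^+ 2 <= (t ^+ 2 - a ^+ 2 - b ^+ 2) * (t ^+ 2 - b ^+ 2 - c ^+ 2)].
Proof.
move=> t0; rewrite opnorm2_symmP// -(sqrrN (a * b + b * c)) -psd2P.
have E x y : (t ^+ 2 - a ^+ 2 - b ^+ 2) * x ^+ 2 + 2 * - (a * b + b * c) * (x * y) +
    (t ^+ 2 - b ^+ 2 - c ^+ 2) * y ^+ 2 =
    t ^+ 2 * (x ^+ 2 + y ^+ 2) - ((a * x + b * y) ^+ 2 + (b * x + c * y) ^+ 2) by ring.
split=> h x y; last first.
  move=> xy; have := h x y; rewrite E subr_ge0 => /le_trans; apply.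
  by rewrite -[leRHS]mulr1 ler_wpM2l// sqr_ge0.
rewrite E subr_ge0; set N := x ^+ 2 + y ^+ 2.
have : 0 <= N by rewrite addr_ge0// sqr_ge0.
rewrite le_eqVlt => /predU1P[N0|N0].
  have [x0 y0] : x = 0 /\ y = 0.
    by have := sqr_ge0 x; have := sqr_ge0 y; split; apply/eqP; rewrite -sqrf_eq0; apply/eqP; rewrite /N in N0; lra.
  by rewrite -N0 x0 y0 !mulr0 addr0 expr0n/= addr0.
have s0 : 0 < Num.sqrt N by rewrite sqrtr_gt0.
have sN : Num.sqrt N ^+ 2 = N by rewrite sqr_sqrtr// ltW.
move: (Num.sqrt N) s0 sN => s s0 sN; have := h (x / s) (y / s).
rewrite !expr_div_n sN -mulrDl divff ?gt_eqF// => /(_ (lexx _)).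
have -> : (a * (x / s) + b * (y / s)) ^+ 2 + (b * (x / s) + c * (y / s)) ^+ 2 =
    ((a * x + b * y) ^+ 2 + (b * x + c * y) ^+ 2) / N.
  by rewrite -sN; field; rewrite gt_eqF.
by rewrite ler_pdivrMr.
Qed.

Lemma opnorm2_symm_entries a b c t : 0 <= t -> opnorm2 (symmx2 a b c) <= t ->
  [/\ `|a| <= t, `|b| <= t & `|c| <= t].
Proof.
move=> t0 /opnorm2_symm_le -/(_ t0)[h1 h2 _].
have S z : z ^+ 2 <= t ^+ 2 -> `|z| <= t.
  by rewrite -(real_normK (num_real z)) ler_pXn2r// nnegrE.
have := sqr_ge0 a; have := sqr_ge0 b; have := sqr_ge0 c.
by split; apply: S; lra.
Qed.

Lemma measurable_opnorm2_gt d (T : measurableType d) (a b c : T -> R) t : 0 <= t ->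
  measurable_fun setT a -> measurable_fun setT b -> measurable_fun setT c ->
  measurable [set w | t < opnorm2 (symmx2 (a w) (b w) (c w))].
Proof.
move=> t0 ma mb mc.
have mt : measurable_fun setT (fun _ : T => t) by exact: measurable_cst.
have m1 : measurable_fun setT (fun w => t ^+ 2 - a w ^+ 2 - b w ^+ 2).
  by apply: measurable_funB; [apply: measurable_funB|]; apply: measurable_funX.
have m2 : measurable_fun setT (fun w => t ^+ 2 - b w ^+ 2 - c w ^+ 2).
  by apply: measurable_funB; [apply: measurable_funB|]; apply: measurable_funX.
have m3 : measurable_fun setT (fun w => (a w * b w + b w * c w) ^+ 2).
  by apply: measurable_funX; apply: measurable_funD; apply: measurable_funM.
have -> : [set w | t < opnorm2 (symmx2 (a w) (b w) (c w))] =
    ~` ([set w | 0 <= t ^+ 2 - a w ^+ 2 - b w ^+ 2] `&` [set w | 0 <= t ^+ 2 - b w ^+ 2 - c w ^+ 2] `&`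
      [set w | (a w * b w + b w * c w) ^+ 2 <=
        (t ^+ 2 - a w ^+ 2 - b w ^+ 2) * (t ^+ 2 - b w ^+ 2 - c w ^+ 2)]).
  apply/seteqP; split => w /=; rewrite ltNge.
    by move=> /negP h [[h1 h2] h3]; apply: h; apply/opnorm2_symm_le.
  by move=> h; apply/negP => /opnorm2_symm_le -/(_ t0)[h1 h2 h3]; apply: h.
apply: measurableC; apply: measurableI; first apply: measurableI.
- exact: measurable_set_le.
- exact: measurable_set_le.
- by apply: measurable_set_le => //; exact: measurable_funM.
Qed.

Lemma psdmx_symm2 a b c : psdmx (symmx2 a b c) -> b ^+ 2 <= a * c.
Proof.
move=> [_ h]; have [_ _ //] : [/\ 0 <= a, 0 <= c & b ^+ 2 <= a * c].
apply/psd2P => x y; have := h (row2 x y); rewrite dot2 (mul_symm a b c _).1 (mul_symm a b c _).2 !mxE/=.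
by congr (0 <= _); ring.
Qed.

Lemma symmx2B a b c a' b' c' :
  symmx2 a b c - symmx2 a' b' c' = symmx2 (a - a') (b - b') (c - c').
Proof. by apply/matrixP => i j; rewrite !mxE; case: ifP => // _; case: ifP. Qed.

Lemma symmx2Z k a b c : k *: symmx2 a b c = symmx2 (k * a) (k * b) (k * c).
Proof. by apply/matrixP => i j; rewrite !mxE; case: ifP => // _; case: ifP. Qed.

End SpectralNorm2.

(** * Consistency *)

Section Perturbation.
Context {R : realType}.
Implicit Types (s m M t f : R).

(** For nonnegative numbers |g - g0| <= g + g0, so |g - g0|^2 <= |g^2 - g0^2|. Unlike a derivative
    bound for the square root, this works at g0 = 0. *)
Lemma sqr_close (g g0 s : R) : 0 <= g -> 0 <= g0 -> 0 <= s ->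
  `|g ^+ 2 - g0 ^+ 2| <= s ^+ 2 -> `|g - g0| <= s.
Proof.
move=> g_ge0 g0_ge0 s_ge0 /ler_normlP[h1 h2]; apply/ler_normlP; split; rewrite leNgt; apply/negP => h; nra.
Qed.

Lemma mul_close (a a0 b b0 s A B : R) : 0 <= s -> s <= 1 -> 0 <= A -> 0 <= B ->
  `|a - a0| <= A * s -> `|b - b0| <= B * s ->
  `|a * b - a0 * b0| <= (A * (`|b0| + B) + `|a0| * B) * s.
Proof.
move=> s0 s1 A0 B0 ha hb.
have -> : a * b - a0 * b0 = (a - a0) * b + a0 * (b - b0) by ring.
apply: le_trans (ler_normD _ _) _; rewrite !normrM mulrDl; apply: lerD; last first.
  by rewrite -mulrA ler_wpM2l.
have hb' : `|b| <= `|b0| + B.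
  have -> : b = b0 + (b - b0) by ring.
  apply: le_trans (ler_normD _ _) _; rewrite lerD2l; apply: le_trans hb _.
  by rewrite -[leRHS]mulr1 ler_wpM2l.
by rewrite mulrAC; apply: ler_pM.
Qed.

(** The clamp at level M fixes f, and a clamp is 1-Lipschitz both in its argument and in its
    level. *)
Lemma clip_close (t m f M : R) : 0 <= m -> `|f| <= M ->
  `|Num.max (- m) (Num.min t m) - f| <= `|t - f| + `|m - M|.
Proof.
move=> m0 /ler_normlP[f1 f2].
have := ler_norm (t - f); have := ler_norm (- (t - f)); rewrite normrN.
have := ler_norm (m - M); have := ler_norm (- (m - M)); rewrite normrN.
move: (`|t - f|) (`|m - M|) => u v h1 h2 h3 h4.
apply/ler_normlP; case: (leP t m) => tm.
  by case: (leP (- m) t) => h; split; lra.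
by case: (leP (- m) m) => h; split; lra.
Qed.

Lemma moments_close (th0 g0 f0 : R) : 0 <= g0 -> exists2 L, 0 < L &
  forall s th g f, 0 <= s -> s <= 1 -> `|th - th0| <= s -> 0 <= g ->
    `|g ^+ 2 - g0 ^+ 2| <= s ^+ 2 -> `|f - f0| <= s ->
  [/\ `|mom_pi th g - mom_pi th0 g0| <= L * s,
      `|mom_zeta th g ^+ 2 - mom_zeta th0 g0 ^+ 2| <= L * s &
      `|f * mom_c th g - f0 * mom_c th0 g0| <= L * s].
Proof.
move=> g00; have := @normal_m1_ge0 R; have := @normal_m2_ge0 R.
(* Only the Lipschitz inequalities matter from here on; the integrals become variables, hence atoms
   for the arithmetic. *)
move: (@mom_pi_lip R) (@mom_c_lip R) (@mom_zeta_lip R).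
move: (@normal_m1 R) (@normal_m2 R) (@mom_pi R) (@mom_c R) (@mom_zeta R).
move=> m1 m2 pi c zeta pil cl zl m20 m10.
pose A := m1 + m2; have A0 : 0 <= A by exact: addr_ge0.
pose L1 := 1 + m1; pose L2 := A * (`|zeta th0 g0| + A) + `|zeta th0 g0| * A.
pose L3 := 1 * (`|c th0 g0| + L1) + `|f0| * L1.
have L10 : 0 < L1 by rewrite /L1; lra.
have L20 : 0 <= L2 by rewrite /L2 addr_ge0 ?mulr_ge0 ?addr_ge0.
have L1_ge0 := ltW L10.
have L30 : 0 <= L3 by rewrite /L3 mul1r !addr_ge0 ?mulr_ge0.
exists (L1 + L2 + L3); first by lra.
move=> s th g f s0 s1 hth g_ge0 hg hf.
have hg' := sqr_close g_ge0 g00 s0 hg.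
have m1s : `|g - g0| * m1 <= s * m1 by rewrite ler_wpM2r.
have m2s : `|g - g0| * m2 <= s * m2 by rewrite ler_wpM2r.
have m3s : `|th - th0| * m1 <= s * m1 by rewrite ler_wpM2r.
have hpi : `|pi th g - pi th0 g0| <= L1 * s.
  by apply: le_trans (pil _ _ _ _) _; rewrite /L1; lra.
have hc : `|c th g - c th0 g0| <= L1 * s.
  by apply: le_trans (cl _ _ _ _) _; rewrite /L1; lra.
have hz : `|zeta th g - zeta th0 g0| <= A * s.
  by apply: le_trans (zl _ _ _ _) _; rewrite /A; lra.
have hf' : `|f - f0| <= 1 * s by rewrite mul1r.
have P1 : 0 <= L1 * s by rewrite mulr_ge0// ltW.
have P2 : 0 <= L2 * s by rewrite mulr_ge0.
have P3 : 0 <= L3 * s by rewrite mulr_ge0.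
have D3 a b u : (a + b + u) * s = a * s + b * s + u * s by ring.
rewrite (D3 L1 L2 L3); split; first by lra.
- have := mul_close s0 s1 A0 A0 hz hz; rewrite -/L2 -!expr2; lra.
- have := mul_close s0 s1 ler01 (ltW L10) hf' hc; rewrite -/L3; lra.
Qed.

(** A deterministic continuity statement: [moment_est_cvg] handles theta and gamma, and phi combines
    a quotient whose denominator stays away from 0 with a clamp whose limiting interval contains
    f0. *)
Lemma estimators_close (th0 g0 delta f0 e : R) : 0 <= g0 -> 0 <= delta ->
  f0 ^+ 2 <= g0 ^+ 2 * delta ^+ 2 -> 0 < e -> exists2 r, 0 < r &
  forall n k (y : 'I_n -> R) (x : 'I_n -> 'rV[R]_k) (bP : 'rV[R]_k),
    `|pi_hat y - mom_pi th0 g0| <= r ->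
    `|zeta2_hat y x - mom_zeta th0 g0 ^+ 2| <= r ->
    `|b_hat y x bP - f0 * mom_c th0 g0| <= r ->
    `|delta_p bP ^+ 2 - delta ^+ 2| <= r ->
  [/\ `|theta0_hat y x - th0| <= e, `|gamma_hat y x ^+ 2 - g0 ^+ 2| <= e &
      `|phi_hat y x bP - f0| <= e].
Proof.
move=> g00 d0 hf e0.
have KE (c l u : R) : c != 0 -> 2 / c * (1 + `|f0| * l) * u * (c / 2) = u + `|f0| * (l * u).
  by move=> c_neq0; field.
have quotE (b c c' : R) : c != 0 -> b / c - f0 = (b - f0 * c' + f0 * (c' - c)) / c.
  by move=> c_neq0; field.
have m10 := @normal_m1_ge0 R.
have c0 := mom_c_gt0 th0 g0.
have [C CE] : exists C, C = mom_c th0 g0 by exists (mom_c th0 g0).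
rewrite -CE in c0 *.
have fM : `|f0| <= g0 * delta.
  rewrite -(@ler_pXn2r _ 2)// ?nnegrE ?mulr_ge0// real_normK ?num_real//.
  by rewrite exprMn.
have [L1 L1E] : exists L1 : R, L1 = 1 + @normal_m1 R by eexists.
have L10 : 0 < L1 by rewrite L1E; lra.
(* For c >= C / 2 the error of b / c is at most (2 / C) (|b - f0 C| + |f0| |c - C|). *)
pose K := 2 / C * (1 + `|f0| * L1).
have L1_ge0 := ltW L10.
have C_ge0 := ltW c0.
have K0 : 0 <= K by rewrite /K mulr_ge0 ?divr_ge0 ?addr_ge0 ?mulr_ge0.
have KsE u : K * u * (C / 2) = u + `|f0| * (L1 * u) by exact: KE (lt0r_neq0 c0).
(* One summand per error: 2 g0 + 1 for gamma^2, K for the quotient, delta + 1 + g0 for the clipping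
   level, and 1 for theta. *)
clearbody K; pose L := 2 * g0 + 1 + K + (delta + 1 + g0) + 1.
have L0 : 0 < L by rewrite /L; lra.
(* The last entry guarantees |c - C| <= C / 2. *)
pose s := Num.min 1 (Num.min (e / L) (C / (2 * L1))).
have s0 : 0 < s by rewrite !lt_min ltr01 !divr_gt0// mulr_gt0.
have s1 : s <= 1 by rewrite ge_min lexx.
have sL : L * s <= e.
  by rewrite mulrC -ler_pdivlMr// /s !ge_min lexx/= orbT.
have sC : L1 * s <= C / 2.
  rewrite mulrC -ler_pdivlMr//; apply: (@le_trans _ _ (C / (2 * L1))).
    by rewrite /s !ge_min lexx !orbT.
  by rewrite invfM mulrA.
have [r1 r10 hr1] := moment_est_cvg normal_m1_ge0 normal_m2_ge0 (@mom_pi_gt0 R) (@mom_pi_lt1 R)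
  (@mom_pi_lt R) (@mom_pi_sup R) (@mom_pi_inf R) (@mom_pi_lip R) (@mom_zeta_lip R)
  (@mom_zeta0 R) (@mom_zeta_lt R) th0 g00 s0.
(* Zeta and delta are known through their squares, whence the squared tolerances. *)
pose r := Num.min r1 (Num.min (r1 ^+ 2) (s ^+ 2)).
have r0 : 0 < r by rewrite !lt_min r10 !exprn_gt0.
have rr1 : r <= r1 by rewrite ge_min lexx.
have rr2 : r <= r1 ^+ 2 by rewrite /r !ge_min lexx !orbT.
have rs : r <= s ^+ 2 by rewrite /r !ge_min lexx !orbT.
have rs1 : r <= s by apply: (le_trans rs); rewrite expr2 -[leRHS]mulr1 ler_wpM2l// ltW.
exists r => // n k y x bP hpi hz hb hd.
have z0 : 0 <= mom_zeta th0 g0 by rewrite mom_zetaE mulr_ge0// -CE ltW.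
have zh0 : 0 <= zeta_hat y x by exact: sqrtr_ge0.
have hz' : `|mom_zeta th0 g0 - zeta_hat y x| <= r1.
  rewrite distrC; apply: sqr_close => //; first exact: ltW.
  apply: le_trans rr2; apply: le_trans hz.
  rewrite /zeta_hat sqr_sqrtr ?le_max ?lexx ?orbT//.
  (* The target is nonnegative, so truncation at 0 does not increase the distance to it. *)
  have z20 := sqr_ge0 (mom_zeta th0 g0).
  move: (zeta2_hat y x) (mom_zeta th0 g0 ^+ 2) z20 => a b b0.
  case: (leP a 0) => // a0.
  by rewrite sub0r normrN ger0_norm// ler0_norm; lra.
have hpi' : `|mom_pi th0 g0 - pi_hat y| <= r1 by rewrite distrC (le_trans hpi).
have [_ hth hg] := hr1 _ _ zh0 hpi' hz'.
have hth' : `|theta0_hat y x - th0| <= s by rewrite distrC.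
have hg' : `|gamma_hat y x - g0| <= s by rewrite distrC.
have gh0 := gamma_hat_ge0 y x.
have dp0 : 0 <= delta_p bP by rewrite mulr_ge0 ?invr_ge0 ?sqrtr_ge0.
have hd' : `|delta_p bP - delta| <= s.
  by apply: sqr_close => //; [exact: ltW|exact: le_trans hd rs].
have s_ge0 := ltW s0.
have Ks : 0 <= K * s by exact: mulr_ge0.
have g0s : 0 <= g0 * s by exact: mulr_ge0.
have ds : 0 <= delta * s by exact: mulr_ge0.
have LE : L * s = 2 * (g0 * s) + s + K * s + (delta * s + s + g0 * s) + s by rewrite /L; ring.
rewrite LE in sL.
split; first by lra.
  have h1 : `|gamma_hat y x - g0| <= 1 * s by rewrite mul1r.
  have := mul_close s_ge0 s1 ler01 ler01 h1 h1.
  rewrite -!expr2 (ger0_norm g00); lra.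
rewrite phi_hatE; set m := gamma_hat y x * delta_p bP.
have m0 : 0 <= m by exact: mulr_ge0.
apply: le_trans (clip_close (phi_tilde y x bP) m0 fM) _.
have hm : `|m - g0 * delta| <= (delta + 1 + g0) * s.
  have h1 : `|gamma_hat y x - g0| <= 1 * s by rewrite mul1r.
  have h2 : `|delta_p bP - delta| <= 1 * s by rewrite mul1r.
  have := mul_close s_ge0 s1 ler01 ler01 h1 h2.
  by rewrite (ger0_norm g00) (ger0_norm d0) mul1r mulr1.
have ht : `|phi_tilde y x bP - f0| <= K * s.
  rewrite /phi_tilde; set c := mom_c _ _.
  have cC : `|c - C| <= L1 * s.
    have -> : L1 * s = s + s * @normal_m1 R by rewrite L1E; ring.
    rewrite CE.
    by apply: le_trans (mom_c_lip _ _ _ _) _; apply: lerD => //; exact: ler_wpM2r.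
  have cC2 : C / 2 <= c by move: cC => /ler_normlP[]; lra.
  have c_gt0 : 0 < c by apply: lt_le_trans cC2; rewrite divr_gt0.
  rewrite (quotE _ c C (lt0r_neq0 c_gt0)) normrM normfV (gtr0_norm c_gt0) ler_pdivrMr//.
  apply: (@le_trans _ _ (K * s * (C / 2))); last by rewrite ler_wpM2l.
  rewrite KsE.
  apply: le_trans (ler_normD _ _) _; apply: lerD; first exact: le_trans hb rs1.
  by rewrite normrM ler_wpM2l// distrC.
have mE : (delta + 1 + g0) * s = delta * s + s + g0 * s by ring.
rewrite mE in hm; lra.
Qed.

End Perturbation.

Section Rates.
Context {R : realType}.

(** For n >= 2, n - 1 >= n / 2, so each (n - 1)^-2 costs a factor 4. Thus 41 = 1 + 8 + 32, using k
    <= n, and 12 = 3 times 4. *)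
Lemma deviation_rate_le (n k : nat) (B r : R) : (1 < n)%N -> (k <= n)%N -> 0 <= B ->
  deviation_rate n k B r <= (41 + 24 * B + 12 * B ^+ 2) / r ^+ 2 / n%:R.
Proof.
move=> n2 kn B0; rewrite /deviation_rate [leRHS]mulrAC ler_wpM2r ?invr_ge0 ?sqr_ge0//.
have n2R : 2 <= n%:R :> R by rewrite ler_nat.
have knR : k%:R <= n%:R :> R by rewrite ler_nat.
have k0 : 0 <= k%:R :> R by [].
move: (n%:R) (k%:R) n2R knR k0 => N K N2 KN K0.
have N0 : 0 < N by lra.
have N1 : 0 < N - 1 by lra.
have sqN : (N - 1) ^- 2 <= 4 / N ^+ 2.
  rewrite -[4 / _]invrK lef_pV2 ?posrE ?exprn_gt0 ?invr_gt0 ?divr_gt0 ?exprn_gt0//.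
  by rewrite invf_div ler_pdivrMr//; nra.
have h1 : 8 * K / (N - 1) ^+ 2 <= 32 / N.
  apply: (@le_trans _ _ (8 * N * (4 / N ^+ 2))).
    by apply: ler_pM => //; [rewrite mulr_ge0|rewrite invr_ge0 sqr_ge0|rewrite ler_wpM2l].
  by rewrite le_eqVlt; apply/orP; left; apply/eqP; field; rewrite gt_eqF.
have h2 : 3 * B ^+ 2 / (N - 1) ^+ 2 <= 12 * B ^+ 2 / N.
  apply: (@le_trans _ _ (3 * B ^+ 2 * (4 / N))).
    apply: ler_wpM2l; first by rewrite mulr_ge0// sqr_ge0.
    apply: (le_trans sqN); rewrite ler_wpM2l// lef_pV2 ?posrE ?exprn_gt0//.
    by rewrite expr2 ler_peMl//; lra.
  by rewrite le_eqVlt; apply/orP; left; apply/eqP; field; rewrite gt_eqF.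
have -> : (41 + 24 * B + 12 * B ^+ 2) / N = N^-1 + (8 / N + 32 / N) + (24 * B / N + 12 * B ^+ 2 / N).
  by field; rewrite gt_eqF.
lra.
Qed.

(** The exponential tails are weakened, by exp t >= t, to the order 1 / n of the Chebyshev
    bounds. *)
Lemma expR_rate (c m : R) (n : nat) : 0 < c -> 0 < m -> (0 < n)%N ->
  expR (- (c * n%:R * m)) <= (c * m)^-1 / n%:R.
Proof.
move=> c0 m0 n0; have n0R : 0 < n%:R :> R by rewrite ltr0n.
rewrite expRN -invfM lef_pV2 ?posrE ?expR_gt0 ?mulr_gt0//.
by have := expR_ge1Dx (c * n%:R * m); rewrite mulrAC; lra.
Qed.

Lemma cvg_prob_rate d (T : measurableType d) (P : probability T R) (A : nat -> set T) (C : R) :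
  (\forall n \near \oo, (P (A n) <= (C / n%:R)%:E)%E) -> P (A n) @[n --> \oo] --> 0%E.
Proof.
move=> H; apply: (squeeze_cvge (f := fun=> 0%E) (h := fun n => (C / n%:R)%:E)).
- by near=> n; rewrite measure_ge0/=; near: n.
- exact: cvg_cst.
- apply: cvg_EFin; first by near=> n.
  rewrite -(mulr0 C); apply: cvgM; first exact: cvg_cst.
  apply/gtr0_cvgV0; last exact: cvgr_idn.
  by near=> n; rewrite ltr0n; near: n; exact: nbhs_infty_gt.
Unshelve. all: by end_near.
Qed.

End Rates.

(** The deterministic core of the theorem: half of the tolerance r pays for the sampling error at
    the actual parameters, the other half for the distance of their moments from the limits. *)
Lemma event_cover (R : realType) (th0 g0 delta f0 e : R) : 0 <= g0 -> 0 <= delta ->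
  f0 ^+ 2 <= g0 ^+ 2 * delta ^+ 2 -> 0 < e ->
  exists r s t B : R, [/\ 0 < r, 0 < s, 0 < t, 0 <= B &
    forall n k (eps : 'I_n -> R) (x : 'I_n -> k.-tuple R) th (b0 bP : k.-tuple R),
    `|th - th0| <= s ->
    opnorm2 (Gram2 (vec b0) (vec bP) - symmx2 (g0 ^+ 2) f0 (delta ^+ 2)) <= t ->
    bounded_params B b0 bP /\ (~ deviates r eps x th b0 bP ->
      let X := fun i => vec (x i) in
      let Y := fun i => response (eps i) th (X i) (vec b0) in
      [/\ `|theta0_hat Y X - th0| <= e, `|gamma_hat Y X ^+ 2 - g0 ^+ 2| <= e &
          `|phi_hat Y X (vec bP) - f0| <= e])].
Proof.
move=> g00 d0 hf e0.
have [r r0 hr] := estimators_close th0 g00 d0 hf e0.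
have [L L0 hL] := moments_close th0 f0 g00.
pose s := Num.min 1 (r / 2 / L).
have r20 : 0 < r / 2 by rewrite divr_gt0.
have s0 : 0 < s by rewrite lt_min ltr01 divr_gt0.
have s1 : s <= 1 by rewrite ge_min lexx.
have sL : L * s <= r / 2 by rewrite mulrC -ler_pdivlMr// ge_min lexx orbT.
(* The Gram matrix controls only the square of gamma, hence s^2; the r is for delta^2. *)
pose t := Num.min (s ^+ 2) r.
have t0 : 0 < t by rewrite lt_min exprn_gt0.
have ts : t <= s ^+ 2 by rewrite ge_min lexx.
have tr : t <= r by rewrite ge_min lexx orbT.
have ts1 : t <= s by apply: (le_trans ts); rewrite expr2 -[leRHS]mulr1 ler_wpM2l// ltW.
have t1 : t <= 1 by exact: le_trans ts1 s1.
(* As t <= 1, each Gram entry is within 1 of its limit, so this B bounds both quantities in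
   [bounded_params]. *)
exists (r / 2), s, t, (delta ^+ 2 + `|f0| + 1); split => //.
  by rewrite !addr_ge0// sqr_ge0.
move=> n k eps x th b0 bP hth hop.
have l2sq (b : k.-tuple R) : l2norm (vec b) ^+ 2 = \sum_j tnth b j ^+ 2.
  rewrite /l2norm dot_vec; under eq_bigr do rewrite -expr2.
  by rewrite sqr_sqrtr// sumr_ge0// => j _; exact: sqr_ge0.
have := opnorm2_symm_entries (ltW t0); rewrite /Gram2 symmx2Z symmx2B in hop * => /(_ _ _ _ hop).
rewrite !l2sq => -[hg hfd hd].
have gE : gauss_norm (Num.sqrt k%:R)^-1 (tnth b0) ^+ 2 = k%:R^-1 * \sum_j tnth b0 j ^+ 2.
  rewrite /gauss_norm exprMn exprVn !sqr_sqrtr//.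
  by rewrite sumr_ge0// => j _; exact: sqr_ge0.
have dE : delta_p (vec bP) ^+ 2 = k%:R^-1 * \sum_j tnth bP j ^+ 2.
  by rewrite /delta_p expr_div_n l2sq sqr_sqrtr// mulrC.
split.
  split.
    move: hd; move: (k%:R^-1 * _) => a /ler_normlP[_ h].
    by have := normr_ge0 f0; lra.
  move: hfd; move: (k%:R^-1 * _) => a h.
  have -> : a = f0 + (a - f0) by ring.
  apply: le_trans (ler_normD _ _) _; have := sqr_ge0 delta; lra.
move=> ndev.
have gam0 : 0 <= gauss_norm (Num.sqrt k%:R)^-1 (tnth b0).
  by rewrite mulr_ge0 ?invr_ge0 ?sqrtr_ge0.
have := hL s th (gauss_norm (Num.sqrt k%:R)^-1 (tnth b0)) (k%:R^-1 * dot (vec b0) (vec bP))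
  (ltW s0) s1 hth gam0.
rewrite gE => /(_ (le_trans hg ts) (le_trans hfd ts1))[m1 m2 m3].
have tri (a b c : R) : ~ (r / 2 < `|a - b|) -> `|b - c| <= L * s -> `|a - c| <= r.
  move=> /negP; rewrite -leNgt => h1 h2.
  have -> : a - c = (a - b) + (b - c) by ring.
  by apply: le_trans (ler_normD _ _) _; lra.
apply: hr.
- by apply: tri m1 => h; apply: ndev; apply: Or31.
- by apply: tri m2 => h; apply: ndev; apply: Or32.
- by apply: tri m3 => h; apply: ndev; apply: Or33.
- by rewrite dE; exact: le_trans hd tr.
Qed.

Theorem proposition7p1 (R : realType) (d : measure_display)
  (T : measurableType d) (P : probability T R)
  (p : nat -> nat) (kappa : R)
  (hkappa : 0 < kappa < 1)
  (hp : (p n)%:R / n%:R @[n --> \oo] --> kappa)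
  (x : forall n, 'I_n -> {RV P >-> (p n).-tuple R})
  (eps : forall n, 'I_n -> {RV P >-> R})
  (beta0 betaP : forall n, {RV P >-> (p n).-tuple R})
  (theta0 thetaP : nat -> {RV P >-> R})
  (hx_law : forall n (i : 'I_n),
     isotropic_gaussian P (Num.sqrt (p n)%:R)^-1 (x n i))
  (hx_indep : forall n, mutually_independent P (x n))
  (heps_law : forall n (i : 'I_n),
     has_law P (eps n i) (uniform_prob (@ltr01 R)))
  (heps_indep : forall n, mutually_independent P (eps n))
  (heps_other : forall n, independent2 P
     (fun w => [tuple eps n i w | i < n])
     (fun w => ([tuple x n i w | i < n],
                (theta0 n w, thetaP n w, beta0 n w, betaP n w))))
  (gamma delta phi : R) (hgamma : 0 <= gamma) (hdelta : 0 <= delta)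
  (hGamma_psd : psdmx (symmx2 (gamma ^+ 2) phi (delta ^+ 2)))
  (hGamma_conc : exists cG CG : R, exists n0 : nat, [/\ 0 < cG, 0 < CG &
     forall (n : nat) (t : R), (n0 < n)%N -> 0 < t ->
       (P [set w | (t < opnorm2 (Gram2 (vec (beta0 n w)) (vec (betaP n w))
                                - symmx2 (gamma ^+ 2) phi (delta ^+ 2)))%R]
        <= (CG * expR (- (cG * n%:R * Num.min (t ^+ 2) t)))%:E)%E])
  (hwasserstein : exists nu : probability (R * R)%type R,
     {ae P, forall w,
       wasserstein2 (empirical2 (beta0 n w) (betaP n w)) nu @[n --> \oo] --> 0%E})
  (theta0s thetaPs : R)
  (htheta_conc : exists cT CT : R, exists n0 : nat, [/\ 0 < cT, 0 < CT &
     forall (n : nat) (t : R), (n0 < n)%N -> 0 < t ->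
       (P [set w | (t < Num.max `|theta0 n w - theta0s| `|thetaP n w - thetaPs|)%R]
        <= (CT * expR (- (cT * n%:R * t ^+ 2)))%:E)%E])
  (hx_other : forall n, independent2 P
     (fun w => (theta0 n w, thetaP n w, beta0 n w, betaP n w))
     (fun w => [tuple x n i w | i < n])) :
  cvg_in_prob P
    (fun n w =>
       let X := fun i : 'I_n => vec (x n i w) in
       let Y := fun i : 'I_n =>
         response (eps n i w) (theta0 n w) (X i) (vec (beta0 n w)) in
       response_moment_estimators Y X (vec (betaP n w)))
    (theta0s, gamma ^+ 2, phi).
Proof.
have psd := psdmx_symm2 hGamma_psd.
move=> e e0.
have [r [s [t [B [r0 s0 t0 B0 cover]]]]] := event_cover theta0s hgamma hdelta psd e0.
have [cG [CG [nG [cG0 CG0 concG]]]] := hGamma_conc.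
have [cT [CT [nT [cT0 CT0 concT]]]] := htheta_conc.
have /andP[kappa0 kappa1] := hkappa.
(* Positivity of kappa excludes p = 0, and kappa < 1 gives p <= n below, which turns p / n^2 into 1
   / n. *)
have p_gt0 : \forall n \near \oo, (0 < p n)%N.
  have : \forall n \near \oo, 0 < (p n)%:R / n%:R :> R by exact: (cvgr_gt _ hp).
  apply: filterS => n; rewrite lt0n; case: (p n) => //; rewrite mul0r ltxx//.
have p_len : \forall n \near \oo, (p n <= n)%N.
  have : \forall n \near \oo, (p n)%:R / n%:R < 1 :> R by exact: (cvgr_lt _ hp).
  apply: filter_app; near=> n.
  have n0 : 0 < n%:R :> R by rewrite ltr0n; near: n; exact: nbhs_infty_gt.
  by rewrite ltr_pdivrMr// mul1r ltr_nat => /ltnW.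
set CD := (41 + 24 * B + 12 * B ^+ 2) / r ^+ 2.
(* One constant per way to fail: a deviation at bounded parameters, the intercepts, the Gram
   matrix. *)
pose C := CD + (CT / (cT * s ^+ 2) + CG / (cG * Num.min (t ^+ 2) t)).
apply: (cvg_prob_rate (C := C)); near=> n.
have n1 : (1 < n)%N by near: n; exact: nbhs_infty_gt.
have pn0 : (0 < p n)%N by near: n.
have pnn : (p n <= n)%N by near: n.
have nGn : (nG < n)%N by near: n; exact: nbhs_infty_gt.
have nTn : (nT < n)%N by near: n; exact: nbhs_infty_gt.
have mx i : measurable_fun setT (x n i) by exact: measurable_funP.
have meps i : measurable_fun setT (eps n i) by exact: measurable_funP.
have mth : measurable_fun setT (theta0 n) by exact: measurable_funP.
have mthP : measurable_fun setT (thetaP n) by exact: measurable_funP.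
have mb0 : measurable_fun setT (beta0 n) by exact: measurable_funP.
have mbP : measurable_fun setT (betaP n) by exact: measurable_funP.
pose X w (i : 'I_n) := vec (x n i w).
pose Y w (i : 'I_n) := response (eps n i w) (theta0 n w) (X w i) (vec (beta0 n w)).
pose AD := [set w | deviates r (fun i => eps n i w) (fun i => x n i w) (theta0 n w) (beta0 n w) (betaP n w)
  /\ bounded_params B (beta0 n w) (betaP n w)].
pose AT := [set w | s < Num.max `|theta0 n w - theta0s| `|thetaP n w - thetaPs|].
pose AG := [set w | t < opnorm2 (Gram2 (vec (beta0 n w)) (vec (betaP n w)) -
  symmx2 (gamma ^+ 2) phi (delta ^+ 2))].
set A := [set w | _].
have mAD : measurable AD.
  apply: measurableI.
    exact: (measurable_deviation r (e := fun w i => eps n i w) (x := fun w i => x n i w)).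
  exact: measurable_bounded_params.
have mAT : measurable AT.
  apply: measurable_set_lt => //; apply: measurable_maxr; apply: measurableT_comp => //.
    exact: measurable_funB.
  exact: measurable_funB.
have mAG : measurable AG.
  rewrite /AG /Gram2; under eq_set do rewrite symmx2Z symmx2B.
  have ml2 (b : T -> (p n).-tuple R) : measurable_fun setT b ->
      measurable_fun setT (fun w => l2norm (vec (b w)) ^+ 2).
    by move=> mb; apply: measurable_funX; apply: measurable_sqrt; exact: measurable_dot.
  apply: measurable_opnorm2_gt; first exact: ltW.
  - by apply: measurable_funB => //; apply: measurable_funM => //; exact: ml2.
  - by apply: measurable_funB => //; apply: measurable_funM => //; exact: measurable_dot.
  - by apply: measurable_funB => //; apply: measurable_funM => //; exact: ml2.
have mY i : measurable_fun setT (Y ^~ i) by exact: measurable_response.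
(* The norm on a product is the maximum, so the three coordinates can be treated separately. *)
have normE w : `|response_moment_estimators (Y w) (X w) (vec (betaP n w)) - (theta0s, gamma ^+ 2, phi)| =
    Num.max (Num.max `|theta0_hat (Y w) (X w) - theta0s| `|gamma_hat (Y w) (X w) ^+ 2 - gamma ^+ 2|)
      `|phi_hat (Y w) (X w) (vec (betaP n w)) - phi|.
  by rewrite !prod_normE.
have AE : A = [set w | e < Num.max (Num.max `|theta0_hat (Y w) (X w) - theta0s|
    `|gamma_hat (Y w) (X w) ^+ 2 - gamma ^+ 2|) `|phi_hat (Y w) (X w) (vec (betaP n w)) - phi|].
  by apply/funext => w; rewrite /A /mkset -normE.
have mA : measurable A.
  rewrite AE; apply: measurable_set_lt => //.
  apply: measurable_maxr; first apply: measurable_maxr; apply: measurableT_comp => //; apply: measurable_funB => //.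
  - exact: (measurable_theta0_hat mY mx).
  - by apply: measurable_funX; exact: (measurable_gamma_hat mY mx).
  - exact: (measurable_phi_hat mY mx mbP).
(* Off [AT] and [AG] the parameters are bounded automatically, so the only failure left is a
   deviation, and it belongs to [AD]. *)
have sub : A `<=` AD `|` (AT `|` AG).
  move=> w; rewrite AE /mkset => Aw; apply: contrapT => /not_orP[nD /not_orP[nT' nG']].
  have hth : `|theta0 n w - theta0s| <= s.
    by move/negP: nT'; rewrite -leNgt ge_max => /andP[].
  have hG : opnorm2 (Gram2 (vec (beta0 n w)) (vec (betaP n w)) - symmx2 (gamma ^+ 2) phi (delta ^+ 2)) <= t.
    by move/negP: nG'; rewrite -leNgt.
  have [bd H] := cover n (p n) (fun i => eps n i w) (fun i => x n i w) _ _ _ hth hG.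
  have ndev : ~ deviates r (fun i => eps n i w) (fun i => x n i w) (theta0 n w) (beta0 n w) (betaP n w).
    by move=> h; apply: nD.
  have [h1 h2 h3] := H ndev.
  by move: Aw; rewrite !lt_max !ltNge h1 h2 h3.
apply: (@le_trans _ _ (P (AD `|` (AT `|` AG)))).
  by apply: le_measure; rewrite ?inE//; apply: measurableU => //; exact: measurableU.
apply: (@le_trans _ _ (P AD + (P AT + P AG))%E).
  apply: le_trans (measureU2 _ _ _) _ => //; first exact: measurableU.
  by apply: leeD => //; exact: measureU2.
have n0 : (0 < n)%N by exact: ltnW.
rewrite /C !mulrDl !EFinD; apply: leeD; last apply: leeD.
- apply: (@le_trans _ _ (deviation_rate n (p n) B r)%:E); last first.
    by rewrite lee_fin; exact: deviation_rate_le.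
  exact: (deviation_le (thP := thetaP n) pn0 n1 meps mx (heps_law n) (hx_law n) (heps_indep n) (hx_indep n)
    mth mthP mb0 mbP (heps_other n) (hx_other n) B0 r0).
- apply: le_trans (concT n s nTn s0) _; rewrite lee_fin -[leRHS]mulrA ler_wpM2l ?(ltW CT0)//.
  by apply: expR_rate => //; rewrite exprn_gt0.
- apply: le_trans (concG n t nGn t0) _; rewrite lee_fin -[leRHS]mulrA ler_wpM2l ?(ltW CG0)//.
  by apply: expR_rate => //; rewrite lt_min exprn_gt0.
Unshelve. all: by end_near.
Qed.
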